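(* Suppose that all orbits in $X$ are of the same finite order (i.e. there is an integer $p\geq1$ such that every orbit in $X$ has exactly $p$ elements). Then the structure space $\Pi_{\ell^1}$ of $\ell^1(\Sigma)$ is homeomorphic to $(X/\mathbb{Z})\times\mathbb{T}$.
   Context: $X$ is a non-empty compact Hausdorff space, $\sigma:X\to X$ is a homeomorphism, $\Sigma=(X,\sigma)$, and $\mathbb{Z}$ acts on $X$ via $n\mapsto\sigma^n$; orbits are orbits of this action, and $X/\mathbb{Z}$ is the orbit space with the quotient topology. $\mathbb{T}$ is the unit circle in $\mathbb{C}$. $C(X)$ carries the supremum norm and $\alpha(f)=f\circ\sigma^{-1}$. $\ell^1(\Sigma)$ is the Banach space of all $a:\mathbb{Z}\to C(X)$ with $\|a\|=\sum_n\|a(n)\|<\infty$, with multiplication $(aa')(n)=\sum_{k\in\mathbb{Z}}a(k)\,\alpha^k(a'(n-k))$; it is a unital Banach algebra. A representation of an algebra $A$ on a complex vector space $E$ is algebraically irreducible if $\pi(A)E\ne\{0\}$ and the only invariant subspaces are $\{0\}$ and $E$; a primitive ideal is the kernel of such a representation. The structure space $\Pi_{\ell^1}$ of $\ell^1(\Sigma)$ is the set of all its primitive ideals with the hull-kernel topology: the closure of $E\subset\Pi_{\ell^1}$ is $\{P\in\Pi_{\ell^1}:P\supset\bigcap_{Q\in E}Q\}$. *)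

(* Defs.v *)
From HB Require Import structures.
From mathcomp Require Import all_boot all_order all_algebra finmap.
From mathcomp Require Import all_classical all_reals all_analysis.
From mathcomp.analysis.showcase Require summability.
From mathcomp Require Import complex ring lra.

Set Implicit Arguments.
Unset Strict Implicit.
Unset Printing Implicit Defensive.

Import Order.TTheory GRing.Theory Num.Theory.
Import numFieldNormedType.Exports.
Import ComplexField.Normc.

Local Open Scope classical_set_scope.
Local Open Scope ring_scope.

(* The field of complex numbers; wrapping R[i] as a [numClosedFieldType] gives it
   the topology and norm that the analysis library puts on such fields. *)
Definition Cplx (R : realType) : numClosedFieldType := R[i].

(* Unordered summability: convergence along the finite subsets of the index
   type. *)
Definition has_sum (K : numFieldType) (I : choiceType) (f : I -> K) (s : K) :=
  forall e : K, 0 < e -> exists A : {fset I}, forall B : {fset I},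
    (A `<=` B)%fset -> `|s - \sum_(i <- B) f i| < e.

Definition bounded_sums (R : realType) (I : choiceType) (u : I -> R) (M : R) :=
  forall B : {fset I}, \sum_(i <- B) u i <= M.

Section HasSum.
Context {K : numFieldType}.
Implicit Types I J : choiceType.

Lemma small_eq (x y : K) : (forall e, 0 < e -> `|x - y| < e) -> x = y.
Proof.
move=> h; apply/eqP; rewrite -subr_eq0 -normr_eq0; apply/negPn/negP => n0.
have /h : 0 < `|x - y| by rewrite lt_neqAle eq_sym n0 normr_ge0.
by rewrite ltxx.
Qed.

Lemma has_sum_uniq I (f : I -> K) s t : has_sum f s -> has_sum f t -> s = t.
Proof.
move=> hs ht; apply: small_eq => e e0.
have e2 : 0 < e / 2 by rewrite divr_gt0.
have [A hA] := hs _ e2; have [B hB] := ht _ e2.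
have h1 := hA _ (fsubsetUl A B); have h2 := hB _ (fsubsetUr A B).
rewrite -(subrKA (\sum_(i <- (A `|` B)%fset) f i)) (le_lt_trans (ler_normD _ _))//.
by rewrite [e]splitr ltrD// distrC.
Qed.

Lemma has_sumD I (f g : I -> K) s t :
  has_sum f s -> has_sum g t -> has_sum (fun i => f i + g i) (s + t).
Proof.
move=> hs ht e e0.
have e2 : 0 < e / 2 by rewrite divr_gt0.
have [A hA] := hs _ e2; have [B hB] := ht _ e2.
exists (A `|` B)%fset => D; rewrite fsubUset => /andP[AD BD].
rewrite big_split/= opprD addrACA (le_lt_trans (ler_normD _ _))//.
by rewrite [e]splitr ltrD ?hA ?hB.
Qed.

Lemma has_sumZ I (c : K) (f : I -> K) s :
  has_sum f s -> has_sum (fun i => c * f i) (c * s).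
Proof.
move=> hs e e0.
have c0 : 0 < `|c| + 1 by rewrite ltr_wpDl.
have [A hA] := hs (e / (`|c| + 1)) (divr_gt0 e0 c0).
exists A => B AB; rewrite -mulr_sumr -mulrBr normrM.
have := hA _ AB; rewrite ltr_pdivlMr// => h.
apply: le_lt_trans h; rewrite mulrC ler_wpM2l//.
by rewrite lerDl.
Qed.

Lemma has_sum_ext I (f g : I -> K) s : f =1 g -> has_sum f s -> has_sum g s.
Proof. by move=> /funext ->. Qed.

Lemma has_sum_reindex I J (h : I -> J) (k : J -> I) (f : J -> K) s :
  cancel h k -> cancel k h -> has_sum f s -> has_sum (f \o h) s.
Proof.
move=> hk kh hs e /hs[A hA].
exists [fset k j | j in A]%fset => B AB.
have -> : \sum_(i <- B) (f \o h) i = \sum_(j <- [fset h i | i in B]%fset) f j.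
  by rewrite big_imfset//= => x y _ _; exact: (can_inj hk).
apply: hA; apply/fsubsetP => j jA; apply/imfsetP; exists (k j); rewrite ?kh//.
by apply: (fsubsetP AB); apply/imfsetP; exists j.
Qed.

Lemma has_sum1 I (i0 : I) (f : I -> K) :
  (forall i, i != i0 -> f i = 0) -> has_sum f (f i0).
Proof.
move=> f0 e e0; exists [fset i0]%fset => B; rewrite fsub1set => iB.
by rewrite (big_fsetD1 i0)//= big1_fset ?addr0 ?subrr ?normr0// => i;
  rewrite !inE => /andP[/f0 ->].
Qed.

Lemma has_sum_fubini I J (F : I -> J -> K) (g : I -> K) s :
  has_sum (fun p : I * J => F p.1 p.2) s ->
  (forall i, has_sum (F i) (g i)) -> has_sum g s.
Proof.
move=> hs hg e e0.
have e2 : 0 < e / 2 by rewrite divr_gt0.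
have [A0 hA0] := hs _ e2.
exists [fset p.1 | p in A0]%fset => B AB.
pose n := (size B)%:R + 1 : K.
have n0 : 0 < n by rewrite ltr_wpDl.
have d0 : 0 < e / 2 / n by rewrite divr_gt0.
have /choice[A hA] : forall i, exists A : {fset J}, forall D : {fset J},
    (A `<=` D)%fset -> `|g i - \sum_(j <- D) F i j| < e / 2 / n.
  by move=> i; exact: hg d0.
pose D := ([fset p.2 | p in A0] `|` \bigcup_(i <- B) A i)%fset.
have AD i : i \in B -> (A i `<=` D)%fset.
  move=> iB; apply: fsubset_trans (fsubsetUr _ _).
  by apply: bigfcup_sup.
pose P := (B `*` D)%fset.
have sumP : \sum_(p <- P) F p.1 p.2 = \sum_(i <- B) \sum_(j <- D) F i j.
  by rewrite /P /fsetM big_imfset2//= => -[? ?] [? ?] _ _ /= [-> ->].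
have A0P : (A0 `<=` P)%fset.
  apply/fsubsetP => -[i j] ijA; rewrite in_fsetM/=; apply/andP; split.
    by apply: (fsubsetP AB); apply/imfsetP; exists (i, j).
  by rewrite inE; apply/orP; left; apply/imfsetP; exists (i, j).
have h1 := hA0 _ A0P.
rewrite -(subrKA (\sum_(p <- P) F p.1 p.2)) (le_lt_trans (ler_normD _ _))//.
rewrite [e]splitr ltr_leD// sumP -sumrB (le_trans (ler_norm_sum _ _ _))//.
apply: (@le_trans _ _ (\sum_(i <- B) (e / 2 / n))).
  rewrite big_seq [leRHS]big_seq ler_sum// => i iB.
  by rewrite distrC ltW// hA// AD.
rewrite big_const_seq count_predT iter_addr_0 -[leLHS]mulr_natr [leLHS]mulrAC.
by rewrite ler_pdivrMr// ler_pM2l// lerDl.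
Qed.

End HasSum.

Section RealSums.
Context {R : realType}.
Implicit Types I J : choiceType.
Local Notation C := (Cplx R).

Lemma fset_big_split I (K : zmodType) (A B : {fset I}) (f : I -> K) :
  (A `<=` B)%fset ->
  \sum_(i <- B) f i = \sum_(i <- A) f i + \sum_(i <- (B `\` A)%fset) f i.
Proof.
move=> AB; rewrite -big_cat/=; apply: perm_big; apply: uniq_perm => //.
  rewrite cat_uniq !fset_uniq/= andbT; apply/hasPn => i /=.
  by rewrite inE => /andP[].
move=> i; rewrite mem_cat inE; case: (boolP (i \in A)) => //= iA.
by rewrite (fsubsetP AB).
Qed.

Lemma fset_sum_mono I (u : I -> R) (A B : {fset I}) :
  (forall i, 0 <= u i) -> (A `<=` B)%fset ->
  \sum_(i <- A) u i <= \sum_(i <- B) u i.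
Proof. by move=> u0 AB; rewrite (fset_big_split _ AB) lerDl sumr_ge0. Qed.

Lemma has_sum_ge0 I (u : I -> R) M : (forall i, 0 <= u i) -> bounded_sums u M ->
  exists s, [/\ has_sum u s, bounded_sums u s & s <= M].
Proof.
move=> u0 uM; pose S := [set \sum_(i <- B) u i | B in [set: {fset I}]].
have S0 : S !=set0 by exists (\sum_(i <- fset0) u i), fset0.
have SM : ubound S M by move=> _ [B _ <-].
have sS : has_sup S by split => //; exists M.
have ub (B : {fset I}) : \sum_(i <- B) u i <= sup S.
  by apply: ub_le_sup; [exists M | exists B].
exists (sup S); split => //; last exact: ge_sup.
move=> e e0; have [_ [A _ <-] hA] := sup_adherent e0 sS.
exists A => B AB; rewrite ger0_norm ?subr_ge0// ltrBlDr -ltrBlDl.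
exact: lt_le_trans hA (fset_sum_mono u0 AB).
Qed.

Lemma has_sum_real I (u : I -> R) M :
  bounded_sums (fun i => `|u i|) M -> exists s, has_sum u s.
Proof.
move=> uM; pose v i := `|u i| - u i.
have [s [hs _ _]] := has_sum_ge0 (fun i => normr_ge0 (u i)) uM.
have v0 i : 0 <= v i by rewrite subr_ge0 ler_norm.
have vM : bounded_sums v (M *+ 2).
  move=> B; rewrite /v sumrB mulr2n lerD// -sumrN.
  by apply: le_trans (uM B); rewrite ler_sum// => i _; rewrite -normrN ler_norm.
have [t [ht _ _]] := has_sum_ge0 v0 vM.
exists (s + (-1) * t); have := has_sumD hs (has_sumZ (-1) ht).
by apply: has_sum_ext => i; rewrite /v mulN1r opprB addrC subrK.
Qed.

Lemma has_sum_complex I (u : I -> R) s : has_sum u s ->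
  has_sum (fun i => real_complex R (u i) : C) (real_complex R s).
Proof.
move=> hs e; rewrite ltcE/= => /andP[/eqP e0 /hs[A hA]].
exists A => B /hA; rewrite -rmorph_sum -rmorphB/= normc_def/=.
by rewrite expr0n/= addr0 sqrtr_sqr ltcE/= e0 eqxx.
Qed.

Lemma normcE (z : C) : `|z| = real_complex R (normc z). Proof. by case: z. Qed.

Lemma normc_nneg (z : C) : 0 <= normc z.
Proof. by case: z => a b /=; rewrite sqrtr_ge0. Qed.

Lemma le_Re_normc (z : C) : `|complex.Re z| <= normc z.
Proof. by have := normc_ge_Re z; rewrite normcE lecR. Qed.

Lemma le_Im_normc (z : C) : `|complex.Im z| <= normc z.
Proof.
case: z => a b /=; rewrite -[leLHS]sqrtr_sqr ler_wsqrtr//.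
by rewrite lerDr sqr_ge0.
Qed.

Lemma has_sum_exists I (f : I -> C) M :
  bounded_sums (fun i => normc (f i)) M -> exists s, has_sum f s.
Proof.
move=> fM.
have [s hs] : exists s, has_sum (fun i => complex.Re (f i)) s.
  apply: (@has_sum_real _ _ M) => B; apply: le_trans (fM B).
  by rewrite ler_sum// => i _; exact: le_Re_normc.
have [t ht] : exists s, has_sum (fun i => complex.Im (f i)) s.
  apply: (@has_sum_real _ _ M) => B; apply: le_trans (fM B).
  by rewrite ler_sum// => i _; exact: le_Im_normc.
have := has_sumD (has_sum_complex hs) (has_sumZ (Complex 0 1) (has_sum_complex ht)).
move=> h; eexists; move: h; apply: has_sum_ext => i.
by rewrite -complexE.
Qed.

Lemma normc_sum I (B : seq I) (f : I -> C) :
  normc (\sum_(i <- B) f i) <= \sum_(i <- B) normc (f i).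
Proof.
elim/big_ind2 : _ => // [|x1 x2 y1 y2 h1 h2]; first by rewrite normc0.
exact: le_trans (le_normcD _ _) (lerD h1 h2).
Qed.

Lemma has_sum_bound I (f : I -> C) s M :
  has_sum f s -> bounded_sums (fun i => normc (f i)) M -> normc s <= M.
Proof.
move=> hs fM; apply/ler_addgt0Pr => e e0.
have [|A /(_ A (fsubset_refl _)) hA] := hs (real_complex R e).
  by rewrite ltcR.
rewrite -(subrK (\sum_(i <- A) f i) s) (le_trans (le_normcD _ _))// addrC lerD//.
  exact: le_trans (normc_sum _ _) (fM A).
by move: hA; rewrite normcE ltcR => /ltW.
Qed.

Lemma bounded_prod I J (u : I -> R) (v : J -> R) U V :
  (forall i, 0 <= u i) -> (forall j, 0 <= v j) ->
  bounded_sums u U -> bounded_sums v V ->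
  bounded_sums (fun p : I * J => u p.1 * v p.2) (U * V).
Proof.
move=> u0 v0 uU vV B.
pose P := ([fset p.1 | p in B] `*` [fset p.2 | p in B])%fset.
have BP : (B `<=` P)%fset.
  apply/fsubsetP => p pB; rewrite in_fsetM.
  by apply/andP; split; apply/imfsetP; exists p.
apply: le_trans (fset_sum_mono _ BP) _; first by move=> p; rewrite mulr_ge0.
rewrite /P /fsetM big_imfset2/=; last by move=> [? ?] [? ?] _ _ /= [-> ->].
under eq_bigr do rewrite -mulr_sumr.
by rewrite -mulr_suml ler_pM// ?sumr_ge0.
Qed.

Lemma bounded_reindex I J (h : I -> J) (u : J -> R) M :
  injective h -> bounded_sums u M -> bounded_sums (u \o h) M.
Proof.
move=> hinj uM B.
have -> : \sum_(i <- B) (u \o h) i = \sum_(j <- [fset h i | i in B]%fset) u j.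
  by rewrite big_imfset//= => x y _ _; exact: hinj.
exact: uM.
Qed.

Lemma bounded_le I (u v : I -> R) M : (forall i, u i <= v i) ->
  bounded_sums v M -> bounded_sums u M.
Proof. by move=> uv vM B; apply: le_trans (vM B); rewrite ler_sum. Qed.

Lemma bounded_Z I (c : R) (u : I -> R) M : 0 <= c ->
  bounded_sums u M -> bounded_sums (fun i => c * u i) (c * M).
Proof. by move=> c0 uM B; rewrite -mulr_sumr ler_wpM2l. Qed.

Lemma bounded_slice I J (u : I * J -> R) M i : bounded_sums u M ->
  bounded_sums (fun j => u (i, j)) M.
Proof. by apply: bounded_reindex => x y []. Qed.

Lemma esum_bounded I (u : I -> R) : (forall i, 0 <= u i) ->
  (\esum_(i in [set: I]) (u i)%:E < +oo)%E <-> exists M, bounded_sums u M.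
Proof.
move=> u0; split => [h|[M uM]].
  have f0 : (\esum_(i in [set: I]) (u i)%:E \is a fin_num)%E.
    by rewrite ge0_fin_numE// esum_ge0// => i _; rewrite lee_fin.
  exists (fine (\esum_(i in [set: I]) (u i)%:E)) => B.
  rewrite -lee_fin fineK// esum_ge//; exists [set` B].
    by split.
  by rewrite -fsbig_seq ?fset_uniq// sumEFin.
apply: (@le_lt_trans _ _ M%:E); last exact: ltry.
apply: ge_ereal_sup => _ [A [finA _] <-].
by rewrite fsbig_finite//= sumEFin lee_fin.
Qed.

End RealSums.

Section ContinuousSums.
Context {R : realType}.
Local Notation C := (Cplx R).

Lemma csumP (I : choiceType) (f : I -> C) s :
  has_sum f s -> summability.sum f = s.
Proof.
move=> hs; have ? := @summability.totally_filter I.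
apply: (@cvg_lim C); first exact: norm_hausdorff.
apply/pseudometric_normed_Zmodule.cvgrPdist_lt => e e0; have [A hA] := hs _ e0.
exists A => // B /= /hA.
by rewrite /summability.partial_sum big_seq_fsetE.
Qed.

Lemma cplx_continuousP (X : topologicalType) (f : X -> C) : continuous f <->
  forall x (e : R), 0 < e -> \forall y \near x, normc (f x - f y) < e.
Proof.
split=> [cf x e e0|h x].
  have /pseudometric_normed_Zmodule.cvgrPdist_lt /(_ (real_complex R e)) := cf x.
  rewrite ltcR => /(_ e0); apply: filterS => y.
  by rewrite normcE ltcR.
apply/pseudometric_normed_Zmodule.cvgrPdist_lt => e; rewrite ltcE/= => /andP[/eqP e0 e1].
have := h x _ e1; apply: filterS => y.
by rewrite normcE ltcE/= e0 eqxx.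
Qed.

Lemma fsum_continuous (X : topologicalType) I (r : seq I) (g : I -> X -> C) :
  (forall k, continuous (g k)) -> continuous (fun x => \sum_(k <- r) g k x).
Proof.
move=> cg; elim: r => [|i r IH].
  under eq_fun do rewrite big_nil.
  by move=> x; exact: cvg_cst.
under eq_fun do rewrite big_cons.
by move=> x; apply: cvgD; [exact: cg | exact: IH].
Qed.

Lemma has_sum_continuous (X : topologicalType) (I : choiceType)
    (g : I -> X -> C) (f : X -> C) (u : I -> R) M :
  (forall k, continuous (g k)) -> (forall k x, normc (g k x) <= u k) ->
  bounded_sums u M -> (forall x, has_sum (g^~ x) (f x)) -> continuous f.
Proof.
move=> cg gu uM gf; apply/cplx_continuousP => x e e0.
have u0 k : 0 <= u k by apply: le_trans (gu k x); exact: normc_nneg.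
have [s [hs us _]] := has_sum_ge0 u0 uM.
have e4 : 0 < e / 4 by rewrite divr_gt0.
have [A hA] := hs _ e4.
have tail y : normc (f y - \sum_(k <- A) g k y) <= e / 4.
  apply/ler_addgt0Pr => d d0.
  have [|B0 hB0] := gf y (real_complex R d); first by rewrite ltcR.
  pose B := (A `|` B0)%fset; have AB : (A `<=` B)%fset := fsubsetUl _ _.
  have h1 := hB0 _ (fsubsetUr A B0).
  rewrite -(subrKA (\sum_(k <- B) g k y)) (le_trans (le_normcD _ _))// addrC lerD//.
    rewrite (fset_big_split _ AB) addrC addKr (le_trans (normc_sum _ _))//.
    apply: (@le_trans _ _ (\sum_(k <- (B `\` A)%fset) u k)); first exact: ler_sum.
    have := hA _ (fsubset_refl A); rewrite ger0_norm ?subr_ge0// => /ltW.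
    apply: le_trans; rewrite lerBrDl -(fset_big_split _ AB).
    exact: us.
  by move: h1; rewrite normcE ltcR => /ltW.
have /cplx_continuousP/(_ x _ e4) := fsum_continuous (r := A) cg.
apply: filterS => y h.
rewrite -(subrKA (\sum_(k <- A) g k x)) (le_lt_trans (le_normcD _ _))//.
rewrite -[X in _ + normc X](subrKA (\sum_(k <- A) g k y)).
apply: (@le_lt_trans _ _ (e / 4 + (e / 4 + e / 4))).
  rewrite lerD ?tail// (le_trans (le_normcD _ _))// lerD ?(ltW h)//.
  by rewrite -normcN opprB tail.
by lra.
Qed.

End ContinuousSums.

(* A pair (X, sigma) with X a non-empty compact Hausdorff space and sigma a
   homeomorphism of X. The inverse of sigma is a field, but it is determined by
   sigma. *)
Record dynsys := Dynsys {
  dspace :> topologicalType;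
  homeo : dspace -> dspace;
  homeo_inv : dspace -> dspace;
  dspace_nonempty : [set: dspace] !=set0;
  dspace_compact : compact [set: dspace];
  dspace_hausdorff : hausdorff_space dspace;
  homeoK : cancel homeo homeo_inv;
  homeo_invK : cancel homeo_inv homeo;
  homeo_continuous : continuous homeo;
  homeo_inv_continuous : continuous homeo_inv }.

Section DynamicalSystem.
Context (S : dynsys).

(* The action n |-> sigma ^ n of the integers; [Negz m] is - (m + 1). *)
Definition act (n : int) : S -> S :=
  match n with
  | Posz m => iter m (@homeo S)
  | Negz m => iter m.+1 (@homeo_inv S)
  end.

Lemma act0 x : act 0 x = x. Proof. by []. Qed.

Lemma actS n x : act (n + 1) x = homeo (act n x).
Proof.
case: n => [n|[|n]]; first by rewrite -PoszD addn1.
  by rewrite /= homeo_invK.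
have -> : Negz n.+1 + 1 = Negz n by rewrite !NegzE -addn1 PoszD opprD subrK.
by rewrite /= homeo_invK.
Qed.

Lemma actB n x : act (n - 1) x = homeo_inv (act n x).
Proof. by rewrite -[in RHS](subrK 1 n) actS homeoK. Qed.

Lemma actD m n x : act (m + n) x = act m (act n x).
Proof.
elim/int_rec: m => [|m IH|m IH]; first by rewrite add0r.
  by rewrite -addn1 PoszD addrAC actS IH actS.
by rewrite -addn1 PoszD opprD addrAC actB IH actB.
Qed.

Lemma act_continuous n : continuous (act n).
Proof.
have it (f : S -> S) m : continuous f -> continuous (iter m f).
  move=> cf; elim: m => [|m IH] x; first exact: cvg_id.
  by apply: (@continuous_comp _ _ _ (iter m f) f); [exact: IH | exact: cf].
case: n => n; apply: it; [exact: homeo_continuous|exact: homeo_inv_continuous].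
Qed.

Definition orbit_of (x : S) : set S := [set act n x | n in [set: int]].

Definition same_orbit (x y : S) : bool := `[< orbit_of x y >].

Lemma same_orbit_equiv : equiv_class_of same_orbit.
Proof.
split=> [x|x y|y x z].
- by apply/asboolP; exists 0.
- by apply/asbool_equiv_eq; split=> -[n _ <-]; exists (- n) => //;
    rewrite -actD addNr.
- move=> /asboolP[m _ <-] /asboolP[n _ <-]; apply/asboolP.
  by exists (n + m) => //; rewrite actD.
Qed.

Definition orbit_equiv : equiv_rel S := EquivRelPack same_orbit_equiv.

Definition orbit_space : topologicalType :=
  quotient_topology {eq_quot orbit_equiv}%qT.

End DynamicalSystem.

(* For f continuous on a compact space the set below is bounded, so [sup] is the
   supremum norm of C(X). *)
Definition supnorm (R : realType) (X : topologicalType) (f : X -> Cplx R) : R :=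
  sup [set normc (f x) | x in [set: X]].

Section EllOneAlgebra.
Context {R : realType} {S : dynsys}.
Local Notation C := (Cplx R).
Implicit Types (f g : S -> C) (a b c : int -> S -> C).

Lemma supnorm_le f M : (forall x, normc (f x) <= M) -> supnorm f <= M.
Proof.
move=> fM; apply: ge_sup; last by move=> _ [x _ <-].
by have [x _] := dspace_nonempty S; exists (normc (f x)), x.
Qed.

Lemma le_supnorm f x : continuous f -> normc (f x) <= supnorm f.
Proof.
move=> cf; apply: ub_le_sup; last by exists x.
have cn : continuous (fun x => normc (f x) : R).
  move=> y; apply/pseudometric_normed_Zmodule.cvgrPdist_lt => e e0.
  move/cplx_continuousP : cf => /(_ y _ e0); apply: filterS => z.
  apply: le_lt_trans; rewrite ler_norml lerBlDr; apply/andP; split.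
    rewrite lerNl opprB lerBlDr -[in leLHS](subrK (f y) (f z)).
    by rewrite (le_trans (le_normcD _ _))// -normcN opprB.
  by rewrite -[in leLHS](subrK (f z) (f y)) le_normcD.
have /compact_bounded[M [_ hM]] : compact [set (normc (f x) : R) | x in [set: S]].
  apply: continuous_compact; last exact: dspace_compact.
  exact: continuous_subspaceT.
exists (M + 1) => _ [y _ <-]; apply: le_trans (ler_norm _) _.
by apply: hM; [rewrite ltrDl | exists y].
Qed.

Lemma supnorm_ge0 f : 0 <= supnorm f.
Proof.
have [x _] := dspace_nonempty S.
rewrite /supnorm; have [|] := pselect (has_sup [set normc (f x) | x in [set: S]]).
  by move=> h; apply: (@le_trans _ _ (normc (f x))); rewrite ?normc_nneg//;
    (apply: ub_le_sup; [by case: h | by exists x]).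
by move=> h; rewrite sup_out.
Qed.

(* The maps a : Z -> C(X) with \sum_n ||a n|| finite. A map Z -> C(X) is given as
   a function of n and x which is continuous in x for every n. *)
Definition ell1_pred : {pred int -> S -> C} := fun a =>
  `[< (forall n, continuous (a n)) /\
      (\esum_(n in [set: int]) (supnorm (a n))%:E < +oo)%E >].

Lemma ell1P a : reflect ((forall n, continuous (a n)) /\
    exists M, bounded_sums (fun n => supnorm (a n)) M) (a \in ell1_pred).
Proof.
apply: (iffP (asboolP _)) => -[ca h]; split => //.
  by apply/esum_bounded => // n; exact: supnorm_ge0.
by apply/esum_bounded => // n; exact: supnorm_ge0.
Qed.

Lemma ell1_submod_closed : submod_closed ell1_pred.
Proof.
split.
  apply/ell1P; split; first by move=> n x; exact: cvg_cst.
  exists 0 => B; rewrite big1// => n _; apply/eqP; rewrite eq_le supnorm_ge0 andbT.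
  by apply: supnorm_le => x; rewrite normc0.
move=> k a b /ell1P[ca [M aM]] /ell1P[cb [N bN]]; apply/ell1P; split.
  move=> n x; apply: cvgD; last exact: cb.
  by apply: cvgZr; exact: ca.
exists (normc k * M + N) => B.
apply: (@le_trans _ _ (\sum_(i <- B) (normc k * supnorm (a i) + supnorm (b i)))).
  apply: ler_sum => n _; apply: supnorm_le => x.
  rewrite (le_trans (le_normcD _ _))// lerD ?le_supnorm//.
  by rewrite normcM ler_wpM2l ?normc_nneg// le_supnorm.
by rewrite big_split lerD// -mulr_sumr ler_wpM2l ?normc_nneg.
Qed.

HB.instance Definition _ :=
  GRing.isSubmodClosed.Build C (int -> S -> C) ell1_pred ell1_submod_closed.

(* (a b)(n) = \sum_k a(k) alpha^k (b(n - k)) with alpha f = f \o sigma^-1, hence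
   (alpha^k f)(x) = f (sigma^(- k) x). On ell^1 the series converges absolutely
   in C(X), so its sum is computed pointwise; see [conv_has_sum]. *)
Definition convolution a b : int -> S -> C := fun n x =>
  summability.sum (fun k : int => a k x * b (n - k) (act (- k) x)).

Definition ell1_unit : int -> S -> C := fun n _ => (n == 0)%:R.

Lemma ell1_unit_closed : ell1_unit \in ell1_pred.
Proof.
apply/ell1P; split; first by move=> n x; exact: cvg_cst.
exists 1 => B; apply: (@le_trans _ _ (\sum_(n <- B) (n == 0)%:R)).
  apply: ler_sum => n _; apply: supnorm_le => x; rewrite /ell1_unit.
  by case: (n == 0); rewrite ?normc1 ?normc0.
have [B0|B0] := boolP (0 \in B).
  rewrite (big_fsetD1 0)//= big1_fset ?addr0// => i.
  by rewrite !inE => /andP[/negbTE ->].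
rewrite big1_fset// => i iB _; case: eqP => // i0.
by move: B0; rewrite -i0 iB.
Qed.

Section Bounds.
Variables (a b : int -> S -> C).
Hypotheses (ha : a \in ell1_pred) (hb : b \in ell1_pred).

Lemma conv_bounded : exists M, bounded_sums
  (fun p : int * int => supnorm (a p.2) * supnorm (b (p.1 - p.2))) M.
Proof.
have /ell1P[_ [M aM]] := ha; have /ell1P[_ [N bN]] := hb.
have := bounded_prod (fun i => supnorm_ge0 (a i)) (fun i => supnorm_ge0 (b i)) aM bN.
move=> /(@bounded_reindex _ _ _ (fun p : int * int => (p.2, p.1 - p.2))) h.
exists (M * N); apply: h => -[i j] [i' j'] /= [-> /addIr ->//].
Qed.

Lemma conv_term k n x : normc (a k x * b (n - k) (act (- k) x)) <=
  supnorm (a k) * supnorm (b (n - k)).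
Proof.
have /ell1P[ca _] := ha; have /ell1P[cb _] := hb.
by rewrite normcM ler_pM ?normc_nneg ?le_supnorm.
Qed.

Lemma conv_has_sum n x :
  has_sum (fun k => a k x * b (n - k) (act (- k) x)) (convolution a b n x).
Proof.
have [M hM] := conv_bounded.
have [|s hs] := @has_sum_exists R _ (fun k => a k x * b (n - k) (act (- k) x)) M.
  by apply: bounded_le (bounded_slice n hM) => k; exact: conv_term.
by rewrite /convolution (csumP hs).
Qed.

Lemma conv_closed : convolution a b \in ell1_pred.
Proof.
have [M hM] := conv_bounded.
have /ell1P[ca _] := ha; have /ell1P[cb _] := hb.
apply/ell1P; split.
  move=> n; apply: (has_sum_continuous _ _ (bounded_slice n hM)); last first.
  - by move=> x; exact: conv_has_sum.
  - by move=> k x; exact: conv_term.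
  - move=> k x; apply: cvgM; first exact: ca.
    by apply: continuous_comp; [exact: act_continuous | exact: cb].
have F0 (p : int * int) : 0 <= supnorm (a p.2) * supnorm (b (p.1 - p.2)).
  by rewrite mulr_ge0 ?supnorm_ge0.
have [s [hs _ _]] := has_sum_ge0 F0 hM.
have /choice[G hG] n : exists t, has_sum (fun k => supnorm (a k) * supnorm (b (n - k))) t
    /\ bounded_sums (fun k => supnorm (a k) * supnorm (b (n - k))) t.
  have [|t [? ? _]] := has_sum_ge0 _ (bounded_slice n hM).
    by move=> k; exact: F0 (n, k).
  by exists t.
have hGs := has_sum_fubini hs (fun n => (hG n).1).
have G0 n : 0 <= G n by have := (hG n).2 fset0; rewrite big_seq_fset0.
have Gs : bounded_sums G s.
  move=> B; apply/ler_addgt0Pr => e e0; have [A hA] := hGs _ e0.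
  have := hA _ (fsubsetUl A B) => /ltW; rewrite ler_norml => /andP[h _].
  apply: le_trans (fset_sum_mono G0 (fsubsetUr A B)) _.
  by move: h; rewrite lerBrDr addrC lerBlDr addrC.
exists s; apply: bounded_le Gs => n; apply: supnorm_le => x.
apply: has_sum_bound (conv_has_sum n x) _.
by apply: bounded_le (hG n).2 => k; exact: conv_term.
Qed.

End Bounds.

Lemma convA a b c : a \in ell1_pred -> b \in ell1_pred -> c \in ell1_pred ->
  convolution a (convolution b c) = convolution (convolution a b) c.
Proof.
move=> ha hb hc; apply/funext => n; apply/funext => x.
pose F k j := a j x * b (k - j) (act (- j) x) * c (n - k) (act (- k) x).
have [M hM] := conv_bounded ha hb.
have /ell1P[ca _] := ha; have /ell1P[cb _] := hb.
have /ell1P[cc [N cN]] := hc.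
have cn k y : normc (c k y) <= N.
  apply: le_trans (le_supnorm y (cc k)) _.
  by have := cN [fset k]%fset; rewrite big_seq_fset1.
have N0 : 0 <= N := le_trans (normc_nneg _) (cn 0 x).
have [s hs] : exists s, has_sum (fun p : int * int => F p.1 p.2) s.
  apply: (@has_sum_exists R _ _ (N * M)).
  apply: bounded_le (bounded_Z N0 hM) => -[k j] /=.
  rewrite /F normcM mulrC ler_pM ?normc_nneg//.
  exact: conv_term.
have e1 : convolution (convolution a b) c n x = s.
  apply: has_sum_uniq (conv_has_sum (conv_closed ha hb) hc n x) _.
  apply: (has_sum_fubini hs) => k; rewrite [_ * c _ _]mulrC.
  have := has_sumZ (c (n - k) (act (- k) x)) (conv_has_sum ha hb k x).
  by apply: has_sum_ext => j; rewrite mulrC.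
have hs' : has_sum (fun p : int * int => F p.2 p.1) s.
  by apply: (has_sum_reindex (h := fun p : int * int => (p.2, p.1))
    (k := fun p : int * int => (p.2, p.1)) _ _ hs); case.
rewrite e1; apply: has_sum_uniq (conv_has_sum ha (conv_closed hb hc) n x) _.
apply: (has_sum_fubini (F := fun j k => F k j) hs') => j.
have := conv_has_sum hb hc (n - j) (act (- j) x).
move=> /(has_sum_reindex (h := fun k => k - j) (k := fun k => k + j)
  (subrK j) (addrK j)) /(has_sumZ (a j x)).
apply: has_sum_ext => k; rewrite /F /= -mulrA -actD.
congr (_ * (_ * c _ (act _ _))).
  by rewrite opprB addrA subrK.
by rewrite opprB addrAC subrr add0r.
Qed.

Lemma conv1l a : a \in ell1_pred -> convolution ell1_unit a = a.
Proof.
move=> ha; apply/funext => n; apply/funext => x.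
have := conv_has_sum ell1_unit_closed ha n x.
move=> /has_sum_uniq; apply.
have := @has_sum1 C _ 0 (fun k => ell1_unit k x * a (n - k) (act (- k) x)).
rewrite /ell1_unit eqxx mul1r subr0; apply => k /negbTE ->.
by rewrite mul0r.
Qed.

Lemma conv1r a : a \in ell1_pred -> convolution a ell1_unit = a.
Proof.
move=> ha; apply/funext => n; apply/funext => x.
have := conv_has_sum ha ell1_unit_closed n x.
move=> /has_sum_uniq; apply.
have := @has_sum1 C _ n (fun k => a k x * ell1_unit (n - k) (act (- k) x)).
rewrite /ell1_unit subrr eqxx mulr1; apply => k nk.
by rewrite subr_eq0 eq_sym (negbTE nk) mulr0.
Qed.

Lemma convDl a b c : a \in ell1_pred -> b \in ell1_pred -> c \in ell1_pred ->
  convolution (a + b) c = convolution a c + convolution b c.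
Proof.
move=> ha hb hc; apply/funext => n; apply/funext => x; apply: csumP.
have := has_sumD (conv_has_sum ha hc n x) (conv_has_sum hb hc n x).
by apply: has_sum_ext => k; rewrite -mulrDl.
Qed.

Lemma convDr a b c : a \in ell1_pred -> b \in ell1_pred -> c \in ell1_pred ->
  convolution a (b + c) = convolution a b + convolution a c.
Proof.
move=> ha hb hc; apply/funext => n; apply/funext => x; apply: csumP.
have := has_sumD (conv_has_sum ha hb n x) (conv_has_sum ha hc n x).
by apply: has_sum_ext => k; rewrite -mulrDr.
Qed.

Lemma convZl (k : C) a b : a \in ell1_pred -> b \in ell1_pred ->
  convolution (k *: a) b = k *: convolution a b.
Proof.
move=> ha hb; apply/funext => n; apply/funext => x; apply: csumP.
have := has_sumZ k (conv_has_sum ha hb n x).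
by apply: has_sum_ext => j; rewrite mulrA.
Qed.

Lemma convZr (k : C) a b : a \in ell1_pred -> b \in ell1_pred ->
  convolution a (k *: b) = k *: convolution a b.
Proof.
move=> ha hb; apply/funext => n; apply/funext => x; apply: csumP.
have := has_sumZ k (conv_has_sum ha hb n x).
by apply: has_sum_ext => j; rewrite mulrCA.
Qed.

Lemma ell1_unit_neq0 : ell1_unit != 0.
Proof.
have [x _] := dspace_nonempty S.
apply/eqP => /(congr1 (fun a => a 0 x)); rewrite /ell1_unit eqxx => /eqP.
by rewrite oner_eq0.
Qed.

End EllOneAlgebra.

Arguments ell1_pred : clear implicits.

Record ell1 (R : realType) (S : dynsys) := Ell1 {
  ell1_val :> int -> S -> Cplx R;
  ell1_valP : ell1_val \in ell1_pred R S }.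

Section EllOneType.
Context (R : realType) (S : dynsys).
Local Notation C := (Cplx R).
Local Notation A := (ell1 R S).
Implicit Types a b c : A.

HB.instance Definition _ := [isSub for @ell1_val R S].
HB.instance Definition _ := [Choice of A by <:].
HB.instance Definition _ := [SubChoice_isSubLmodule of A by <:].

Definition ell1_mul a b : A := Ell1 (conv_closed (ell1_valP a) (ell1_valP b)).
Definition ell1_one : A := Ell1 ell1_unit_closed.

Lemma ell1_valD a b : (a + b : A) = (a : int -> S -> C) + b :> (int -> S -> C).
Proof. by []. Qed.
Lemma ell1_valZ (k : C) a : (k *: a : A) = k *: (a : int -> S -> C) :> (int -> S -> C).
Proof. by []. Qed.
Lemma ell1_valM a b : ell1_mul a b = convolution a b :> (int -> S -> C).
Proof. by []. Qed.
Lemma ell1_inj a b : a = b :> (int -> S -> C) -> a = b.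
Proof. exact: val_inj. Qed.

Lemma ell1_mulA : associative ell1_mul.
Proof.
move=> a b c; apply: ell1_inj; rewrite !ell1_valM.
by apply: convA; exact: ell1_valP.
Qed.
Lemma ell1_mul1l : left_id ell1_one ell1_mul.
Proof.
by move=> a; apply: ell1_inj; rewrite ell1_valM conv1l//; exact: ell1_valP.
Qed.
Lemma ell1_mul1r : right_id ell1_one ell1_mul.
Proof.
by move=> a; apply: ell1_inj; rewrite ell1_valM conv1r//; exact: ell1_valP.
Qed.
Lemma ell1_mulDl : left_distributive ell1_mul +%R.
Proof.
move=> a b c; apply: ell1_inj; rewrite ell1_valD !ell1_valM ell1_valD.
by apply: convDl; exact: ell1_valP.
Qed.
Lemma ell1_mulDr : right_distributive ell1_mul +%R.
Proof.
move=> a b c; apply: ell1_inj; rewrite ell1_valD !ell1_valM ell1_valD.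
by apply: convDr; exact: ell1_valP.
Qed.
Lemma ell1_one_neq0 : ell1_one != 0.
Proof. exact: ell1_unit_neq0. Qed.

HB.instance Definition _ := GRing.Zmodule_isNzRing.Build A
  ell1_mulA ell1_mul1l ell1_mul1r ell1_mulDl ell1_mulDr ell1_one_neq0.

Lemma ell1_scaleAl (k : C) a b : k *: (a * b) = (k *: a) * b.
Proof.
apply: ell1_inj; rewrite ell1_valZ [RHS]ell1_valM ell1_valZ.
by rewrite convZl//; exact: ell1_valP.
Qed.

HB.instance Definition _ := GRing.Lmodule_isLalgebra.Build C A ell1_scaleAl.

Lemma ell1_scaleAr (k : C) a b : k *: (a * b) = a * (k *: b).
Proof.
apply: ell1_inj; rewrite ell1_valZ [RHS]ell1_valM ell1_valZ.
by rewrite convZr//; exact: ell1_valP.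
Qed.

HB.instance Definition _ := GRing.Lalgebra_isAlgebra.Build C A ell1_scaleAr.
End EllOneType.

Record representation (K : fieldType) (A : algType K) (E : lmodType K) :=
  Representation {
    rep_fun :> A -> {linear E -> E};
    rep_linear : forall (k : K) (a b : A) (v : E),
      rep_fun (k *: a + b) v = k *: rep_fun a v + rep_fun b v;
    rep_mul : forall (a b : A) (v : E),
      rep_fun (a * b) v = rep_fun a (rep_fun b v) }.

Definition subspace_set (K : fieldType) (E : lmodType K) (F : set E) :=
  F 0 /\ forall (k : K) (u v : E), F u -> F v -> F (k *: u + v).

Section PrimitiveIdeals.
Context (K : fieldType) (A : algType K).

Definition alg_irreducible (E : lmodType K) (rho : representation A E) :=
  (exists a v, rho a v <> 0) /\
  forall F : set E, subspace_set F -> (forall a v, F v -> F (rho a v)) ->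
    F = [set 0] \/ F = setT.

Definition rep_kernel (E : lmodType K) (rho : representation A E) : set A :=
  [set a | forall v, rho a v = 0].

(* The kernels of the algebraically irreducible representations on vector spaces
   of arbitrary dimension; no topology on E is involved. *)
Definition primitive_ideal (P : set A) :=
  exists (E : lmodType K) (rho : representation A E),
    alg_irreducible rho /\ P = rep_kernel rho.

Lemma primitive_mull P (c a : A) : primitive_ideal P -> P a -> P (c * a).
Proof. by move=> [E [rho [_ ->]]] /= h v; rewrite rep_mul h linear0. Qed.

Lemma primitive_mulr P (c a : A) : primitive_ideal P -> P a -> P (a * c).
Proof. by move=> [E [rho [_ ->]]] /= h v; rewrite rep_mul h. Qed.

(* Primitive ideals are prime, which makes the hull-kernel closure preserve finite
   unions. *)
Lemma primitive_prime P (I J : set A) : primitive_ideal P ->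
  (forall a c, I a -> I (a * c)) -> (forall a c, J a -> J (c * a)) ->
  I `&` J `<=` P -> I `<=` P \/ J `<=` P.
Proof.
move=> [E [rho [[_ irr] ->]]] hI hJ IJP.
pose F : set E := [set w | forall a, I a -> rho a w = 0].
have [| |F0|FT] := irr F.
- split=> [a _|k u v Fu Fv a Ia]; first by rewrite linear0.
  by rewrite linearP Fu// Fv// scaler0 addr0.
- by move=> a v Fv b Ib; rewrite -rep_mul Fv//; exact: hI.
- right => b Jb v; have : F (rho b v).
    by move=> a Ia; rewrite -rep_mul IJP//; split; [exact: hI | exact: hJ].
  by rewrite F0.
- by left => a Ia v; have : F v by [rewrite FT]; apply.
Qed.

Record structure_space := StructureSpace {
  ideal_of :> set A;
  ideal_ofP : primitive_ideal ideal_of }.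

HB.instance Definition _ := gen_eqMixin structure_space.
HB.instance Definition _ := gen_choiceMixin structure_space.

Definition kernel_of (E : set structure_space) : set A :=
  \bigcap_(Q in E) (Q : set A).

Definition hk_closure (E : set structure_space) : set structure_space :=
  [set P : structure_space | kernel_of E `<=` P].

(* U is open when its complement contains its own hull-kernel closure. *)
Definition hk_open (U : set structure_space) := hk_closure (~` U) `<=` ~` U.

Lemma kernel_of_mull E c a : kernel_of E a -> kernel_of E (c * a).
Proof. by move=> h Q EQ; apply: primitive_mull (h _ EQ); exact: ideal_ofP. Qed.

Lemma kernel_of_mulr E c a : kernel_of E a -> kernel_of E (a * c).
Proof. by move=> h Q EQ; apply: primitive_mulr (h _ EQ); exact: ideal_ofP. Qed.

Lemma sub_hk_closure E : E `<=` hk_closure E.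
Proof. by move=> P EP a; apply. Qed.

Lemma hk_closureS E F : E `<=` F -> hk_closure E `<=` hk_closure F.
Proof. by move=> EF P + a Fa; apply => Q /EF; exact: Fa. Qed.

Lemma hk_closureK E : hk_closure (hk_closure E) = hk_closure E.
Proof.
apply/seteqP; split; last exact: sub_hk_closure.
by move=> P + a Ea; apply => Q; exact.
Qed.

Lemma hk_closureU E F : hk_closure (E `|` F) = hk_closure E `|` hk_closure F.
Proof.
apply/seteqP; split=> [P PEF|P [] ]; last 2 first.
- by apply: hk_closureS; exact: subsetUl.
- by apply: hk_closureS; exact: subsetUr.
apply: (primitive_prime (ideal_ofP P)).
- by move=> a c; exact: kernel_of_mulr.
- by move=> a c; exact: kernel_of_mull.
- by move=> a [Ea Fa]; apply: PEF => Q [/Ea|/Fa].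
Qed.

Lemma hk_openT : hk_open setT.
Proof.
move=> P; rewrite setCT => P1; have [E [rho [[[a [v av]] _] Prho]]] := ideal_ofP P.
have : (P : set A) a by apply: P1.
by rewrite Prho => /(_ v) /av.
Qed.

Lemma hk_openI : setI_closed hk_open.
Proof.
by move=> U V oU oV P; rewrite setCI hk_closureU => -[/oU|/oV]; [left|right].
Qed.

Lemma hk_open_bigcup (I : Type) (f : I -> set structure_space) :
  (forall i, hk_open (f i)) -> hk_open (\bigcup_i f i).
Proof.
move=> fo P PU [i _ fiP]; apply: (fo i P) => //.
by apply: hk_closureS PU; apply: subsetC; exact: bigcup_sup.
Qed.

HB.instance Definition _ := isOpenTopological.Build structure_space
  hk_openT hk_openI hk_open_bigcup.

Lemma open_hk (U : set structure_space) : open U = hk_open U.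
Proof. by []. Qed.

Lemma closed_hk (D : set structure_space) : closed D <-> hk_closure D `<=` D.
Proof. by rewrite -openC open_hk /hk_open setCK. Qed.

(* The topological closure of the structure space is the hull-kernel closure. *)
Lemma closure_hk (E : set structure_space) : closure E = hk_closure E.
Proof.
apply/seteqP; split=> [P|P EP].
  rewrite closureE; apply; split; last exact: sub_hk_closure.
  by apply/closed_hk; rewrite hk_closureK.
by rewrite closureE => D [/closed_hk cD ED]; apply: cD; exact: hk_closureS EP.
Qed.

End PrimitiveIdeals.

Definition homeomorphic (X Y : topologicalType) :=
  exists (f : X -> Y) (g : Y -> X),
    [/\ cancel f g, cancel g f, continuous f & continuous g].

Definition unit_circle (R : realType) : topologicalType :=
  [set z : Cplx R | `|z| = 1].

(* Main.v *)
(* For x in X and l in T, let C(X) and delta act on the functions h on Z with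
   h (j - p) = l h(j) by (f h)(j) = f(sigma^j x) h(j) and (delta h)(j) = h(j - 1).
   This is an irreducible representation of ell^1(Sigma) of dimension p.

   Conversely, by a Gelfand-Mazur argument central elements act as scalars in any
   irreducible representation. So delta^p acts as some l, which lies in T because
   delta^p and its inverse have norm 1. The ideal of the f in C(X) acting as 0 has
   a common zero y by compactness; a function F vanishing on the orbit of y is
   dominated by the invariant function sum_j |F o sigma^j|^2, which acts as 0, so
   that F acts as 0 as well. This yields a joint eigenvector w of C(X), with
   eigenvalue f(x) say; the annihilator of w is that of a basis vector in the
   representation given by (x, l), so that the two kernels agree.

   The resulting bijection from (X/Z) x T to the structure space is continuous
   because the matrix coefficients depend continuously on (x, l). It is open
   because there are enough bump elements: Urysohn functions on X, and on T the
   functions u + |u| with u(l) = Re(l / l0) - c. These are available since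
   |1 - m l| is the product of a square root of 1 - m l and its conjugate, and
   1 - m l has a square root with absolutely summable Fourier coefficients. *)

Require Import Defs.
From mathcomp Require Import all_boot all_order all_algebra.
From mathcomp Require Import all_classical all_reals all_analysis.
From HB Require Import structures.
From mathcomp Require Import finmap complex ring lra zify.

Set Implicit Arguments.
Unset Strict Implicit.
Unset Printing Implicit Defensive.

Import Order.TTheory GRing.Theory Num.Theory.
Import numFieldNormedType.Exports.
Import ComplexField.Normc.

Local Open Scope classical_set_scope.
Local Open Scope ring_scope.

(** * The norm of ell^1 and the Neumann series *)

(** Two tools are missing. [E] has no topology, and the algebra is not a C*-algebra, so there is no
    continuous functional calculus.

    Irreducibility makes up for the first. [E] is the algebra modulo the annihilator of any nonzero
    vector; the Neumann series makes that annihilator closed, and under the quotient norm every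
    operator commuting with the representation is bounded. Such an annihilator is also a maximal
    left ideal, so comparing two kernels needs only one inclusion between annihilators of single
    vectors.

    Limits in norm make up for the second, in the domination argument and in the square root of 1 -
    T. There T has norm up to 1, on the boundary of the region of geometric convergence.

    Openness is what makes the bumps necessary: an element must lie in every ideal away from a given
    one but not in that one. A nonzero trigonometric polynomial in l cannot vanish on an arc, which
    is why |u| has to be produced inside the algebra. *)

Section Sums.
Context {R : realType}.
Implicit Types I J : choiceType.

Lemma bounded_sum_le I (u : I -> R) s M :
  (forall i, 0 <= u i) -> has_sum u s -> s <= M -> bounded_sums u M.
Proof.
move=> u0 us sM B; apply/ler_addgt0Pr => e e0; have [A hA] := us _ e0.
have := hA _ (fsubsetUl A B) => /ltW; rewrite ler_norml => /andP[h _].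
apply: le_trans (fset_sum_mono u0 (fsubsetUr A B)) _.
by move: h; lra.
Qed.

Lemma bounded_fubini I J (F : I -> J -> R) (g : I -> R) M :
  (forall i j, 0 <= F i j) -> bounded_sums (fun p : I * J => F p.1 p.2) M ->
  (forall i, has_sum (F i) (g i)) -> bounded_sums g M.
Proof.
move=> F0 FM Fg; have [s [hs _ sM]] := has_sum_ge0 (fun p => F0 p.1 p.2) FM.
apply: bounded_sum_le sM; last exact: (has_sum_fubini hs).
by move=> i; apply: le_trans (bounded_sum_le (F0 i) (Fg i) (lexx _) fset0);
  rewrite big_seq_fset0.
Qed.

Lemma bounded_prod_rows I J (F : I -> J -> R) (v : J -> R) M :
  (forall i j, 0 <= F i j) -> (forall j, bounded_sums (F^~ j) (v j)) ->
  bounded_sums v M -> bounded_sums (fun p : I * J => F p.1 p.2) M.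
Proof.
move=> F0 Fv vM B.
pose P := ([fset p.1 | p in B] `*` [fset p.2 | p in B])%fset.
have BP : (B `<=` P)%fset.
  apply/fsubsetP => p pB; rewrite in_fsetM.
  by apply/andP; split; apply/imfsetP; exists p.
apply: le_trans (fset_sum_mono _ BP) _; first by move=> p; exact: F0.
rewrite /P /fsetM big_imfset2/=; last by move=> [? ?] [? ?] _ _ /= [-> ->].
rewrite exchange_big/=; apply: le_trans (vM [fset p.2 | p in B]%fset).
by apply: ler_sum => j _; exact: Fv.
Qed.

Lemma has_sum_shift (K : numFieldType) (f : nat -> K) s :
  has_sum f s -> has_sum (fun k => f k.+1) (s - f 0).
Proof.
move=> fs e /fs[A hA]; exists [fset k.-1 | k in A]%fset => B AB.
have := hA (0%N |` [fset k.+1 | k in B])%fset.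
have -> : \sum_(i <- (0%N |` [fset k.+1 | k in B])%fset) f i =
    f 0%N + \sum_(k <- B) f k.+1.
  rewrite big_fsetU1/=; last by apply/imfsetP => -[].
  by rewrite big_imfset//= => x y _ _ [].
rewrite opprD addrA; apply; apply/fsubsetP => -[|k] kA; first by rewrite !inE.
rewrite !inE/=; apply/imfsetP; exists k => //=.
by apply: (fsubsetP AB); apply/imfsetP; exists k.+1.
Qed.

Lemma bounded_nat (u : nat -> R) M : (forall k, 0 <= u k) ->
  (forall N, \sum_(k < N) u k <= M) -> bounded_sums u M.
Proof.
move=> u0 uM B.
have [N hN] : exists N, forall k, k \in B -> (k < N)%N.
  exists (\sum_(k <- B) k).+1 => k kB; rewrite ltnS.
  by rewrite (big_fsetD1 k)//= leq_addr.
apply: (@le_trans _ _ (\sum_(k <- [fset i | i in iota 0 N]%fset) u k)).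
  apply: fset_sum_mono => //.
  by apply/fsubsetP => k /hN kN; rewrite !inE mem_iota.
rewrite (perm_big (iota 0 N)); last first.
  apply: uniq_perm; rewrite ?fset_uniq ?iota_uniq// => k.
  by rewrite !inE.
by apply: le_trans (uM N); rewrite -(big_mkord predT u) /index_iota subn0.
Qed.

End Sums.

Section EllOneNorm.
Context {R : realType} {S : dynsys}.
Local Notation C := (Cplx R).
Local Notation A := (ell1 R S).
Implicit Types a b c : A.

(** For nonnegative terms the supremum of the finite sums is the sum of the series, and a bound on
    the norm is then literally a [bounded_sums] statement. *)
Definition ell1_norm a : R :=
  sup [set \sum_(n <- B) supnorm (a n) | B in [set: {fset int}]].

Lemma ell1_continuous a n : continuous (a n).
Proof. by have /ell1P[] := ell1_valP a. Qed.

Lemma ell1_norm_bounded a : bounded_sums (fun n => supnorm (a n)) (ell1_norm a).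
Proof.
have /ell1P[_ [M aM]] := ell1_valP a => B.
by apply: ub_le_sup; [exists M => _ [D _ <-]; exact: aM | exists B].
Qed.

Lemma ell1_norm_le a M :
  bounded_sums (fun n => supnorm (a n)) M -> ell1_norm a <= M.
Proof.
move=> aM; apply: ge_sup; last by move=> _ [B _ <-]; exact: aM.
by exists (\sum_(n <- fset0) supnorm (a n)), fset0.
Qed.

Lemma ell1_norm_ge0 a : 0 <= ell1_norm a.
Proof. by have := ell1_norm_bounded a fset0; rewrite big_seq_fset0. Qed.

Lemma supnorm_le_ell1 a n : supnorm (a n) <= ell1_norm a.
Proof. by have := ell1_norm_bounded a [fset n]%fset; rewrite big_seq_fset1. Qed.

Lemma le_ell1_norm a n x : normc (a n x) <= ell1_norm a.
Proof.
exact: le_trans (le_supnorm x (@ell1_continuous a n)) (supnorm_le_ell1 a n).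
Qed.

Lemma ell1_norm0 : ell1_norm 0 = 0.
Proof.
apply/eqP; rewrite eq_le ell1_norm_ge0 andbT; apply: ell1_norm_le => B.
by rewrite big1// => n _; apply/eqP; rewrite eq_le supnorm_ge0 andbT;
  apply: supnorm_le => x; rewrite normc0.
Qed.

Lemma ell1_normD a b : ell1_norm (a + b) <= ell1_norm a + ell1_norm b.
Proof.
apply: ell1_norm_le => B.
apply: le_trans (lerD (ell1_norm_bounded a B) (ell1_norm_bounded b B)).
rewrite -big_split; apply: ler_sum => n _; apply: supnorm_le => x.
by apply: le_trans (le_normcD _ _) _; rewrite lerD// le_supnorm//;
  exact: ell1_continuous.
Qed.

Lemma ell1_normZ (k : C) a : ell1_norm (k *: a) <= normc k * ell1_norm a.
Proof.
apply: ell1_norm_le => B.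
apply: le_trans (ler_wpM2l (normc_nneg _) (ell1_norm_bounded a B)).
rewrite mulr_sumr; apply: ler_sum => n _; apply: supnorm_le => x.
rewrite -[leLHS]/(normc (k * a n x)) normcM ler_wpM2l ?normc_nneg//.
by rewrite le_supnorm//; exact: ell1_continuous.
Qed.

Lemma ell1_normN a : ell1_norm (- a) = ell1_norm a.
Proof.
have h b : ell1_norm (- b) <= ell1_norm b.
  rewrite -scaleN1r; apply: le_trans (ell1_normZ _ _) _.
  by rewrite normcN normc1 mul1r.
by apply/eqP; rewrite eq_le h -{1}[a]opprK h.
Qed.

Lemma ell1_norm1 : ell1_norm (1 : A) <= 1.
Proof.
apply: ell1_norm_le => B; apply: (@le_trans _ _ (\sum_(n <- B) (n == 0)%:R)).
  apply: ler_sum => n _; apply: supnorm_le => x.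
  rewrite -[leLHS]/(normc (ell1_unit n x)) /ell1_unit.
  by case: (n == 0); rewrite ?normc1 ?normc0.
have [B0|B0] := boolP (0 \in B).
  rewrite (big_fsetD1 0)//= big1_fset ?addr0// => i.
  by rewrite !inE => /andP[/negbTE ->].
rewrite big1_fset// => i iB _; case: eqP => // i0.
by move: B0; rewrite -i0 iB.
Qed.

Lemma ell1_has_sumM a b n x :
  has_sum (fun k => a k x * b (n - k) (act (- k) x)) ((a * b : A) n x).
Proof. exact: (conv_has_sum (ell1_valP a) (ell1_valP b)). Qed.

Lemma ell1_normM a b : ell1_norm (a * b) <= ell1_norm a * ell1_norm b.
Proof.
have h : bounded_sums (fun p : int * int => supnorm (a p.2) * supnorm (b (p.1 - p.2)))
    (ell1_norm a * ell1_norm b).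
  have := bounded_prod (fun i => supnorm_ge0 (a i)) (fun i => supnorm_ge0 (b i))
    (ell1_norm_bounded a) (ell1_norm_bounded b).
  move=> /(@bounded_reindex _ _ _ (fun p : int * int => (p.2, p.1 - p.2))).
  by apply => -[i j] [i' j'] /= [-> /addIr ->//].
have F0 n k : 0 <= supnorm (a k) * supnorm (b (n - k)).
  by rewrite mulr_ge0 ?supnorm_ge0.
have /choice[G hG] n : exists t,
    has_sum (fun k => supnorm (a k) * supnorm (b (n - k))) t.
  by have [t []] := has_sum_ge0 (F0 n) (bounded_slice n h); exists t.
apply: ell1_norm_le; apply: bounded_le (bounded_fubini F0 h hG) => n.
apply: supnorm_le => x; apply: has_sum_bound (ell1_has_sumM a b n x) _.
apply: bounded_le (bounded_sum_le (F0 n) (hG n) (lexx _)) => k.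
exact: conv_term (ell1_valP a) (ell1_valP b) _ _ _.
Qed.

Lemma ell1_norm_eq0 a : ell1_norm a <= 0 -> a = 0.
Proof.
move=> a0; apply: ell1_inj; apply/funext => n; apply/funext => x.
apply: eq0_normc; apply/eqP; rewrite eq_le normc_nneg andbT.
exact: le_trans (le_ell1_norm _ _ _) a0.
Qed.

(** Stated for a bare family [d], because this bound is what places the pointwise sum of a series in
    the algebra. *)
Lemma ell1_series_bound (u : nat -> A) M (d : int -> S -> C) :
  bounded_sums (fun k => ell1_norm (u k)) M ->
  (forall n x, has_sum (fun k => u k n x) (d n x)) ->
  bounded_sums (fun n => supnorm (d n)) M.
Proof.
move=> uM ud.
have F0 n k : 0 <= supnorm (u k n) by exact: supnorm_ge0.
have h : bounded_sums (fun p : int * nat => supnorm (u p.2 p.1)) M.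
  exact: bounded_prod_rows F0 (fun k => ell1_norm_bounded (u k)) uM.
have /choice[G hG] n : exists t, has_sum (fun k => supnorm (u k n)) t.
  by have [t []] := has_sum_ge0 (F0 n) (bounded_slice n h); exists t.
apply: bounded_le (bounded_fubini F0 h hG) => n.
apply: supnorm_le => x; apply: has_sum_bound (ud n x) _.
apply: bounded_le (bounded_sum_le (F0 n) (hG n) (lexx _)) => k.
by apply: le_supnorm; exact: ell1_continuous.
Qed.

(** Completeness, in the form that absolutely convergent series converge. *)
Lemma ell1_series (u : nat -> A) M :
  bounded_sums (fun k => ell1_norm (u k)) M ->
  exists d : A, forall n x, has_sum (fun k => u k n x) (d n x).
Proof.
move=> uM.
have /choice[d hd] (p : int * S) : exists s, has_sum (fun k => u k p.1 p.2) s.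
  apply: (@has_sum_exists R _ _ M); apply: bounded_le uM => k.
  exact: le_ell1_norm.
pose D n x := d (n, x).
have hD n x : has_sum (fun k => u k n x) (D n x) := hd (n, x).
have Dl : D \in ell1_pred R S.
  apply/ell1P; split; last by exists M; exact: ell1_series_bound uM hD.
  move=> n; apply: (has_sum_continuous _ _ uM); last by move=> x; exact: hD.
    by move=> k; exact: ell1_continuous.
  by move=> k x; exact: le_ell1_norm.
by exists (Ell1 Dl).
Qed.

Lemma ell1_normX b k : ell1_norm (b ^+ k) <= ell1_norm b ^+ k.
Proof.
elim: k => [|k IH]; first by rewrite !expr0 ell1_norm1.
rewrite !exprS; apply: le_trans (ell1_normM _ _) _.
by rewrite ler_wpM2l ?ell1_norm_ge0.
Qed.

Lemma bounded_geometric (r : R) : 0 <= r < 1 ->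
  bounded_sums (fun k : nat => r ^+ k) (1 - r)^-1.
Proof.
move=> /andP[r0 r1]; apply: bounded_nat => [k|N]; first exact: exprn_ge0.
rewrite -[leRHS]div1r ler_pdivlMr ?subr_gt0// mulrC.
have -> : (1 - r) * \sum_(k < N) r ^+ k = 1 - r ^+ N.
  by rewrite -opprB mulNr -subrX1 opprB.
by rewrite gerBl exprn_ge0.
Qed.

Lemma ell1_evalD a b n x : (a + b : A) n x = a n x + b n x. Proof. by []. Qed.
Lemma ell1_evalB a b n x : (a - b : A) n x = a n x - b n x. Proof. by []. Qed.
Lemma ell1_evalZ (k : C) a n x : (k *: a : A) n x = k * a n x. Proof. by []. Qed.

Lemma ell1_eval_sum I (r : seq I) (F : I -> A) n x :
  (\sum_(i <- r) F i : A) n x = \sum_(i <- r) F i n x.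
Proof. by elim/big_ind2 : _ => // ? ? ? ? <- <-. Qed.

Lemma neumann b : ell1_norm b < 1 -> exists d, d * (1 - b) = 1.
Proof.
move=> b1; have b01 : 0 <= ell1_norm b < 1 by rewrite ell1_norm_ge0.
have uM : bounded_sums (fun k => ell1_norm (b ^+ k)) (1 - ell1_norm b)^-1.
  by apply: bounded_le (bounded_geometric b01) => k; exact: ell1_normX.
have [d hd] := ell1_series uM; exists d.
(* [d] is the pointwise sum of the powers of [b]. By Fubini, right multiplication by [b] goes
   through this sum and shifts the series by one term. *)
suff h : d * b = d - 1 by rewrite mulrBr mulr1 h opprB addrC subrK.
apply: ell1_inj; apply/funext => n; apply/funext => x.
pose F k j := (b ^+ k) j x * b (n - j) (act (- j) x).
have F0 : bounded_sums (fun p : nat * int => normc (F p.1 p.2))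
    (ell1_norm b * (1 - ell1_norm b)^-1).
  have h : bounded_sums (fun p : int * nat => supnorm ((b ^+ p.2) p.1))
      (1 - ell1_norm b)^-1.
    apply: (bounded_prod_rows _ (fun k => ell1_norm_bounded (b ^+ k)) uM) => i k.
    exact: supnorm_ge0.
  have sw : injective (fun p : nat * int => (p.2, p.1)).
    by move=> [? ?] [? ?] /= [-> ->].
  apply: bounded_le (bounded_Z (ell1_norm_ge0 b) (bounded_reindex sw h)) => -[i j] /=.
  rewrite /F normcM mulrC ler_pM ?normc_nneg ?le_ell1_norm ?le_supnorm//.
  exact: ell1_continuous.
have [s hs] := has_sum_exists F0.
have h1 : has_sum (fun k => (b ^+ k.+1) n x) s.
  apply: (has_sum_fubini hs) => k.
  by rewrite exprSr; exact: ell1_has_sumM.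
have h2 : has_sum (fun j => d j x * b (n - j) (act (- j) x)) s.
  have hs' := has_sum_reindex (h := fun p : int * nat => (p.2, p.1))
    (k := fun p : nat * int => (p.2, p.1)) _ _ hs.
  apply: (has_sum_fubini (F := fun j k => F k j) (hs' _ _)); try by case.
  move=> j; have := has_sumZ (b (n - j) (act (- j) x)) (hd j x).
  by rewrite mulrC; apply: has_sum_ext => k; rewrite /F mulrC.
rewrite (has_sum_uniq (ell1_has_sumM d b n x) h2).
exact: (has_sum_uniq h1 (has_sum_shift (hd n x))).
Qed.

End EllOneNorm.

(** * Central elements act as scalars *)

Section Representations.
Context {K : fieldType} {A : algType K} {E : lmodType K}.
Variable rho : representation A E.
Implicit Types (a b c : A) (u v w : E).

Lemma repD a b v : rho (a + b) v = rho a v + rho b v.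
Proof. by rewrite -[a in LHS]scale1r rep_linear scale1r. Qed.

Lemma rep0 v : rho 0 v = 0.
Proof. by apply: (addrI (rho 0 v)); rewrite -repD !addr0. Qed.

Lemma repZ k a v : rho (k *: a) v = k *: rho a v.
Proof. by rewrite -[k *: a]addr0 rep_linear rep0 addr0. Qed.

Lemma repN a v : rho (- a) v = - rho a v.
Proof. by rewrite -[- a]scaleN1r repZ scaleN1r. Qed.

Lemma repB a b v : rho (a - b) v = rho a v - rho b v.
Proof. by rewrite repD repN. Qed.

Lemma rep_sum (I : Type) (r : seq I) (F : I -> A) v :
  rho (\sum_(i <- r) F i) v = \sum_(i <- r) rho (F i) v.
Proof.
elim: r => [|i r IH]; first by rewrite !big_nil rep0.
by rewrite !big_cons repD IH.
Qed.

Hypothesis irr : alg_irreducible rho.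

(** One half of Schur's lemma: the kernel of an intertwiner is an invariant subspace. [irr_onto] is
    the other half, with the range. *)
Lemma irr_ker0 (T : E -> E) : linear T ->
  (forall a v, T (rho a v) = rho a (T v)) -> (exists v, T v <> 0) ->
  forall v, T v = 0 -> v = 0.
Proof.
move=> Tl Trho [v0 Tv0] v Tv.
have T0 : T 0 = 0 by have := Tl (-1) v v; rewrite Tv !scaleN1r !addNr.
have [| |F0|FT] := irr.2 [set u | T u = 0].
- by split=> //= k u w Tu Tw; rewrite Tl Tu Tw scaler0 addr0.
- by move=> a u /= Tu; rewrite Trho Tu linear0.
- by have : [set u | T u = 0] v := Tv; rewrite F0 => ->.
- by case: Tv0; have : [set u | T u = 0] v0 by rewrite FT.
Qed.

Lemma irr_onto (T : E -> E) : linear T ->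
  (forall a v, T (rho a v) = rho a (T v)) -> (exists v, T v <> 0) ->
  forall w, exists v, T v = w.
Proof.
move=> Tl Trho [v0 Tv0] w.
have T0 : T 0 = 0 by have := Tl (-1) 0 0; rewrite scaleN1r addNr scaleN1r addNr.
have [| |F0|FT] := irr.2 (range T).
- split; first by exists 0.
  by move=> k _ _ [u _ <-] [u' _ <-]; exists (k *: u + u'); rewrite ?Tl.
- by move=> a _ [u _ <-]; exists (rho a u); rewrite ?Trho.
- by case: Tv0; have : range T (T v0) by [exists v0]; rewrite F0 => ->.
- by have [v _ <-] : range T w by [rewrite FT]; exists v.
Qed.

(** Unitality is not part of [representation]. But [rho 1] is a nonzero idempotent intertwiner,
    hence injective, and it kills v - rho 1 v. *)
Lemma rep1 v : rho 1 v = v.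
Proof.
have h : rho 1 (v - rho 1 v) = 0 by rewrite linearB/= -rep_mul mulr1 subrr.
apply/esym/eqP; rewrite -subr_eq0; apply/eqP.
move: h; apply: (irr_ker0 (T := rho 1)).
- exact: linearP.
- by move=> a u; rewrite -!rep_mul mulr1 mul1r.
have [a [u au]] := irr.1; exists u => h; apply: au.
by rewrite -[a]mulr1 rep_mul h linear0.
Qed.

Lemma irr_cyclic v w : v <> 0 -> exists a, rho a v = w.
Proof.
move=> v0; have [| |F0|FT] := irr.2 [set rho a v | a in setT].
- split; first by exists 0; rewrite ?rep0.
  move=> k _ _ [a _ <-] [b _ <-]; exists (k *: a + b) => //.
  by rewrite rep_linear.
- by move=> a _ [b _ <-]; exists (a * b); rewrite ?rep_mul.
- by case: v0; have : [set rho a v | a in setT] v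
    by [exists 1; rewrite ?rep1]; rewrite F0.
- by have [a _ <-] : [set rho a v | a in setT] w by [rewrite FT]; exists a.
Qed.

End Representations.

Lemma normc_real (R : realType) (s : R) : normc (real_complex R s : Cplx R) = `|s|.
Proof. by rewrite /= expr0n addr0 sqrtr_sqr. Qed.

Lemma lt_half_of_le_mul (R : realType) (a b : R) :
  0 <= a -> b <= 1 / 5 -> a <= b * (1 + a) -> a < 1 / 2.
Proof.
move=> a0 b5 ab; have a1 : 0 <= 1 + a by rewrite addr_ge0.
by have := ler_wpM2r a1 b5; lra.
Qed.

Lemma normc_le_ReIm (R : realType) (z : Cplx R) :
  normc z <= `|complex.Re z| + `|complex.Im z|.
Proof.
case: z => x y /=.
rewrite -[leRHS]ger0_norm ?addr_ge0// -sqrtr_sqr ler_wsqrtr//.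
rewrite -[x ^+ 2]real_normK ?num_real// -[y ^+ 2]real_normK ?num_real//.
by rewrite sqrrD addrAC lerDl mulrn_wge0// mulr_ge0.
Qed.

(** * Schur's lemma for a Banach algebra, from the properties of its norm *)

Section BanachSchur.
Context {R : realType} {A : algType (Cplx R)}.
Local Notation C := (Cplx R).
Variable nrm : A -> R.
Hypothesis nrm_ge0 : forall a, 0 <= nrm a.
Hypothesis nrmD : forall a b, nrm (a + b) <= nrm a + nrm b.
Hypothesis nrmZ : forall k a, nrm (k *: a) <= normc k * nrm a.
Hypothesis nrmM : forall a b, nrm (a * b) <= nrm a * nrm b.
Hypothesis nrm1 : nrm 1 <= 1.
Hypothesis nrm_neumann : forall b, nrm b < 1 -> exists d, d * (1 - b) = 1.
Context {E : lmodType C} {rho : representation A E}.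
Hypothesis irr : alg_irreducible rho.

(** 1 - b kills [v] and has a left inverse. Completeness enters this section only here. *)
Lemma neumann_ker v b : nrm b < 1 -> rho b v = v -> v = 0.
Proof.
move=> /nrm_neumann[d d1] bv; rewrite -(rep1 irr v) -d1 rep_mul repB.
by rewrite (rep1 irr) bv subrr linear0.
Qed.

(** If a v is nonzero, some [b] brings it back to [v]; for a' close to [a] killing [v], the element
    b (a - a') then fixes [v] and has norm below 1. *)
Lemma annihilator_closed v a :
  (forall e : R, 0 < e -> exists a', nrm (a - a') < e /\ rho a' v = 0) ->
  rho a v = 0.
Proof.
move=> h; apply: contrapT => av0; have [b bav] := irr_cyclic irr v av0.
have b1 : 0 < nrm b + 1 by rewrite ltr_wpDl.
have [|a' [aa' a'v]] := h (nrm b + 1)^-1; first by rewrite invr_gt0.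
apply: av0; suff -> : v = 0 by rewrite linear0.
apply: (@neumann_ker _ (b * (a - a'))); last by rewrite rep_mul repB a'v subr0.
apply: le_lt_trans (nrmM _ _) _; apply: (@le_lt_trans _ _ (nrm b / (nrm b + 1))).
  by rewrite ler_wpM2l// ltW.
by rewrite ltr_pdivrMr// mul1r ltrDl.
Qed.

Section CyclicNorm.
Variable v : E.
Hypothesis v0 : v <> 0.

(* The quotient norm of [E], seen as the algebra modulo the annihilator of [v]. *)
Definition cyclic_norm (w : E) : R := inf [set nrm b | b in [set b | rho b v = w]].
Local Notation N := cyclic_norm.

Lemma cyclic_norm_le b w : rho b v = w -> N w <= nrm b.
Proof.
by move=> bw; apply: ge_inf; [exists 0 => _ [d _ <-] | exists b].
Qed.

Lemma cyclic_norm_lt w M : N w < M -> exists2 b, rho b v = w & nrm b < M.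
Proof.
move=> wM; have [b0 b0w] := irr_cyclic irr w v0.
have [||_ [b /= bw <-] bM] := @inf_adherent _ [set nrm b | b in [set b | rho b v = w]]
  (M - N w); first by rewrite subr_gt0.
  by split; [exists (nrm b0), b0 | exists 0 => _ [d _ <-]].
by exists b => //; move: bM; rewrite addrC subrK.
Qed.

Lemma cyclic_norm_ge0 w : 0 <= N w.
Proof.
have [b0 b0w] := irr_cyclic irr w v0.
by apply: lb_le_inf; [exists (nrm b0), b0 | move=> _ [d _ <-]].
Qed.

Lemma cyclic_normD u w : N (u + w) <= N u + N w.
Proof.
apply/ler_addgt0Pr => e e0; have e2 : 0 < e / 2 by rewrite divr_gt0.
have [|b bu hb] := @cyclic_norm_lt u (N u + e / 2); first by rewrite ltrDl.
have [|d dw hd] := @cyclic_norm_lt w (N w + e / 2); first by rewrite ltrDl.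
apply: le_trans (@cyclic_norm_le (b + d) _ _) _; first by rewrite repD bu dw.
by apply: le_trans (nrmD _ _) _; rewrite [e]splitr addrACA lerD// ltW.
Qed.

Lemma cyclic_normZ_le k w : N (k *: w) <= normc k * N w.
Proof.
apply/ler_addgt0Pr => e e0.
have k1 : 0 < normc k + 1 by rewrite ltr_wpDl ?normc_nneg.
have [|b bw hb] := @cyclic_norm_lt w (N w + e / (normc k + 1)).
  by rewrite ltrDl divr_gt0.
apply: le_trans (@cyclic_norm_le (k *: b) _ _) _; first by rewrite repZ bw.
apply: le_trans (nrmZ _ _) _; apply: le_trans (ler_wpM2l (normc_nneg _) (ltW hb)) _.
rewrite mulrDr lerD2l mulrCA ger_pMr// ler_pdivrMr// mul1r.
by rewrite lerDl.
Qed.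

Lemma cyclic_normZ k w : N (k *: w) = normc k * N w.
Proof.
apply/eqP; rewrite eq_le cyclic_normZ_le/=.
have [->|k0] := eqVneq k 0.
  by rewrite normc0 mul0r cyclic_norm_ge0.
have nk0 : 0 < normc k.
  by rewrite lt_neqAle normc_nneg andbT eq_sym; apply: contra k0 => /eqP/eq0_normc ->.
rewrite -ler_pdivlMl// -[in leLHS](scalerK k0 w) -normcV//.
exact: cyclic_normZ_le.
Qed.

Lemma cyclic_normN w : N (- w) = N w.
Proof. by rewrite -scaleN1r cyclic_normZ normcN normc1 mul1r. Qed.

Lemma cyclic_normB u w : N (u - w) <= N u + N w.
Proof. by rewrite -[N w]cyclic_normN cyclic_normD. Qed.

(** Automatic continuity: T (b v) = b (T v), so [T] is determined by T v, and its bound is the norm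
    of that vector. *)
Lemma cyclic_norm_comm (T : E -> E) w :
  (forall a u, T (rho a u) = rho a (T u)) -> N (T w) <= N w * N (T v).
Proof.
move=> Trho.
have h b : rho b v = w -> N (T w) <= nrm b * N (T v).
  move=> <-; rewrite Trho; apply/ler_addgt0Pr => e e0.
  have b1 : 0 < nrm b + 1 by rewrite ltr_wpDl.
  have [|d du hd] := @cyclic_norm_lt (T v) (N (T v) + e / (nrm b + 1)).
    by rewrite ltrDl divr_gt0.
  apply: le_trans (@cyclic_norm_le (b * d) _ _) _; first by rewrite rep_mul du.
  apply: le_trans (nrmM _ _) _; apply: le_trans (ler_wpM2l (nrm_ge0 _) (ltW hd)) _.
  rewrite mulrDr lerD2l mulrCA ger_pMr// ler_pdivrMr// mul1r.
  by rewrite lerDl.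
apply/ler_addgt0Pr => e e0.
have t1 : 0 < N (T v) + 1 by rewrite ltr_wpDl ?cyclic_norm_ge0.
have [|b /h hb bw] := @cyclic_norm_lt w (N w + e / (N (T v) + 1)).
  by rewrite ltrDl divr_gt0.
apply: le_trans hb _; apply: le_trans (ler_wpM2r (cyclic_norm_ge0 _) (ltW bw)) _.
rewrite mulrDl lerD2l mulrAC -mulrA ger_pMr// ler_pdivrMr// mul1r.
by rewrite lerDl.
Qed.

(** A representative of [v] of norm below 1 would fix [v]. *)
Lemma cyclic_norm_gen : N v = 1.
Proof.
apply/eqP; rewrite eq_le (le_trans (@cyclic_norm_le 1 _ _))//= ?(rep1 irr)//.
rewrite leNgt; apply/negP => /cyclic_norm_lt[b bv b1].
exact: v0 (neumann_ker b1 bv).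
Qed.

Section NoEigenvalue.
Variable c : A.
Hypothesis c_central : forall a, c * a = a * c.
Hypothesis no_eigenvalue : forall l : C, exists u, rho c u <> l *: u.

Lemma rep_central a u : rho c (rho a u) = rho a (rho c u).
Proof. by rewrite -!rep_mul c_central. Qed.

Lemma rep_centralX n a u : rho (c ^+ n) (rho a u) = rho a (rho (c ^+ n) u).
Proof. by rewrite -!rep_mul (commrX n (esym (c_central a))). Qed.

(** Invertibility of 1 - z c is pure algebra by Schur's lemma. This form, rather than c - z,
    includes z = 0, where the later propagation starts. *)
Lemma resolvent_exists (z : C) : exists T : E -> E,
  [/\ forall u, T (u - z *: rho c u) = u, forall u, T u - z *: rho c (T u) = u &
      forall a u, T (rho a u) = rho a (T u)].
Proof.
pose op u := u - z *: rho c u.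
have opl : linear op.
  move=> k u w; rewrite /op linearP/= scalerBr scalerDr !scalerA opprD addrACA.
  by rewrite [z * k]mulrC.
have oprho a u : op (rho a u) = rho a (op u).
  by rewrite /op rep_central [RHS]linearB/= [in RHS]linearZ.
have op0 : exists u, op u <> 0.
  have [z00|z0] := eqVneq z 0; first by exists v; rewrite /op z00 scale0r subr0.
  have [u cu] := no_eigenvalue z^-1; exists u => /eqP; rewrite subr_eq0 => /eqP uz.
  by apply: cu; rewrite [in RHS]uz scalerK.
have /choice[T hT] := irr_onto irr opl oprho op0.
have inj u w : op u = op w -> u = w.
  move=> uw; apply/eqP; rewrite -subr_eq0; apply/eqP.
  apply: (irr_ker0 irr opl oprho op0).
  by have := opl (-1) w u; rewrite !scaleN1r uw addNr addrC.
exists T; split=> [u|u|a u]; first exact/inj/hT.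
  exact: hT.
by apply: inj; rewrite hT oprho hT.
Qed.

Lemma invert_exists : exists2 T : E -> E, forall u, T (rho c u) = u &
  forall a u, T (rho a u) = rho a (T u).
Proof.
have cl : linear (rho c) by exact: linearP.
have c0 : exists u, rho c u <> 0.
  by have [u] := no_eigenvalue 0; rewrite scale0r; exists u.
have /choice[T hT] := irr_onto irr cl rep_central c0.
have inj u w : rho c u = rho c w -> u = w.
  move=> uw; apply/eqP; rewrite -subr_eq0; apply/eqP.
  by apply: (irr_ker0 irr cl rep_central c0); rewrite linearB/= uw subrr.
by exists T => [u|a u]; apply: inj; rewrite hT// rep_central hT.
Qed.

Local Notation N := cyclic_norm.

Section Resolvent.
Variable T : C -> E -> E.
Hypothesis TK : forall z u, T z (u - z *: rho c u) = u.
Hypothesis KT : forall z u, T z u - z *: rho c (T z u) = u.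
Hypothesis Trho : forall z a u, T z (rho a u) = rho a (T z u).

Let r z := T z v.

(** The resolvent identity r z - r w = T z ((z - w) c (r w)), with [cyclic_norm_comm] applied to
    [T z] and to c. *)
Lemma resolvent_lip z w :
  N (r z - r w) <= normc (z - w) * N (rho c v) * N (r z) * N (r w).
Proof.
have -> : r z - r w = T z ((z - w) *: rho c (r w)).
  have e y : r y = v + y *: rho c (r y) by rewrite -[in RHS](KT y v) subrK.
  have h : r z - r w = z *: rho c (r z) - w *: rho c (r w).
    by rewrite {1}(e z) {1}(e w) opprD addrACA subrr add0r.
  rewrite -[LHS](TK z); congr (T z _); rewrite linearB/= scalerBr opprB scalerBl.
  by rewrite h addrC subrKA.
apply: le_trans (cyclic_norm_comm _ (Trho z)) _.
rewrite cyclic_normZ -/(r z) [leRHS]mulrAC ler_wpM2r ?cyclic_norm_ge0//.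
rewrite -mulrA ler_wpM2l ?normc_nneg// mulrC.
exact: cyclic_norm_comm rep_central.
Qed.

(** [resolvent_lip] gives a local bound around each point, and compactness of a square containing
    the disc makes it uniform. *)
Lemma resolvent_bounded (d : R) :
  exists2 K, 0 <= K & forall z, normc z <= d -> N (r z) <= K.
Proof.
have Icpt : compact (`[- d, d]%classic : set R) by exact: segment_compact.
have /compact_near_coveringP cov := compact_setX Icpt Icpt.
have [|M [_ hM]] := cov R +oo (fun M y => N (r (Complex y.1 y.2)) <= M).
  case=> a b _ /=; pose z := Complex a b : C.
  pose q := N (rho c v) * N (r z).
  have q0 : 0 <= q by rewrite mulr_ge0 ?cyclic_norm_ge0.
  (* This radius in each coordinate keeps |z - w| within 1 / (2 (q + 1)), so the factor in front of
     N (r w) is at most 1/2 and N (r w) <= 2 N (r z). *)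
  have e0 : 0 < (4 * (q + 1))^-1 by rewrite invr_gt0 mulr_gt0// ltr_wpDl.
  exists ([set y | normc (z - Complex y.1 y.2) <= (2 * (q + 1))^-1],
      [set M | 2 * N (r z) <= M]).
    split=> /=; last first.
      by apply: nbhs_pinfty_ge; exact: num_real.
    exists ([set x | `|a - x| < (4 * (q + 1))^-1], [set x | `|b - x| < (4 * (q + 1))^-1]).
      by split=> /=; apply/nbhs_ballP; exists (4 * (q + 1))^-1.
    case=> x y [/= ax bx]; apply: le_trans (normc_le_ReIm (z - Complex x y)) _ => /=.
    have -> : (2 * (q + 1))^-1 = (4 * (q + 1))^-1 + (4 * (q + 1))^-1.
      by field; rewrite gt_eqF// ltr_wpDl.
    by rewrite lerD// ltW.
  case=> [[x y] M] /= [zy rM]; apply: le_trans rM.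
  have := resolvent_lip z (Complex x y); set w := Complex x y; move=> h.
  have h1 : normc (z - w) * N (rho c v) * N (r z) <= 1 / 2.
    rewrite -mulrA -/q; apply: le_trans (ler_wpM2r q0 zy) _.
    rewrite mulrC ler_pdivrMr ?mulr_gt0// ?ltr_wpDl//.
    by rewrite mulrA mul1r mulVf// mul1r lerDl.
  have h2 : N (r w) <= N (r z) + N (r z - r w).
    by rewrite -[in leLHS](subKr (r z) (r w)); exact: cyclic_normB.
  have := ler_wpM2r (cyclic_norm_ge0 (r w)) h1.
  by move: h h2; rewrite -/w; lra.
exists (Num.max 0 (M + 1)); first by rewrite le_max lexx.
case=> a b zd; rewrite le_max; apply/orP; right.
have := hM (M + 1); rewrite ltrDl => /(_ ltr01) /(_ (a, b)).
apply; split; rewrite /= in_itv/= -ler_norml.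
  exact: le_trans (le_Re_normc (Complex a b)) zd.
exact: le_trans (le_Im_normc (Complex a b)) zd.
Qed.

Lemma resolvent_lipschitz (d : R) : exists2 L, 0 < L & forall z w,
  normc z <= d -> normc w <= d -> N (r z - r w) <= L * normc (z - w).
Proof.
have [K K0 hK] := resolvent_bounded d.
have k0 : 0 <= N (rho c v) * K * K by rewrite !mulr_ge0 ?cyclic_norm_ge0.
exists (N (rho c v) * K * K + 1); first by rewrite ltr_wpDl.
move=> z w zd wd; apply: le_trans (resolvent_lip z w) _.
apply: (@le_trans _ _ (normc (z - w) * (N (rho c v) * K * K))).
  rewrite -!mulrA ler_wpM2l ?normc_nneg// ler_wpM2l ?cyclic_norm_ge0//.
  by rewrite ler_pM ?cyclic_norm_ge0// hK.
by rewrite mulrC ler_wpM2r ?normc_nneg// lerDl.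
Qed.

(** Multiplying z by this root changes the sign of z^(2^m). *)
Let omega m : C := (2 ^ m).-root (-1).

Let omegaX m : omega m ^+ (2 ^ m) = -1.
Proof. by rewrite rootCK// expn_gt0. Qed.

Let normc_omega m : normc (omega m) = 1.
Proof.
have n0 : (0 < 2 ^ m)%N by rewrite expn_gt0.
have := congr1 (fun z => Num.norm z) (omegaX m); rewrite normrX normrN1 => /eqP.
by rewrite pexpr_eq1// => /eqP; rewrite Defs.normcE => -[].
Qed.

(* The average of [(1 - z w c)^-1 v] over the [2^m]-th roots of unity [w],
   which equals [(1 - z^(2^m) c^(2^m))^-1 v]. *)
Fixpoint resolvent_avg m z : E :=
  if m is k.+1 then 2^-1 *: (resolvent_avg k z + resolvent_avg k (omega k * z))
  else r z.

Let Y m z u := z ^+ (2 ^ m) *: rho (c ^+ (2 ^ m)) u.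

Let Yrho m z a u : Y m z (rho a u) = rho a (Y m z u).
Proof. by rewrite /Y rep_centralX linearZ. Qed.

Let YB m z u w : Y m z (u - w) = Y m z u - Y m z w.
Proof. by rewrite /Y linearB/= scalerBr. Qed.

Let YD m z u w : Y m z (u + w) = Y m z u + Y m z w.
Proof. by rewrite /Y linearD/= scalerDr. Qed.

Let YS m z u : Y m.+1 z u = Y m z (Y m z u).
Proof.
by rewrite /Y linearZ/= scalerA -!exprD addnn -mul2n -expnS -rep_mul -exprD
  addnn -mul2n -expnS.
Qed.

Let Yomega m z u : Y m (omega m * z) u = - Y m z u.
Proof. by rewrite /Y exprMn omegaX mulN1r scaleNr. Qed.

(** The induction step is (1 - Y)^-1 + (1 + Y)^-1 = 2 (1 - Y^2)^-1; rotating by [omega m] supplies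
    the second summand. *)
Lemma resolvent_avgP m z : resolvent_avg m z - Y m z (resolvent_avg m z) = v.
Proof.
elim: m z => [|m IH] z; first by rewrite /Y expn0 !expr1 /= KT.
have h1 := IH z; have h2 := IH (omega m * z).
rewrite /= YS; set g := resolvent_avg m z in h1 *.
set g' := resolvent_avg m (omega m * z) in h2 *.
rewrite Yomega opprK in h2.
have Z u : Y m z (2^-1 *: u) = 2^-1 *: Y m z u.
  by rewrite /Y linearZ/= !scalerA mulrC.
have e1 : g - Y m z (Y m z g) = v + Y m z v.
  by rewrite -{1}h1 -[in RHS]h1 YB subrKA.
have e2 : g' - Y m z (Y m z g') = v - Y m z v.
  by rewrite -{1}h2 -[in RHS]h2 YD opprD addrA addrK.
rewrite !Z -scalerBr !YD opprD addrACA e1 e2 addrACA subrr addr0.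
by rewrite -[v + v]mulr2n -[v *+ 2]scaler_nat scalerA mulVf ?scale1r// pnatr_eq0.
Qed.

(** Rotations preserve the disc and its distances, so averaging keeps the constant [L], whatever
    [m]. *)
Lemma resolvent_avg_lipschitz (d L : R) : 
  (forall z w, normc z <= d -> normc w <= d -> N (r z - r w) <= L * normc (z - w)) ->
  forall m z w, normc z <= d -> normc w <= d ->
    N (resolvent_avg m z - resolvent_avg m w) <= L * normc (z - w).
Proof.
move=> lip; elim=> [|m IH] z w zd wd //=; first exact: lip.
rewrite -scalerBr opprD addrACA cyclic_normZ.
have om u : normc (omega m * u) = normc u by rewrite normcM normc_omega mul1r.
have h1 := IH z w zd wd.
have := IH (omega m * z) (omega m * w); rewrite !om -mulrBr om => /(_ zd wd) h2.
have -> : normc (2^-1 : C) = 2^-1.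
  have -> : (2^-1 : C) = real_complex R 2^-1 by rewrite fmorphV rmorph_nat.
  by rewrite normc_real ger0_norm.
apply: le_trans (ler_wpM2l _ (cyclic_normD _ _)) _; first by [].
by move: h1 h2; lra.
Qed.

Let y m (t : R) := N (Y m (real_complex R t) v).

Let yS m t : y m.+1 t <= y m t ^+ 2.
Proof.
rewrite /y YS expr2; apply: cyclic_norm_comm; exact: Yrho.
Qed.

Let y_ge0 m t : 0 <= y m t. Proof. exact: cyclic_norm_ge0. Qed.

Let good (t : R) := exists m, y m t < 1 / 2.

(** A small power at t puts the average at t close to v; the uniform Lipschitz bound carries this to
    t', where a small power is read off again. The step length depends on [L] only, not on [m]. *)
Lemma resolvent_step (d L t t' : R) : 0 < L ->
  (forall z w, normc z <= d -> normc w <= d -> N (r z - r w) <= L * normc (z - w)) ->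
  0 <= t <= d -> 0 <= t' <= d -> L * `|t - t'| <= 1 / 8 -> good t -> good t'.
Proof.
move=> L0 /resolvent_avg_lipschitz lip /andP[t0 td] /andP[t'0 t'd] tt' [m ym].
(* Two squarings bring 1/2 down to 1/16. Then N (g - v) <= (N (g - v) + 1) / 16 gives 1/15, and 1/15
   + 1/8 < 1/5. *)
have y2 : y m.+2 t <= 1 / 16.
  have h1 : y m.+1 t <= (1 / 2) ^+ 2.
    by apply: le_trans (yS _ _) _; rewrite ler_pXn2r ?nnegrE ?(ltW ym).
  apply: le_trans (yS _ _) _; have -> : 1 / 16 = ((1 / 2) ^+ 2) ^+ 2 :> R by field.
  by rewrite ler_pXn2r ?nnegrE// exprn_ge0.
pose z := real_complex R t; pose z' := real_complex R t'.
pose g := resolvent_avg m.+2 z; pose g' := resolvent_avg m.+2 z'.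
have gv : g - v = Y m.+2 z g.
  by rewrite -[X in _ - X](resolvent_avgP m.+2 z) subKr.
have ge : N (g - v) <= 1 / 15.
  have h1 : N (g - v) <= N g * y m.+2 t.
    by rewrite gv; apply: cyclic_norm_comm; exact: Yrho.
  have h2 : N g <= N (g - v) + 1.
    by rewrite -[in leLHS](subrK v g) -cyclic_norm_gen cyclic_normD.
  have h3 := ler_wpM2l (cyclic_norm_ge0 g) y2.
  by move: h1 h2 h3; lra.
have ge' : N (g' - v) <= 1 / 5.
  have h1 : N (g' - g) <= 1 / 8.
    apply: le_trans (lip m.+2 z' z _ _) _; rewrite ?normc_real ?ger0_norm//.
    by rewrite -[z' - z]/(real_complex R t' - real_complex R t) -(rmorphB (real_complex R))
      (normc_real (t' - t)) distrC.
  have h2 : N (g' - v) <= N (g' - g) + N (g - v).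
    by rewrite -[in leLHS](subrKA g) cyclic_normD.
  by move: ge h1 h2; lra.
exists m.+2.
(* Applying 1 - Y to g' - v leaves v - (v - Y v) = Y v. *)
have h1 : Y m.+2 z' v = g' - v - Y m.+2 z' (g' - v).
  rewrite YB opprB [Y _ _ v - _]addrC addrACA.
  by rewrite [X in X + _](resolvent_avgP m.+2 z') addNKr.
have h2 : y m.+2 t' <= N (g' - v) * (1 + y m.+2 t').
  rewrite {1}/y h1.
  have h3 : N (v - Y m.+2 z' v) <= 1 + y m.+2 t'.
    by apply: le_trans (cyclic_normB _ _) _; rewrite cyclic_norm_gen.
  apply: le_trans (ler_wpM2l (cyclic_norm_ge0 _) h3).
  apply: (cyclic_norm_comm (T := fun u => u - Y m.+2 z' u)) => a u.
  by rewrite Yrho linearB.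
exact: lt_half_of_le_mul (y_ge0 _ _) ge' h2.
Qed.

Lemma resolvent_powers_small (d : R) : 0 <= d -> exists m,
  N ((real_complex R d) ^+ (2 ^ m) *: rho (c ^+ (2 ^ m)) v) < 1 / 2.
Proof.
move=> d0; have [L L0 lip] := resolvent_lipschitz d.
have e0 : 0 < (8 * L)^-1 by rewrite invr_gt0 mulr_gt0.
(* [n] counts steps of length 1 / (8 L) from 0, where the power vanishes; the maximum below
   truncates the first step. *)
have H (n : nat) : forall t, 0 <= t <= d -> t <= n%:R * (8 * L)^-1 -> good t.
  elim: n => [|n IH] t /andP[t0 td] tn.
    exists 0; have -> : t = 0 by apply/eqP; rewrite eq_le t0 andbT -(mul0r (8 * L)^-1).
    rewrite /y /Y expn0 expr1 (rmorph0 (real_complex R)) scale0r.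
    by rewrite -(scale0r (0 : E)) cyclic_normZ normc0 mul0r divr_gt0.
  pose t' := Num.max 0 (t - (8 * L)^-1).
  have t't : t' <= t by rewrite ge_max t0/= gerBl ltW.
  have t'0 : 0 <= t' by rewrite le_max lexx.
  have tt' : t - (8 * L)^-1 <= t' by rewrite le_max lexx orbT.
  apply: (@resolvent_step d L t') => //.
  - by rewrite t'0 (le_trans t't).
  - by rewrite t0.
  - rewrite distrC ger0_norm ?subr_ge0//.
    rewrite -ler_pdivlMl//; apply: le_trans (_ : (8 * L)^-1 <= _).
      by rewrite lerBlDr -lerBlDl.
    by rewrite invfM mulrC div1r.
  apply: IH; first by rewrite t'0 (le_trans t't).
  rewrite ge_max mulr_ge0 ?ler0n ?(ltW e0)//= lerBlDr.
  by apply: le_trans tn _; rewrite -natr1 mulrDl mul1r.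
have [n dn] : exists n : nat, d <= n%:R * (8 * L)^-1.
  exists (Num.bound (d * (8 * L))); rewrite ler_pdivlMr ?mulr_gt0//.
  apply/ltW/archi_boundP; by rewrite !mulr_ge0// ltW.
by apply: (H n) => //; rewrite d0 lexx.
Qed.

End Resolvent.

(** The radius is the norm of the inverse [U] of c: undoing c^(2^m) costs at most the factor N (U
    v)^(2^m), so 1 = N v would be below 1/2. *)
Lemma no_eigenvalue_absurd : False.
Proof.
have /choice[T hT] := resolvent_exists.
have [U Uc Urho] := invert_exists.
have [m hm] := resolvent_powers_small (fun z => let: And3 h _ _ := hT z in h)
  (fun z => let: And3 _ h _ := hT z in h) (fun z => let: And3 _ _ h := hT z in h)
  (cyclic_norm_ge0 (U v)).
have UX n u : iter n U (rho (c ^+ n) u) = u.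
  elim: n u => [|n IH] u; first by rewrite expr0 /= rep1.
  by rewrite iterSr exprS rep_mul Uc IH.
have NU n u : N (iter n U u) <= N (U v) ^+ n * N u.
  elim: n => [|n IH]; first by rewrite expr0 mul1r.
  rewrite exprS -mulrA mulrC; apply: le_trans (ler_wpM2r (cyclic_norm_ge0 _) IH).
  exact: cyclic_norm_comm _ Urho.
have := NU (2 ^ m)%N (rho (c ^+ (2 ^ m)) v); rewrite UX cyclic_norm_gen.
move: hm; rewrite cyclic_normZ -(rmorphXn (real_complex R)) (normc_real (_ ^+ _)).
rewrite ger0_norm ?exprn_ge0 ?cyclic_norm_ge0//.
move=> h1 h2; have := le_lt_trans h2 h1.
by rewrite ltr_pdivlMr// mul1r -[ltRHS]mulr1n ltr_nat.
Qed.

End NoEigenvalue.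
End CyclicNorm.

(* Gelfand-Mazur without complex analysis: if [c] had no eigenvalue, the averages of
   the resolvent would all satisfy the Lipschitz bound of the resolvent itself, so
   [d^(2^m) c^(2^m) v] would become small along [m] for every radius [d]; this
   propagates from [d = 0] in steps of fixed length. But [c] would be invertible. *)
Theorem central_scalar c : (forall a, c * a = a * c) ->
  exists l : C, forall u, rho c u = l *: u.
Proof.
move=> cc; apply: contrapT => h.
have [a [v av]] := irr.1.
have v0 : v <> 0 by move=> v0; apply: av; rewrite v0 linear0.
apply: (no_eigenvalue_absurd v0 cc) => l; apply: contrapT => h'; apply: h.
by exists l => u; apply: contrapT => uu; apply: h'; exists u.
Qed.

End BanachSchur.

(** * The representation attached to an orbit and a point of the circle *)

Section Singles.
Context {R : realType} {S : dynsys}.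
Local Notation C := (Cplx R).
Local Notation A := (ell1 R S).

Lemma single_closed n (f : S -> C) : continuous f ->
  (fun m y => (m == n)%:R * f y) \in ell1_pred R S.
Proof.
move=> cf; apply/ell1P; split.
  by move=> m y; apply: cvgM; [exact: cvg_cst | exact: cf].
exists (supnorm f) => B; apply: (@le_trans _ _ (\sum_(m <- B) (m == n)%:R * supnorm f)).
  apply: ler_sum => m _; apply: supnorm_le => y; rewrite normcM.
  case: (m == n); rewrite ?normc1 ?normc0 ?mul0r// !mul1r.
  exact: le_supnorm.
have [nB|nB] := boolP (n \in B).
  rewrite (big_fsetD1 n)//= eqxx mul1r big1_fset ?addr0// => i.
  by rewrite !inE => /andP[/negbTE ->]; rewrite mul0r.
rewrite big1_fset ?supnorm_ge0// => i iB _; case: eqP => [i0|]; rewrite ?mul0r//.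
by move: nB; rewrite -i0 iB.
Qed.

(* The element [f delta^n] of the algebra. *)
Definition single n (f : S -> C) (cf : continuous f) : A := Ell1 (single_closed n cf).

Lemma singleE n (f : S -> C) (cf : continuous f) m y : single n cf m y = (m == n)%:R * f y.
Proof. by []. Qed.

Lemma single_mulE n (f : S -> C) (cf : continuous f) (a : A) m y :
  (single n cf * a) m y = f y * a (m - n) (act (- n) y).
Proof.
apply: has_sum_uniq (ell1_has_sumM _ _ _ _) _.
have -> : f y * a (m - n) (act (- n) y) =
  (fun k => single n cf k y * a (m - k) (act (- k) y)) n.
  by rewrite singleE eqxx mul1r.
by apply: has_sum1 => k /negbTE kn; rewrite singleE kn !mul0r.
Qed.

Lemma mul_singleE n (f : S -> C) (cf : continuous f) (a : A) m y :
  (a * single n cf) m y = a (m - n) y * f (act (n - m) y).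
Proof.
apply: has_sum_uniq (ell1_has_sumM _ _ _ _) _.
have -> : a (m - n) y * f (act (n - m) y) =
  (fun k => a k y * single n cf (m - k) (act (- k) y)) (m - n).
  by rewrite singleE opprB [in RHS]addrCA subrr addr0 eqxx mul1r.
apply: has_sum1 => k kn; rewrite singleE; case: eqP => [mk|]; last first.
  by rewrite mul0r mulr0.
by move: kn; rewrite -mk opprB addrCA subrr addr0 eqxx.
Qed.

Lemma ell1_norm_single n (f : S -> C) (cf : continuous f) M :
  (forall y, normc (f y) <= M) -> ell1_norm (single n cf) <= M.
Proof.
move=> fM; apply: ell1_norm_le => B.
have M0 : 0 <= M by have [y _] := dspace_nonempty S; exact: le_trans (normc_nneg _) (fM y).
apply: (@le_trans _ _ (\sum_(m <- B) (m == n)%:R * M)).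
  apply: ler_sum => m _; apply: supnorm_le => y; rewrite singleE normcM.
  by case: (m == n); rewrite ?normc1 ?normc0 ?mul0r// !mul1r.
have [nB|nB] := boolP (n \in B).
  rewrite (big_fsetD1 n)//= eqxx mul1r big1_fset ?addr0// => i.
  by rewrite !inE => /andP[/negbTE ->]; rewrite mul0r.
rewrite big1_fset// => i iB _; case: eqP => [i0|]; rewrite ?mul0r//.
by move: nB; rewrite -i0 iB.
Qed.

(** Truncation to [B] leaves an error supported off [B], of norm at most the defect of the partial
    sum over [B]. *)
Lemma finite_approx (a : A) (e : R) : 0 < e -> exists B : {fset int},
  ell1_norm (a - \sum_(n <- B) single n (@ell1_continuous _ _ a n)) < e.
Proof.
move=> e0; have e2 : 0 < e / 2 by rewrite divr_gt0.
pose X := [set \sum_(n <- B) supnorm (a n) | B in [set: {fset int}]].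
have [|_ [B _ <-] hB] := @sup_adherent _ X _ e2.
  split; first by exists (\sum_(n <- fset0) supnorm (a n)), fset0.
  by exists (ell1_norm a) => _ [D _ <-]; exact: ell1_norm_bounded.
exists B; apply: (@le_lt_trans _ _ (e / 2)); last by rewrite ltr_pdivrMr// ltr_pMr// ltr1n.
set b := \sum_(n <- B) _; apply: ell1_norm_le => D.
have bE m y : b m y = (m \in B)%:R * a m y.
  rewrite /b ell1_eval_sum; under eq_bigr do rewrite singleE.
  have [mB|mB] := boolP (m \in B).
    rewrite (big_fsetD1 m)//= eqxx big1_fset ?addr0// => i.
    by rewrite !inE eq_sym => /andP[/negbTE im _] _; rewrite im mul0r.
  rewrite mul0r big1_fset// => i iB _; case: eqP => [mi|]; rewrite ?mul0r//.
  by move: mB; rewrite mi iB.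
apply: (@le_trans _ _ (\sum_(n <- (D `|` B)%fset) (n \notin B)%:R * supnorm (a n))).
  apply: le_trans (_ : \sum_(n <- D) (n \notin B)%:R * supnorm (a n) <= _); last first.
    apply: fset_sum_mono (fsubsetUl _ _) => n.
    by rewrite mulr_ge0 ?supnorm_ge0.
  apply: ler_sum => n _; apply: supnorm_le => y; rewrite ell1_evalB bE.
  case: (n \in B); rewrite /= ?mul1r ?subrr ?normc0 ?mul0r// subr0.
  by apply: le_supnorm; exact: ell1_continuous.
rewrite (fset_big_split _ (fsubsetUr D B))/= [X in X + _]big1_fset ?add0r; last first.
  by move=> i -> _; rewrite mul0r.
have hD := ell1_norm_bounded a (D `|` B)%fset.
rewrite (fset_big_split _ (fsubsetUr D B))/= in hD.
apply: (@le_trans _ _ (\sum_(i <- ((D `|` B) `\` B)%fset) supnorm (a i))).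
  by apply: ler_sum => i _; case: (i \in B); rewrite ?mul0r ?mul1r ?supnorm_ge0.
by move: hB hD; rewrite -/(ell1_norm a); lra.
Qed.

End Singles.

Section QuasiPeriodic.
Context {R : realType}.
Local Notation C := (Cplx R).

(** Functions on all of Z instead of p coordinates: delta is then a plain shift, with no wrap-around
    case in which [l] appears. *)
Definition qper_pred (p : nat) (l : C) : {pred int -> C} :=
  fun h => `[< forall j, h (j - p%:Z) = l * h j >].

Lemma qper_submod_closed p l : submod_closed (qper_pred p l).
Proof.
split; first by apply/asboolP => j; rewrite mulr0.
move=> k g h /asboolP hg /asboolP hh; apply/asboolP => j.
rewrite -[LHS]/(k * g (j - p%:Z) + h (j - p%:Z)) hg hh.
by rewrite -[X in _ = _ * X]/(k * g j + h j) mulrDr mulrCA.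
Qed.

HB.instance Definition _ p l :=
  GRing.isSubmodClosed.Build C (int -> C) (qper_pred p l) (qper_submod_closed p l).

End QuasiPeriodic.

(* The p-dimensional module on which delta acts as the shift, so that delta^p acts
   as the scalar l. *)
Record qper (R : realType) (p : nat) (l : Cplx R) := Qper {
  qper_val :> int -> Cplx R;
  qper_valP : qper_val \in qper_pred p l }.

HB.instance Definition _ R p l := [isSub for @qper_val R p l].
HB.instance Definition _ R p l := [Choice of @qper R p l by <:].
HB.instance Definition _ R p l := [SubChoice_isSubLmodule of @qper R p l by <:].

Section QuasiPeriodicTheory.
Context {R : realType}.
Local Notation C := (Cplx R).
Variables (p : nat) (l : C).
Hypotheses (p_gt0 : (0 < p)%N) (l_norm : normc l = 1).
Local Notation E := (qper p l).
Implicit Types (h : E).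

Lemma qperP h j : h (j - p%:Z) = l * h j.
Proof. by have /asboolP := qper_valP h. Qed.

Lemma qper_inj h1 h2 : h1 =1 h2 -> h1 = h2.
Proof. by move=> h12; apply: val_inj; apply/funext. Qed.

Lemma qperD h1 h2 j : (h1 + h2 : E) j = h1 j + h2 j. Proof. by []. Qed.
Lemma qperZ (k : C) h j : (k *: h : E) j = k * h j. Proof. by []. Qed.

Lemma qper_eval_sum I (r : seq I) (F : I -> E) j :
  (\sum_(i <- r) F i : E) j = \sum_(i <- r) F i j.
Proof. by elim/big_ind2 : _ => // ? ? ? ? <- <-. Qed.

Lemma unit_normc_neq0 : l != 0.
Proof.
apply: contra_eqN l_norm => /eqP ->; rewrite normc0 eq_sym.
exact: oner_neq0.
Qed.

Lemma qper_shift h j (n : int) : h (j + n * p%:Z) = l ^ (- n) * h j.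
Proof.
have l0 := unit_normc_neq0.
elim/int_rec: n j => [|n IH|n IH] j; first by rewrite mul0r addr0 oppr0 expr0z mul1r.
  rewrite -addn1 PoszD mulrDl mul1r addrA.
  have := qperP h (j + n%:Z * p%:Z + p%:Z); rewrite addrK IH => e.
  apply: (mulfI l0); rewrite -e mulrA; congr (_ * _).
  by rewrite opprD expfzDr// exprN1 mulrCA divff ?mulr1.
rewrite -addn1 PoszD opprD mulrDl mulN1r addrA qperP IH mulrA.
by congr (_ * _); rewrite opprD !opprK expfzDr// expr1z mulrC.
Qed.

Lemma normc_exprz (n : int) : normc (l ^ n) = 1.
Proof.
have h (m : nat) : normc (l ^+ m) = 1.
  by elim: m => [|m IH]; rewrite ?expr0 ?normc1// exprS normcM IH l_norm mulr1.
by case: n => n; rewrite ?NegzE -?exprnN -?exprnP// normcV h invr1.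
Qed.

Lemma divz_decomp (j : int) : j = (j %% p%:Z)%Z + (j %/ p%:Z)%Z * p%:Z.
Proof. by rewrite addrC -divz_eq. Qed.

Lemma qper_bounded h : exists2 M, 0 <= M & forall j, normc (h j) <= M.
Proof.
exists (\sum_(i < p) normc (h i%:Z)); first by apply: sumr_ge0 => i _; exact: normc_nneg.
move=> j; rewrite {1}[j]divz_decomp qper_shift normcM normc_exprz mul1r.
have pz : p%:Z != 0 by rewrite gt_eqF.
have := ltz_pmod j (p_gt0 : 0 < p%:Z); have := modz_ge0 j pz.
case: (j %% p%:Z)%Z => // i _ ip.
rewrite (bigD1 (Ordinal (ip : (i < p)%N)))//= lerDl.
by apply: sumr_ge0 => k _; exact: normc_nneg.
Qed.

(** The quasi-periodic extension of the point mass at [i]. Any integer [i] is allowed, so that a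
    basis can start at any base point, as in [qper_basis_sum]. *)
Definition qper_basis_fun (i j : int) : C :=
  if (p%:Z %| j - i)%Z then l ^ (- ((j - i) %/ p%:Z)%Z) else 0.

Lemma qper_basis_closed i : qper_basis_fun i \in qper_pred p l.
Proof.
have l0 := unit_normc_neq0.
have pz : p%:Z != 0 by rewrite gt_eqF.
apply/asboolP => j; rewrite /qper_basis_fun addrAC.
have -> : (p%:Z %| j - i - p%:Z)%Z = (p%:Z %| j - i)%Z by rewrite rpredBr// dvdzz.
case: ifPn => [ji|_]; last by rewrite mulr0.
rewrite -[X in (X %/ _)%Z](_ : (-1) * p%:Z + (j - i) = _); last by rewrite mulN1r addrC.
by rewrite divzMDl// opprD opprK expfzDr// expr1z mulrC.
Qed.

Definition qper_basis i : E := Qper (qper_basis_closed i).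

Lemma qper_basisE i j : qper_basis i j =
  if (p%:Z %| j - i)%Z then l ^ (- ((j - i) %/ p%:Z)%Z) else 0.
Proof. by []. Qed.

Lemma qper_basis_diag i : qper_basis i i = 1.
Proof. by rewrite qper_basisE subrr dvdz0 div0z oppr0 expr0z. Qed.

Lemma qper_basis_le1 i j : normc (qper_basis i j) <= 1.
Proof.
by rewrite qper_basisE; case: ifP => _; rewrite ?normc_exprz ?normc0.
Qed.

Lemma qper_basis_sum (k : int) h :
  h = \sum_(i < p) h (k + i%:Z) *: qper_basis (k + i%:Z).
Proof.
have pz : p%:Z != 0 by rewrite gt_eqF.
apply: qper_inj => j; rewrite qper_eval_sum.
under eq_bigr do rewrite qperZ qper_basisE.
have := ltz_pmod (j - k) (p_gt0 : 0 < p%:Z); have := modz_ge0 (j - k) pz.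
have := divz_decomp (j - k); set q := ((j - k) %/ p%:Z)%Z.
case: ((j - k) %% p%:Z)%Z => // i jk _ ip.
have jE : j = k + i%:Z + q * p%:Z by rewrite -addrA -jk addrC subrK.
rewrite (bigD1 (Ordinal (ip : (i < p)%N)))//= big1 => [|m mi].
  have e : j - (k + i%:Z) = q * p%:Z by rewrite {1}jE addrAC subrr add0r.
  by rewrite addr0 {1}jE e dvdz_mull// mulzK// qper_shift mulrC.
case: ifPn => [|_]; last by rewrite mulr0.
have -> : j - (k + m%:Z) = i%:Z - m%:Z + q * p%:Z by rewrite jE; ring.
rewrite rpredDr ?dvdz_mull// => h1; exfalso.
move: mi; rewrite -val_eqE /=; apply/negP/negPn.
have : i%:Z = m%:Z %[mod p%:Z]%Z by apply/eqP; rewrite eqz_mod_dvd.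
by rewrite !modz_nat !modn_small// => -[->].
Qed.

End QuasiPeriodicTheory.

Section OrbitRepresentation.
Context {R : realType} {S : dynsys}.
Local Notation C := (Cplx R).
Local Notation A := (ell1 R S).
Variables (p : nat) (l : C).
Hypotheses (p_gt0 : (0 < p)%N) (l_norm : normc l = 1).
Hypothesis act_period : forall y : S, act p%:Z y = y.
Variable x : S.
Local Notation E := (qper p l).
Implicit Types (a b : A) (h : E).

Definition orbit_op_fun (a : A) (h : E) : int -> C :=
  fun j => summability.sum (fun n => a n (act j x) * h (j - n)).

Lemma orbit_has_sum_fun a h j :
  has_sum (fun n => a n (act j x) * h (j - n)) (orbit_op_fun a h j).
Proof.
have [M M0 hM] := qper_bounded p_gt0 l_norm h.
have [|s hs] := @has_sum_exists R _ (fun n => a n (act j x) * h (j - n)) (M * ell1_norm a).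
  apply: bounded_le (bounded_Z M0 (ell1_norm_bounded a)) => n.
  rewrite normcM mulrC ler_pM ?normc_nneg// le_supnorm//.
  exact: ell1_continuous.
by rewrite /orbit_op_fun (csumP hs).
Qed.

Lemma act_shift j : act (j - p%:Z) x = act j x.
Proof. by rewrite -[in RHS](subrK p%:Z j) [RHS]actD act_period. Qed.

Lemma orbit_op_closed a h : orbit_op_fun a h \in qper_pred p l.
Proof.
apply/asboolP => j; apply: has_sum_uniq (orbit_has_sum_fun a h _) _.
have := has_sumZ l (orbit_has_sum_fun a h j); apply: has_sum_ext => n.
by rewrite act_shift mulrCA -qperP addrAC.
Qed.

Definition orbit_op a h : E := Qper (orbit_op_closed a h).

Lemma orbit_has_sum a h j :
  has_sum (fun n => a n (act j x) * h (j - n)) (orbit_op a h j).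
Proof. exact: orbit_has_sum_fun. Qed.

Lemma orbit_op_linear a : linear (orbit_op a).
Proof.
move=> k g h; apply: qper_inj => j; apply: has_sum_uniq (orbit_has_sum _ _ _) _.
have := has_sumD (has_sumZ k (orbit_has_sum a g j)) (orbit_has_sum a h j).
by apply: has_sum_ext => n; rewrite qperD qperZ mulrDr mulrCA.
Qed.

HB.instance Definition _ a :=
  GRing.isLinear.Build C E E *:%R (orbit_op a) (orbit_op_linear a).

Lemma orbit_op_linearl (k : C) a b h :
  orbit_op (k *: a + b) h = k *: orbit_op a h + orbit_op b h.
Proof.
apply: qper_inj => j; apply: has_sum_uniq (orbit_has_sum _ _ _) _.
have := has_sumD (has_sumZ k (orbit_has_sum a h j)) (orbit_has_sum b h j).
by apply: has_sum_ext => n; rewrite ell1_evalD ell1_evalZ mulrDl mulrA.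
Qed.

Lemma orbit_opM a b h : orbit_op (a * b) h = orbit_op a (orbit_op b h).
Proof.
apply: qper_inj => j; have [M M0 hM] := qper_bounded p_gt0 l_norm h.
pose F n k := a k (act j x) * b (n - k) (act (- k) (act j x)) * h (j - n).
have [N hN] := conv_bounded (ell1_valP a) (ell1_valP b).
have [s hs] : exists s, has_sum (fun q : int * int => F q.1 q.2) s.
  apply: (@has_sum_exists R _ _ (M * N)).
  apply: bounded_le (bounded_Z M0 hN) => -[n k] /=.
  rewrite /F normcM mulrC ler_pM ?normc_nneg//.
  exact: conv_term (ell1_valP a) (ell1_valP b) _ _ _.
have e1 : orbit_op (a * b) h j = s.
  apply: has_sum_uniq (orbit_has_sum _ _ _) _.
  apply: (has_sum_fubini hs) => n; rewrite mulrC.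
  have := has_sumZ (h (j - n)) (ell1_has_sumM a b n (act j x)).
  by apply: has_sum_ext => k; rewrite mulrC.
rewrite e1; apply/esym; apply: has_sum_uniq (orbit_has_sum _ _ _) _.
have hs' := has_sum_reindex (h := fun q : int * int => (q.2, q.1))
  (k := fun q : int * int => (q.2, q.1)) _ _ hs.
apply: (has_sum_fubini (F := fun k n => F n k) (hs' _ _)); try by case.
move=> k; have := has_sumZ (a k (act j x)) (orbit_has_sum b h (j - k)).
move=> /(has_sum_reindex (h := fun n => n - k) (k := fun n => n + k)
  (subrK k) (addrK k)); apply: has_sum_ext => n.
rewrite /F /= -mulrA -actD [- k + j]addrC; congr (_ * (_ * h _)).
by rewrite opprB addrA subrK.
Qed.

Definition orbit_rep : representation A E :=
  @Representation _ _ _ (fun a => orbit_op a : {linear E -> E}) orbit_op_linearl orbit_opM.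

Lemma orbit_rep_has_sum a h j :
  has_sum (fun n => a n (act j x) * h (j - n)) (orbit_rep a h j).
Proof. exact: orbit_has_sum_fun. Qed.

Lemma orbit_rep_single n (f : S -> C) (cf : continuous f) h j :
  orbit_rep (single n cf) h j = f (act j x) * h (j - n).
Proof.
apply: has_sum_uniq (orbit_rep_has_sum _ _ _) _.
have -> : f (act j x) * h (j - n) =
    (fun m => single n cf m (act j x) * h (j - m)) n.
  by rewrite singleE eqxx mul1r.
by apply: has_sum1 => m /negbTE mn; rewrite singleE mn !mul0r.
Qed.

End OrbitRepresentation.

(** * Exact period of the action *)

Section OrbitPeriod.
Variables (S : dynsys) (p : nat).
Hypothesis p_gt0 : (0 < p)%N.
Hypothesis orbits_of_order_p : forall x : S, (orbit_of x #= `I_p)%card.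
Implicit Types (x : S).

Lemma act_inj n : injective (@act S n).
Proof. by move=> x y e; rewrite -[x]act0 -[y]act0 -(addNr n) !actD e. Qed.

Lemma act_subn (i j : nat) x :
  (i <= j)%N -> act i%:Z x = act j%:Z x -> act (j - i)%N%:Z x = x.
Proof.
move=> ij e; apply: (@act_inj i%:Z).
by rewrite -[LHS]actD -PoszD subnKC.
Qed.

Lemma act_mulz_fix q n x : act q x = x -> act (n * q) x = x.
Proof.
move=> qx; elim/int_rec: n => [|n IH|n IH]; first by rewrite mul0r.
  by rewrite -addn1 PoszD mulrDl mul1r actD qx.
apply: (@act_inj q); rewrite -actD qx -addn1 PoszD opprD mulrDl mulN1r.
by rewrite addrC subrK.
Qed.

(** Without a period the points act 0 x, ..., act p x would be p + 1 distinct points of a p-element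
    orbit. *)
Lemma orbit_least_period x : exists2 q : nat, (0 < q)%N &
  act q%:Z x = x /\ forall n : nat, (0 < n)%N -> act n%:Z x = x -> (q <= n)%N.
Proof.
pose per n := (0 < n)%N && `[< act n%:Z x = x >].
have exn : exists n, per n.
  apply: contrapT => h.
  have inj : {in `I_p.+1 &, injective (fun i : nat => act i%:Z x)}.
    have lt i j : (i < j)%N -> act i%:Z x <> act j%:Z x.
      move=> ij e; apply: h; exists (j - i)%N; rewrite /per subn_gt0 ij/=.
      by apply/asboolP; exact: act_subn (ltnW ij) e.
    move=> i j _ _ e; have [ij|ji|//] := ltngtP i j; exfalso.
      exact: lt ij e.
    exact: lt ji (esym e).
  have : (`I_p.+1 #<= `I_p)%card.
    rewrite -(card_le_eqr (orbits_of_order_p x)) -(card_le_eql (inj_card_eq inj)).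
    by apply: subset_card_le => _ [i _ <-]; exists i%:Z.
  by rewrite card_le_II ltnn.
case: (ex_minnP exn) => q /andP[q0 /asboolP qx] qmin; exists q => //.
by split=> // n n0 nx; apply: qmin; rewrite /per n0; apply/asboolP.
Qed.

Lemma act_mod (q : nat) n x : act q%:Z x = x -> act n x = act (n %% q%:Z)%Z x.
Proof. by move=> qx; rewrite {1}(divz_eq n q%:Z) addrC actD act_mulz_fix. Qed.

(** For the least period q the first q iterates are distinct and exhaust the orbit; counting gives q
    = p. *)
Lemma orbit_period_min x : act p%:Z x = x /\
  forall n : nat, (0 < n)%N -> act n%:Z x = x -> (p <= n)%N.
Proof.
have [q q0 [qx qmin]] := orbit_least_period x.
suff -> : p = q by [].
apply/card_eq_II; rewrite -(card_eql (orbits_of_order_p x)).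
have inj : {in `I_q &, injective (fun i : nat => act i%:Z x)}.
  have lt i j : (i < j)%N -> (j < q)%N -> act i%:Z x <> act j%:Z x.
    move=> ij jq e; have : (q <= j - i)%N.
      by apply: qmin; [rewrite subn_gt0 | exact: act_subn (ltnW ij) e].
    by rewrite leqNgt (leq_ltn_trans (leq_subr _ _) jq).
  move=> i j /set_mem/= iq /set_mem/= jq e; have [ij|ji|//] := ltngtP i j; exfalso.
    exact: lt ij jq e.
  exact: lt ji iq (esym e).
rewrite -(card_eqr (inj_card_eq inj)).
suff -> : orbit_of x = [set act i%:Z x | i in `I_q] by exact: card_eqxx.
apply/seteqP; split=> [_ [n _ <-]|_ [i _ <-]]; last by exists i%:Z.
have qz : q%:Z != 0 by rewrite gt_eqF.
rewrite (act_mod _ qx); have := ltz_pmod n (q0 : 0 < q%:Z); have := modz_ge0 n qz.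
by case: (n %% q%:Z)%Z => // i _ iq; exists i.
Qed.

Lemma act_period x : act p%:Z x = x. Proof. exact: (orbit_period_min x).1. Qed.

Lemma act_fix_dvd n x : act n x = x -> (p%:Z %| n)%Z.
Proof.
have pz : p%:Z != 0 by rewrite gt_eqF.
rewrite (act_mod _ (act_period x)) => h; apply/dvdz_mod0P; move: h.
have := ltz_pmod n (p_gt0 : 0 < p%:Z); have := modz_ge0 n pz.
case: (n %% p%:Z)%Z => // -[//|i] _ ip ix; exfalso.
have := (orbit_period_min x).2 i.+1 isT ix.
by rewrite leqNgt (ip : (i.+1 < p)%N).
Qed.

Lemma act_dvd n x : (p%:Z %| n)%Z -> act n x = x.
Proof. by move=> /dvdzP[m ->]; apply: act_mulz_fix; exact: act_period. Qed.

End OrbitPeriod.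

Section Urysohn.
Context {R : realType} {S : dynsys}.
Local Notation C := (Cplx R).

Lemma real_complex_continuous (f : S -> R) : continuous f ->
  continuous (fun x => real_complex R (f x) : C).
Proof.
move=> cf; apply/cplx_continuousP => x e e0.
have /pseudometric_normed_Zmodule.cvgrPdist_lt/(_ e e0) := cf x.
by apply: filterS => y; rewrite -(rmorphB (real_complex R)) (normc_real (_ - _)).
Qed.

Lemma dynsys_urysohn (K : set S) x : closed K -> ~ K x ->
  exists f : S -> C, [/\ continuous f, f x = 1 & forall y, K y -> f y = 0].
Proof.
move=> cK Kx.
have cx : closed [set x].
  by apply: accessible_closed_set1; apply: hausdorff_accessible;
    exact: dspace_hausdorff.
have /normal_separatorP sep := compact_normal (@dspace_hausdorff S) (@dspace_compact S).
have K0 : K `&` [set x] = set0.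
  by rewrite -subset0 => y [Ky]; rewrite /= => yx; apply: Kx; rewrite -yx.
have /(@uniform_separatorP _ R)[f [cf _ f0 f1]] := sep R _ _ cK cx K0.
exists (fun y => real_complex R (f y)); split; first exact: real_complex_continuous.
  by rewrite [f x]f1//; exists x.
by move=> y Ky; rewrite [f y]f0//; exists y.
Qed.

End Urysohn.

Section OrbitIrreducible.
Context {R : realType} {S : dynsys}.
Local Notation C := (Cplx R).
Local Notation A := (ell1 R S).

Definition delta n : A := single n (@cst_continuous S C 1).

Variable p : nat.
Hypothesis p_gt0 : (0 < p)%N.
Hypothesis orbits_of_order_p : forall x : S, (orbit_of x #= `I_p)%card.
Let act_per := act_period orbits_of_order_p.

(** The rest of the orbit is finite, hence closed. In the orbit representation such a function acts
    as the projection onto one basis vector. *)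
Lemma orbit_bump (x : S) : exists e : S -> C, [/\ continuous e, e x = 1 &
  forall n, ~~ (p%:Z %| n)%Z -> e (act n x) = 0].
Proof.
pose K := [set act i%:Z x | i in [set i : nat | (0 < i < p)%N]].
have cK : closed K.
  have /accessible_finite_set_closed := hausdorff_accessible (@dspace_hausdorff S).
  apply; apply: finite_image; apply: sub_finite_set (finite_II p) => i.
  by case/andP.
have Kx : ~ K x.
  move=> [i /andP[i0 ip] ix].
  have := act_fix_dvd p_gt0 orbits_of_order_p (ix : act i%:Z x = x).
  by rewrite dvdzE/= gtnNdvd.
have [e [ce ex eK]] := @dynsys_urysohn R S K x cK Kx.
exists e; split=> // n pn; apply: eK.
have pz : p%:Z != 0 by rewrite gt_eqF.
rewrite (act_mod _ (act_per x)).
have : (n %% p%:Z)%Z != 0 by apply: contra pn => /eqP/dvdz_mod0P.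
have := ltz_pmod n (p_gt0 : 0 < p%:Z); have := modz_ge0 n pz.
case: (n %% p%:Z)%Z => // i _ ip i0; exists i => //=.
by rewrite lt0n; apply/andP.
Qed.

Section Irr.
Variable l : C.
Hypothesis l_norm : normc l = 1.
Variable x : S.
Local Notation rho := (orbit_rep p_gt0 l_norm act_per x).
Local Notation eps := (qper_basis p_gt0 l_norm).

Lemma orbit_rep_basis n (f : S -> C) (cf : continuous f) k :
  rho (single n cf) (eps k) = f (act (n + k) x) *: eps (n + k).
Proof.
apply: qper_inj => j; rewrite orbit_rep_single qperZ !qper_basisE.
have -> : j - n - k = j - (n + k) by rewrite opprD addrA.
case: ifPn => [pj|_]; last by rewrite !mulr0.
congr (f _ * _); rewrite -[in LHS](subrK (n + k) j) [LHS]actD.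
by rewrite (act_dvd orbits_of_order_p _ pj).
Qed.

Lemma qper_basis0_neq0 k : eps k <> 0.
Proof.
move=> e0; have : eps k k = 0 by rewrite e0.
rewrite qper_basis_diag; apply/eqP; exact: oner_neq0.
Qed.

Lemma orbit_rep_irr : alg_irreducible rho.
Proof.
split.
  exists (delta 0), (eps 0); rewrite /delta orbit_rep_basis scale1r.
  exact: qper_basis0_neq0.
move=> F [F0 FP] FA.
have [F1|F1] := pselect (exists2 h, F h & h <> 0); last first.
  left; apply/seteqP; split=> [h Fh /=|h ->//].
  by apply: contrapT => h0; apply: F1; exists h.
have [h Fh h0] := F1.
have [j hj] : exists j, h j <> 0.
  apply: contrapT => hh; apply: h0; apply: qper_inj => j.
  by apply: contrapT => hj; apply: hh; exists j.
(* The bump at the point where h does not vanish cuts h down to a multiple of [eps j]; shifts then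
   reach every basis vector. *)
have [e [ce ej e0]] := orbit_bump (act j x).
have FZ k g : F g -> F (k *: g) by move=> Fg; rewrite -[_ *: _]addr0; exact: FP.
have Fj : F (eps j).
  have -> : eps j = (h j)^-1 *: rho (single 0 ce) h.
    have key i : rho (single 0 ce) (h i *: eps i) = (e (act i x) * h i) *: eps i.
      by rewrite linearZ (orbit_rep_basis 0 ce i) add0r [LHS]scalerA mulrC.
    have -> : rho (single 0 ce) h = \sum_(i < p)
        (e (act i%:Z (act j x)) * h (j + i%:Z)) *: eps (j + i%:Z).
      rewrite [in LHS](qper_basis_sum p_gt0 l_norm j h).
      apply: etrans (linear_sum _ _ _ _) _; apply: eq_bigr => i _.
      by apply: etrans (key _) _; rewrite [j + _]addrC actD.
    rewrite (bigD1 (Ordinal p_gt0))// big1 => [|i i0].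
      rewrite /= !addr0 ej mul1r scalerA mulVf ?scale1r//.
      exact/eqP.
    rewrite e0 ?mul0r ?scale0r//.
    by rewrite dvdzE/= gtnNdvd// lt0n.
  by apply: FZ; exact: FA.
have Fall k : F (eps k).
  have -> : eps k = rho (delta (k - j)) (eps j).
    by rewrite orbit_rep_basis scale1r subrK.
  exact: FA.
right; apply/seteqP; split=> // g _; rewrite (qper_basis_sum p_gt0 l_norm 0 g).
by elim/big_ind : _ => // [u v Fu Fv|i _]; [rewrite -[u]scale1r; exact: FP | exact: FZ].
Qed.

End Irr.
End OrbitIrreducible.

(** * Classification of the irreducible representations *)

Section ComplexContinuity.
Context {R : realType} {X : topologicalType}.
Local Notation C := (Cplx R).
Implicit Types f : X -> C.

Lemma normcB_ge (a b : C) : `|normc a - normc b| <= normc (a - b).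
Proof.
have h1 : normc a <= normc (a - b) + normc b.
  by rewrite -[in leLHS](subrK b a) le_normcD.
have h2 : normc b <= normc (a - b) + normc a.
  by rewrite -[in leLHS](subrK a b) (le_trans (le_normcD _ _))// -normcN opprB.
by rewrite ler_norml; apply/andP; split; lra.
Qed.

Lemma normc_continuous f : continuous f -> continuous (fun y => normc (f y) : R).
Proof.
move=> cf y; apply/pseudometric_normed_Zmodule.cvgrPdist_lt => e e0.
move/cplx_continuousP : cf => /(_ y _ e0); apply: filterS => z.
exact: le_lt_trans (normcB_ge _ _).
Qed.

Lemma conjc_continuous f : continuous f -> continuous (fun y => (f y)^*%C : C).
Proof.
move/cplx_continuousP => cf; apply/cplx_continuousP => y e e0.
have := cf y e e0; apply: filterS => z.
have -> : (f y)^*%C - (f z)^*%C = (f y - f z)^*%C by rewrite rmorphB.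
by case: (f y - f z) => a b /=; rewrite sqrrN.
Qed.

Lemma exprz_continuous f (n : int) : continuous f -> (forall y, f y != 0) ->
  continuous (fun y => f y ^ n).
Proof.
move=> cf f0.
have cX (m : nat) : continuous (fun y => f y ^+ m).
  elim: m => [|m IH] y.
    by under eq_fun do rewrite expr0; exact: cvg_cst.
  by under eq_fun do rewrite exprS; apply: cvgM; [exact: cf | exact: IH].
case: n => n; first exact: cX.
by move=> y; apply: cvgV; [rewrite expf_neq0 | exact: cX].
Qed.

End ComplexContinuity.

Section Singles0.
Context {R : realType} {S : dynsys}.
Local Notation C := (Cplx R).
Local Notation A := (ell1 R S).
Implicit Types f g : S -> C.

Lemma single_ext n f g (cf : continuous f) (cg : continuous g) :
  f =1 g -> single n cf = single n cg.
Proof.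
move=> fg; apply: ell1_inj; apply/funext => m; apply/funext => y.
by rewrite !singleE fg.
Qed.

Lemma single0M f g (cf : continuous f) (cg : continuous g)
    (cfg : continuous (fun y => f y * g y)) :
  single 0 cfg = single 0 cf * single 0 cg.
Proof.
apply: ell1_inj; apply/funext => m; apply/funext => y.
by rewrite single_mulE !singleE oppr0 subr0 mulrCA.
Qed.

Lemma singleD n f g (cf : continuous f) (cg : continuous g)
    (cfg : continuous (fun y => f y + g y)) :
  single n cfg = single n cf + single n cg.
Proof.
apply: ell1_inj; apply/funext => m; apply/funext => y.
by rewrite ell1_evalD !singleE mulrDr.
Qed.

Lemma single_cst0 (k : C) (ck : continuous (fun _ : S => k)) : single 0 ck = k *: 1.
Proof.
apply: ell1_inj; apply/funext => m; apply/funext => y.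
by rewrite ell1_evalZ singleE mulrC.
Qed.

Lemma single_delta n f (cf : continuous f)
    (cfn : continuous (fun y => f (act n y))) :
  single n cf = delta n * single 0 cfn.
Proof.
apply: ell1_inj; apply/funext => m; apply/funext => y.
by rewrite single_mulE !singleE mul1r subr_eq0 -actD subrr.
Qed.

Lemma deltaD m n : delta (m + n) = delta m * delta n :> A.
Proof.
apply: ell1_inj; apply/funext => k; apply/funext => y.
by rewrite single_mulE !singleE mul1r subr_eq addrC.
Qed.

Lemma delta0 : delta 0 = 1 :> A.
Proof. by rewrite /delta single_cst0 scale1r. Qed.

Lemma single0_comm f (cf : continuous f) :
  (forall n y, f (act n y) = f y) -> forall a : A, single 0 cf * a = a * single 0 cf.
Proof.
move=> finv a; apply: ell1_inj; apply/funext => m; apply/funext => y.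
by rewrite single_mulE mul_singleE oppr0 subr0 finv mulrC.
Qed.

Lemma delta_comm n : (forall y : S, act n y = y) ->
  forall a : A, delta n * a = a * delta n.
Proof.
move=> ny a; apply: ell1_inj; apply/funext => m; apply/funext => y.
rewrite single_mulE mul_singleE mul1r mulr1; congr (a _ _).
by rewrite -[in LHS](ny y) -actD addNr.
Qed.

Lemma ell1_norm_delta n : ell1_norm (delta n : A) <= 1.
Proof. by apply: ell1_norm_single => y; rewrite normc1. Qed.

End Singles0.

Section Classification.
Context {R : realType} {S : dynsys}.
Local Notation C := (Cplx R).
Local Notation A := (ell1 R S).
Context {E : lmodType C} {rho : representation A E}.
Hypothesis irr : alg_irreducible rho.
Implicit Types f g F : S -> C.

Lemma ell1_annihilator_closed (a : A) v :
  (forall e : R, 0 < e -> exists a', ell1_norm (a - a') < e /\ rho a' v = 0) ->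
  rho a v = 0.
Proof.
exact: (annihilator_closed (@ell1_norm_ge0 R S) (@ell1_normM R S) (@neumann R S) irr).
Qed.

Lemma ell1_central_scalar (c : A) : (forall a, c * a = a * c) ->
  exists l : C, forall u, rho c u = l *: u.
Proof.
exact: (central_scalar (@ell1_norm_ge0 R S) (@ell1_normD R S) (@ell1_normZ R S)
  (@ell1_normM R S) (@ell1_norm1 R S) (@neumann R S) irr).
Qed.

(** Otherwise c / l has norm below 1 and fixes every vector. *)
Lemma ell1_scalar_bound (c : A) l : (forall u, rho c u = l *: u) ->
  normc l <= ell1_norm c.
Proof.
move=> cl; rewrite leNgt; apply/negP => lc.
have l0 : 0 < normc l := le_lt_trans (ell1_norm_ge0 _) lc.
have ln0 : l != 0 by apply: contraTneq l0 => ->; rewrite normc0 ltxx.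
have [a [v av]] := irr.1; apply: av; suff -> : v = 0 by rewrite linear0.
apply: (neumann_ker (@neumann R S) irr (b := l^-1 *: c)).
  apply: le_lt_trans (ell1_normZ _ _) _.
  by rewrite normcV// mulrC ltr_pdivrMr// mul1r.
by rewrite repZ cl scalerA mulVf// scale1r.
Qed.

(** [single] takes a continuity proof as argument; quantifying over it lets the ideal be handled as
    a predicate on bare functions. *)
Definition annihilates (f : S -> C) :=
  continuous f /\ forall (cf : continuous f) v, rho (single 0 cf) v = 0.

Lemma annihilates_ext f g : f =1 g -> annihilates f -> annihilates g.
Proof. by move=> /funext ->. Qed.

Lemma annihilatesP f (cf : continuous f) :
  (forall v, rho (single 0 cf) v = 0) -> annihilates f.
Proof.
by move=> h; split=> // cf' v; rewrite (single_ext 0 cf' cf (frefl f)).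
Qed.

Lemma annihilatesM f g : continuous f -> annihilates g ->
  annihilates (fun y => f y * g y).
Proof.
move=> cf [cg hg]; have cfg : continuous (fun y => f y * g y).
  by move=> y; apply: cvgM; [exact: cf | exact: cg].
apply: (annihilatesP (cf := cfg)) => v.
by rewrite (single0M cf cg cfg) rep_mul hg linear0.
Qed.

Lemma annihilatesD f g : annihilates f -> annihilates g ->
  annihilates (fun y => f y + g y).
Proof.
move=> [cf hf] [cg hg]; have cfg : continuous (fun y => f y + g y).
  by move=> y; apply: cvgD; [exact: cf | exact: cg].
apply: (annihilatesP (cf := cfg)) => v.
by rewrite (singleD 0 cf cg cfg) repD hf hg addr0.
Qed.

Lemma annihilates0 : annihilates (fun _ => 0).
Proof.
apply: (annihilatesP (cf := @cst_continuous S C 0)) => v.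
by rewrite single_cst0 scale0r rep0.
Qed.

Lemma annihilates_sum (I : Type) (r : seq I) (f : I -> S -> C) :
  (forall i, annihilates (f i)) -> annihilates (fun y => \sum_(i <- r) f i y).
Proof.
move=> hf; elim: r => [|i r IH].
  by apply: annihilates_ext annihilates0 => y; rewrite big_nil.
by apply: annihilates_ext (annihilatesD (hf i) IH) => y; rewrite big_cons.
Qed.

(** A function without zeros is invertible in C(X), and would put 1 in the ideal. *)
Lemma annihilates_neq0 f : annihilates f -> exists y, f y = 0.
Proof.
move=> [cf hf]; apply: contrapT => f0.
have f1 y : f y != 0 by apply/eqP => fy; apply: f0; exists y.
have cV : continuous (fun y => (f y)^-1 : C).
  by move=> y; apply: cvgV; [exact: f1 | exact: cf].
have [c1 h1] : annihilates (fun _ => 1).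
  apply: annihilates_ext (annihilatesM cV (conj cf hf)) => y.
  by rewrite mulVf.
have [a [v av]] := irr.1; apply: av.
have := h1 c1 v; rewrite single_cst0 scale1r (rep1 irr) => ->.
by rewrite linear0.
Qed.

(* [F] is the norm limit of [F G / (G + e^2)]: the error [|F| e^2 / (G + e^2)] is
   at most [e / 2], because [|F|^2 <= G]. *)
Lemma annihilates_dominated F (G : S -> R) : continuous F -> continuous G ->
  (forall y, normc (F y) ^+ 2 <= G y) ->
  annihilates (fun y => real_complex R (G y) : C) -> annihilates F.
Proof.
move=> cF cG FG [cGC hG]; apply: (annihilatesP (cf := cF)) => v.
apply: ell1_annihilator_closed => e e0.
have G0 y : 0 <= G y by apply: le_trans (FG y); rewrite exprn_ge0 ?normc_nneg.
have Ge y : 0 < G y + e ^+ 2 by rewrite ltr_wpDl// exprn_gt0.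
have cV : continuous (fun y => (G y + e ^+ 2)^-1 : R).
  move=> y; apply: cvgV; first by rewrite gt_eqF.
  by apply: cvgD; [exact: cG | exact: cvg_cst].
have cFV : continuous (fun y => F y * (real_complex R (G y + e ^+ 2)^-1 : C)).
  by move=> y; apply: cvgM; [exact: cF | exact: real_complex_continuous].
have [cH hH] := annihilatesM cFV (conj cGC hG).
have cD : continuous (fun y => F y * (real_complex R (e ^+ 2 / (G y + e ^+ 2)) : C)).
  move=> y; apply: cvgM; first exact: cF.
  by apply: real_complex_continuous => z; apply: cvgM; [exact: cvg_cst | exact: cV].
exists (single 0 cH); split=> //.
have FDH : single 0 cF = single 0 cD + single 0 cH :> A.
  apply: ell1_inj; apply/funext => m; apply/funext => y.
  rewrite ell1_evalD !singleE -mulrDr; congr (_ * _).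
  rewrite -mulrA -(rmorphM (real_complex R)) -mulrDr -(rmorphD (real_complex R)).
  by rewrite mulrC [_^-1 * _]mulrC -mulrDl [e ^+ 2 + _]addrC mulfV ?mul1r// gt_eqF.
rewrite FDH addrK; apply: (@le_lt_trans _ _ (e / 2)).
  apply: ell1_norm_single => y; rewrite normcM (normc_real (_ / _)).
  rewrite ger0_norm ?divr_ge0// ?exprn_ge0 ?(ltW (Ge _)) ?(ltW e0)//.
  rewrite mulrA ler_pdivrMr// mulrAC ler_pdivlMr//.
  have := FG y; move: (normc (F y)) (G y) => n g ng.
  (* This square gives 2 e^2 n <= e (n^2 + e^2) <= e (g + e^2), the claimed bound e / 2. *)
  have : 0 <= e * (n - e) ^+ 2 by rewrite mulr_ge0 ?sqr_ge0 ?ltW.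
  have := ler_wpM2l (ltW e0) ng; rewrite !expr2; lra.
by rewrite ltr_pdivrMr// ltr_pMr// ltr1n.
Qed.

End Classification.

(** * From a common zero to a joint eigenvector *)

Section ClassificationOrbit.
Context {R : realType} {S : dynsys}.
Local Notation C := (Cplx R).
Local Notation A := (ell1 R S).
Variable p : nat.
Hypothesis p_gt0 : (0 < p)%N.
Hypothesis orbits_of_order_p : forall x : S, (orbit_of x #= `I_p)%card.
Let act_per := act_period orbits_of_order_p.
Context {E : lmodType C} {rho : representation A E}.
Hypothesis irr : alg_irreducible rho.
Implicit Types f g F : S -> C.
Local Notation annihilates := (@annihilates R S E rho).

Lemma conjc_mul (z : C) : z^*%C * z = real_complex R (normc z ^+ 2).
Proof.
case: z => a b; rewrite [normc _]/= sqr_sqrtr ?addr_ge0 ?sqr_ge0//.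
by apply/eqP; rewrite eq_complex/=; apply/andP; split; apply/eqP; ring.
Qed.

(** Otherwise finitely many members of the ideal have no common zero, and the sum of their squared
    moduli is a member without zeros. *)
Lemma annihilates_common_zero : exists y0, forall g, annihilates g -> g y0 = 0.
Proof.
apply: contrapT => h.
have /choice[g hg] : forall y, exists g, annihilates g /\ g y <> 0.
  move=> y; apply: contrapT => hy; apply: h; exists y => g ag.
  by apply: contrapT => gy; apply: hy; exists g.
have cg y : continuous (fun z => normc (g y z) : R).
  by apply: normc_continuous; exact: (hg y).1.1.
(* Compactness along the filter of growing finite sets: any D containing y works near y, so some D
   works everywhere. *)
have [D DS] : exists D : {fset S}, forall z, exists2 y, y \in D & 0 < normc (g y z).
  have /compact_near_coveringP cov := @dspace_compact S.
  have [|D _ hD] := cov _ (@summability.totally S)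
    (fun D z => exists2 y, y \in D & 0 < normc (g y z)) (@summability.totally_filter S).
    move=> y _; exists ([set z | 0 < normc (g y z)], [set D | ([fset y] `<=` D)%fset]).
      split; last by exists [fset y]%fset.
      apply: open_nbhs_nbhs; split.
        by apply: (@open_comp _ _ (fun z => normc (g y z) : R) [set t | 0 < t]);
          [move=> z _; exact: cg | exact: open_gt].
      rewrite /= lt_neqAle normc_nneg andbT eq_sym.
      by apply/eqP => /eq0_normc; exact: (hg y).2.
    by case=> z D /= [zy]; rewrite fsub1set => yD; exists y.
  by exists D => z; exact: (hD D (fsubset_refl D) z I).
have : annihilates (fun z => \sum_(y <- D) (g y z)^*%C * g y z).
  apply: annihilates_sum => y; apply: annihilatesM (hg y).1.
  by apply: conjc_continuous; exact: (hg y).1.1.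
move=> /(annihilates_neq0 irr)[z].
under eq_bigr do rewrite conjc_mul.
rewrite -(rmorph_sum (real_complex R)) => -[/eqP].
have n0 y : true -> 0 <= normc (g y z) ^+ 2 by rewrite exprn_ge0 ?normc_nneg.
rewrite (psumr_eq0 _ n0) => /allP hz.
have [y yD] := DS z.
have /= := hz y yD; rewrite expf_eq0/= => /eqP ->.
by rewrite ltxx.
Qed.

Lemma annihilates_invariant f : continuous f -> (forall n y, f (act n y) = f y) ->
  exists l, annihilates (fun y => f y - l).
Proof.
move=> cf finv; have [l hl] := ell1_central_scalar irr (single0_comm cf finv).
exists l; have cN : continuous (fun _ : S => - l) := @cst_continuous _ _ _.
have cfl : continuous (fun y => f y - l) by move=> y; apply: cvgD; [exact: cf|exact: cN].
apply: (annihilatesP (cf := cfl)) => v.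
by rewrite (singleD 0 cf cN cfl) repD hl single_cst0 repZ (rep1 irr) -scalerDl subrr scale0r.
Qed.

Lemma annihilates_orbit : exists y0, forall F, continuous F ->
  (forall n, F (act n y0) = 0) -> annihilates F.
Proof.
have [y0 hy0] := annihilates_common_zero; exists y0 => F cF F0.
pose G y := \sum_(j < p) normc (F (act j%:Z y)) ^+ 2.
have Ginv1 y : G (act 1 y) = G y.
  rewrite /G; case: p p_gt0 act_per => // q _ ap.
  rewrite big_ord_recr big_ord_recl/= addrC; congr (normc (F _) ^+ 2 + _).
    by have := ap y; rewrite -addn1 PoszD actD.
  by apply: eq_bigr => j _; rewrite -iterSr.
have Ginv n y : G (act n y) = G y.
  elim/int_rec: n y => [//|n IH|n IH] y.
    by rewrite -addn1 PoszD actD IH Ginv1.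
  rewrite -[LHS]Ginv1 -actD.
  by have -> : 1 + - n.+1%:Z = - n%:Z by lia.
have cG : continuous G.
  apply: continuous_big => [|j _ y]; first exact: add_continuous.
  apply: (@continuous_comp _ _ _ (fun y => normc (F (act j%:Z y))) (fun t : R => t ^+ 2)).
    have cFj : continuous (fun y => F (act j%:Z y)).
      by move=> z; apply: continuous_comp; [exact: act_continuous | exact: cF].
    exact: normc_continuous.
  exact: exprn_continuous.
have cGC := real_complex_continuous cG.
apply: (annihilates_dominated irr cF cG) => [y|].
  rewrite /G (bigD1 (Ordinal p_gt0))//= lerDl.
  by apply: sumr_ge0 => j _; rewrite exprn_ge0 ?normc_nneg.
have [n y|l hl] := annihilates_invariant cGC _; first by rewrite Ginv.
(* The invariant G acts as a scalar l, so G - l lies in the ideal and vanishes at the common zero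
   y0; there G itself is 0. *)
have l0 : l = 0.
  have /eqP := hy0 _ hl; rewrite subr_eq0 => /eqP <-.
  by rewrite /G big1// => j _; rewrite F0 normc0 expr0n.
by apply: annihilates_ext hl => y; rewrite l0 subr0.
Qed.

Lemma delta_period_scalar : exists2 l : C, normc l = 1 &
  forall v, rho (delta p%:Z) v = l *: v.
Proof.
have [l hl] := ell1_central_scalar irr (delta_comm act_per).
have actN y : act (- p%:Z) y = y :> S by rewrite -[in LHS](act_per y) -actD addNr.
have [k hk] := ell1_central_scalar irr (delta_comm actN).
exists l => //.
have kl : k * l = 1.
  have [a [v av]] := irr.1.
  have := rep1 irr v; rewrite -[1](delta0 : _ = 1 :> A) -(addNr p%:Z) deltaD rep_mul hl hk.
  rewrite scalerA mulrC => /eqP; rewrite -subr_eq0 -{2}[v]scale1r -scalerBl scaler_eq0.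
  case/orP => [|/eqP v0]; last by exfalso; apply: av; rewrite v0 linear0.
  by rewrite subr_eq0 mulrC => /eqP.
have l1 := le_trans (ell1_scalar_bound irr hl) (ell1_norm_delta _).
have k1 := le_trans (ell1_scalar_bound irr hk) (ell1_norm_delta _).
apply/eqP; rewrite eq_le l1/= -(normc1 R) -kl normcM.
by rewrite -[leRHS]mul1r ler_wpM2r ?normc_nneg.
Qed.

(** The bumps at the p orbit points sum to 1 on the orbit, hence act with sum 1, so one of them has
    a nonzero value e v. On the orbit (f - f(x)) e vanishes, so this value is an eigenvector of
    every f. *)
Lemma joint_eigenvector : exists (x : S) (w : E), w <> 0 /\
  forall f (cf : continuous f), rho (single 0 cf) w = f x *: w.
Proof.
have [y0 hy0] := annihilates_orbit.
have /choice[e he] : forall i : int, exists e : S -> C, [/\ continuous e, e (act i y0) = 1 &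
    forall n, ~~ (p%:Z %| n)%Z -> e (act n (act i y0)) = 0].
  by move=> i; exact: orbit_bump.
have ce i : continuous (e i) by case: (he i).
have eE i n : e i (act n y0) = ((p%:Z %| n - i)%Z)%:R.
  have [_ e1 e0] := he i.
  have -> : act n y0 = act (n - i) (act i y0) by rewrite -actD subrK.
  have [pn|pn] := boolP (p%:Z %| n - i)%Z; last exact: e0.
  by rewrite (act_dvd orbits_of_order_p _ pn).
have [i [v hv]] : exists i v, rho (single 0 (ce i)) v <> 0.
  apply: contrapT => h.
  have ae i : annihilates (e i).
    apply: (annihilatesP (cf := ce i)) => v; apply: contrapT => iv.
    by apply: h; exists i, v.
  have a1 : annihilates (fun y => 1 - \sum_(i < p) e i%:Z y).
    apply: hy0 => [y|n].
      by apply: cvgB; [exact: cvg_cst | exact: (fsum_continuous (g := fun i : 'I_p => e i%:Z))].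
    rewrite (eq_bigr (fun i : 'I_p => (p%:Z %| n - i%:Z)%Z%:R)); last first.
      by move=> i _; rewrite eE.
    have pz : p%:Z != 0 by rewrite gt_eqF.
    have := ltz_pmod n (p_gt0 : 0 < p%:Z); have := modz_ge0 n pz.
    have := divz_decomp p n.
    case: (n %% p%:Z)%Z => // i nE _ ip.
    rewrite (bigD1 (Ordinal (ip : (i < p)%N)))// big1 => [|m mi].
      by rewrite nE /= addrAC subrr add0r dvdz_mull// addr0 subrr.
    have [h1|//] := boolP (p%:Z %| n - m%:Z)%Z; exfalso.
    move: mi; rewrite -val_eqE /=; apply/negP/negPn.
    move: h1; rewrite nE addrAC rpredDr ?dvdz_mull// => h1.
    have : i%:Z = m%:Z %[mod p%:Z]%Z by apply/eqP; rewrite eqz_mod_dvd.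
    by rewrite !modz_nat !modn_small// => -[->].
  have := annihilatesD (annihilates_sum (index_enum 'I_p) (fun i => ae (nat_of_ord i)%:Z)) a1.
  move=> /(annihilates_neq0 irr)[y]; rewrite addrC subrK => /eqP.
  by rewrite oner_eq0.
exists (act i y0), (rho (single 0 (ce i)) v); split=> // f cf.
pose k := f (act i y0).
have cN : continuous (fun _ : S => - k) := @cst_continuous _ _ _.
have cfk : continuous (fun y => f y - k) by move=> y; apply: cvgD; [exact: cf|exact: cN].
have cg : continuous (fun y => (f y - k) * e i y).
  by move=> y; apply: cvgM; [exact: cfk | exact: ce].
have [_ /(_ cg v)] : annihilates (fun y => (f y - k) * e i y).
  apply: hy0 => // n; rewrite eE.
  have [pn|_] := boolP (p%:Z %| n - i)%Z; last by rewrite mulr0.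
  rewrite mulr1 /k -[X in act X y0](subrK i n) actD.
  by rewrite (act_dvd orbits_of_order_p _ pn) subrr.
rewrite (single0M cfk (ce i) cg) rep_mul (singleD 0 cf cN cfk) repD single_cst0.
by rewrite repZ (rep1 irr) scaleNr => /eqP; rewrite subr_eq0 => /eqP.
Qed.

End ClassificationOrbit.

(** * Comparison of annihilators and kernels *)

Section Kernels.
Context {R : realType} {S : dynsys}.
Local Notation C := (Cplx R).
Local Notation A := (ell1 R S).
Variable p : nat.
Hypothesis p_gt0 : (0 < p)%N.
Hypothesis orbits_of_order_p : forall x : S, (orbit_of x #= `I_p)%card.
Let act_per := act_period orbits_of_order_p.
Context {E : lmodType C} {rho : representation A E}.
Hypothesis irr : alg_irreducible rho.

Section Comparison.
Variables (l : C) (x : S) (w : E).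
Hypotheses (l_norm : normc l = 1) (w_neq0 : w <> 0).
Hypothesis delta_w : forall v, rho (delta p%:Z) v = l *: v.
Hypothesis single_w : forall (f : S -> C) (cf : continuous f), rho (single 0 cf) w = f x *: w.
Local Notation pi := (orbit_rep p_gt0 l_norm act_per x).
Local Notation eps := (qper_basis p_gt0 l_norm).
Implicit Types a b : A.

(* Every [a] acts on [w] as [reduced (pi a (eps 0))]: this holds for the elements
   [f delta^n], hence in general because annihilators are closed. *)
Let reduced (h : qper p l) : A := \sum_(i < p) h i%:Z *: delta i%:Z.

Let reduced_linear (k : C) g h : reduced (k *: g + h) = k *: reduced g + reduced h.
Proof.
rewrite /reduced scaler_sumr -big_split; apply: eq_bigr => i _.
by rewrite qperD qperZ scalerDl scalerA.
Qed.

Lemma delta_shift_w (j q : int) :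
  rho (delta (j + q * p%:Z)) w = l ^ q *: rho (delta j) w.
Proof.
have l0 := unit_normc_neq0 l_norm.
have step i : rho (delta (i + p%:Z)) w = l *: rho (delta i) w.
  by rewrite deltaD rep_mul delta_w linearZ.
elim/int_rec: q => [|q IH|q IH]; first by rewrite mul0r addr0 expr0z scale1r.
  rewrite -addn1 PoszD mulrDl mul1r addrA step IH scalerA.
  by rewrite expfzDr// expr1z mulrC.
apply: (scalerI l0); rewrite -step -addn1 PoszD opprD mulrDl mulN1r addrA subrK IH.
by rewrite scalerA expfzDr// exprN1 mulrCA divff ?mulr1.
Qed.

Let reduced_basis n : rho (reduced (eps n)) w = rho (delta n) w.
Proof.
have pz : p%:Z != 0 by rewrite gt_eqF.
rewrite rep_sum; under eq_bigr do rewrite repZ qper_basisE.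
have := ltz_pmod n (p_gt0 : 0 < p%:Z); have := modz_ge0 n pz.
have := divz_decomp p n; set q := (n %/ p%:Z)%Z.
case: (n %% p%:Z)%Z => // i nE _ ip.
rewrite (bigD1 (Ordinal (ip : (i < p)%N)))// big1 => [|m mi].
  have e : (Ordinal (ip : (i < p)%N))%:Z - n = - q * p%:Z.
    by rewrite nE /= opprD addNKr mulNr.
  rewrite e dvdz_mull// mulzK// opprK nE delta_shift_w; exact: addr0.
case: ifPn => [h1|]; last by rewrite scale0r.
exfalso; move: mi; rewrite -val_eqE /=; apply/negP/negPn.
move: h1; rewrite nE opprD addrA -mulNr rpredDr ?dvdz_mull// => h1.
have : m%:Z = i%:Z %[mod p%:Z]%Z by apply/eqP; rewrite eqz_mod_dvd.
by rewrite !modz_nat !modn_small// => -[->].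
Qed.

Let reduced_single (n : int) (f : S -> C) (cf : continuous f) :
  rho (reduced (pi (single n cf) (eps 0))) w = rho (single n cf) w.
Proof.
have cfn : continuous (fun y => f (act n y)).
  by move=> y; apply: continuous_comp; [exact: act_continuous | exact: cf].
rewrite [in RHS](single_delta cf cfn) [RHS]rep_mul single_w [RHS]linearZ/=.
have -> : pi (single n cf) (eps 0) = f (act n x) *: eps n + 0.
  rewrite addr0; have h := orbit_rep_basis p_gt0 orbits_of_order_p l_norm x n cf 0.
  by rewrite [n + 0]addr0 in h.
rewrite reduced_linear repD repZ reduced_basis.
by rewrite /reduced big1 ?rep0 ?addr0// => i _; rewrite scale0r.
Qed.

Lemma orbit_rep_le1 a i : normc (pi a (eps 0) i) <= ell1_norm a.
Proof.
apply: has_sum_bound (orbit_rep_has_sum _ _ _ _ _ _ _) _.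
apply: bounded_le (ell1_norm_bounded a) => n.
rewrite normcM -[leRHS]mulr1 ler_pM ?normc_nneg ?qper_basis_le1// le_supnorm//.
exact: ell1_continuous.
Qed.

Lemma orbit_annihilator_sub a : pi a (eps 0) = 0 -> rho a w = 0.
Proof.
move=> a0; apply: (ell1_annihilator_closed irr) => e e0.
have p1 : 0 < 1 + p%:R :> R by rewrite addr_gt0 ?ltr0n.
(* The factor 1 + p pays for [reduced]: its p coefficients are each at most the norm of a - b,
   because pi a (eps 0) = 0. *)
have [B hB] := finite_approx a (divr_gt0 e0 p1).
set b := \sum_(n <- B) _ in hB.
exists (b - reduced (pi b (eps 0))); split; last first.
  rewrite repB; apply/eqP; rewrite subr_eq0; apply/eqP.
  rewrite /b; elim: (B : seq int) => [|n r IH].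
    by rewrite big_nil !rep0 /reduced big1 ?rep0// => i _; rewrite scale0r.
  rewrite big_cons; set c := \sum_(n <- r) _ in IH *.
  have -> : pi (single n (@ell1_continuous _ _ a n) + c) (eps 0) =
      1 *: pi (single n (@ell1_continuous _ _ a n)) (eps 0) + pi c (eps 0).
    by rewrite scale1r repD.
  by rewrite reduced_linear scale1r !repD reduced_single IH.
rewrite opprB addrCA addrC.
apply: le_lt_trans (ell1_normD _ _) _.
have hr : ell1_norm (reduced (pi b (eps 0))) <= p%:R * ell1_norm (a - b).
  have -> : p%:R * ell1_norm (a - b) = \sum_(i < p) ell1_norm (a - b).
    by rewrite sumr_const card_ord mulr_natl.
  rewrite /reduced; elim/big_ind2 : _ => [|u s v t us vt|i _].
  - by rewrite ell1_norm0.
  - by apply: le_trans (ell1_normD _ _) (lerD us vt).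
  apply: le_trans (ell1_normZ _ _) _.
  apply: le_trans (ler_wpM2l (normc_nneg _) (ell1_norm_delta _)) _.
  rewrite mulr1 -normcN.
  have -> : - pi b (eps 0) i%:Z = pi (a - b) (eps 0) i%:Z.
    by rewrite repB a0 sub0r.
  exact: orbit_rep_le1.
have := hB; rewrite ltr_pdivlMr// mulrDr mulr1 mulrC => h.
by apply: le_lt_trans h; rewrite lerD2l.
Qed.

(** Maximality reverses the inclusion of annihilators: if a kills w but not [eps 0], some b has b a
    (eps 0) = eps 0, and 1 - b a kills [eps 0], hence w, so w = 0. Since [eps 0] and w are cyclic,
    their annihilators determine the kernels. *)
Lemma kernel_orbit_rep : rep_kernel rho = rep_kernel pi.
Proof.
have pirr : alg_irreducible pi by exact: orbit_rep_irr.
have e0 : eps 0 <> 0 by exact: qper_basis0_neq0.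
have sub a : rho a w = 0 -> pi a (eps 0) = 0.
  move=> aw; apply: contrapT => a0.
  have [b hb] := irr_cyclic pirr (eps 0) a0.
  apply: w_neq0; rewrite -(rep1 irr w).
  have : rho (1 - b * a) w = 0.
    apply: orbit_annihilator_sub.
    by rewrite repB (rep1 pirr) rep_mul hb subrr.
  by rewrite repB rep_mul aw linear0 subr0.
apply/seteqP; split=> a ha u.
  have [b <-] := irr_cyclic pirr u e0.
  by rewrite -rep_mul; apply: sub; rewrite rep_mul; exact: ha.
have [b <-] := irr_cyclic irr u w_neq0.
by rewrite -rep_mul; apply: orbit_annihilator_sub; rewrite rep_mul; exact: ha.
Qed.

End Comparison.

Theorem irreducible_kernel : exists (x : S) (l : C) (l_norm : normc l = 1),
  rep_kernel rho = rep_kernel (orbit_rep p_gt0 l_norm act_per x).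
Proof.
have [l l1 hl] := delta_period_scalar orbits_of_order_p irr.
have [x [w [w0 hw]]] := joint_eigenvector p_gt0 orbits_of_order_p irr.
by exists x, l, l1; exact: (kernel_orbit_rep l1 w0 hl hw).
Qed.

End Kernels.

(** * Bump elements *)

Section SquareRoot.
Context {R : realType} {S : dynsys}.
Local Notation C := (Cplx R).
Local Notation A := (ell1 R S).

(** The iteration with the number 1 in place of T. The map t -> (1 + t^2) / 2 has slope 1 at its
    fixed point 1, so convergence rests on monotonicity and the bound 1, not on contraction. *)
Fixpoint real_iter (k : nat) : R :=
  if k is m.+1 then (1 + real_iter m ^+ 2) / 2 else 0.

Lemma real_iter01 k : 0 <= real_iter k <= 1.
Proof.
elim: k => [|k /andP[IH0 IH1]] /=; first by rewrite lexx ler01.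
have := exprn_ge0 2 IH0; have := exprn_ile1 2 IH0 IH1.
by move: (_ ^+ 2) => q q1 q0; lra.
Qed.

Lemma real_iter_le k m : (k <= m)%N -> real_iter k <= real_iter m.
Proof.
move=> /subnK <-; elim: (m - k)%N => // i IH; apply: le_trans IH _.
rewrite addSn /=; have := sqr_ge0 (1 - real_iter (i + k)).
by rewrite !expr2; move: (real_iter (i + k)) => t; lra.
Qed.

Variable T : A.
Hypothesis T_norm : ell1_norm T <= 1.

(* The iteration for the fixed point [W = (T + W^2) / 2], that is
   [(1 - W)^2 = 1 - T]; its increments are dominated by those of [real_iter]. *)
Fixpoint sqrt_iter (k : nat) : A :=
  if k is m.+1 then (2^-1 : C) *: (T + sqrt_iter m * sqrt_iter m) else 0.

Lemma sqrt_iter_comm k a : T * a = a * T -> sqrt_iter k * a = a * sqrt_iter k.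
Proof.
move=> Ta; elim: k => [|k IH] /=; first by rewrite mul0r mulr0.
rewrite -scalerAl -scalerAr mulrDl mulrDr Ta; congr (_ *: (_ + _)).
by rewrite -mulrA IH mulrA IH mulrA.
Qed.

Let nhalf : normc (2^-1 : C) = 2^-1.
Proof.
have -> : (2^-1 : C) = real_complex R 2^-1 by rewrite fmorphV rmorph_nat.
by rewrite normc_real ger0_norm.
Qed.

Lemma sqrt_iter_norm k : ell1_norm (sqrt_iter k) <= real_iter k.
Proof.
elim: k => [|k IH] /=; first by rewrite ell1_norm0.
apply: le_trans (ell1_normZ _ _) _; rewrite nhalf mulrC ler_wpM2r ?invr_ge0//.
apply: le_trans (ell1_normD _ _) _; apply: lerD => //.
apply: le_trans (ell1_normM _ _) _; rewrite expr2.
by apply: ler_pM; rewrite ?ell1_norm_ge0.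
Qed.

(** The iterates commute, so a difference of squares factors in the algebra as it does for the
    reals, and the factors compare one by one. *)
Lemma sqrt_iter_step k :
  ell1_norm (sqrt_iter k.+1 - sqrt_iter k) <= real_iter k.+1 - real_iter k.
Proof.
elim: k => [|k IH].
  by rewrite !subr0; exact: (sqrt_iter_norm 1).
have -> : sqrt_iter k.+2 - sqrt_iter k.+1 = (2^-1 : C) *:
    ((sqrt_iter k.+1 - sqrt_iter k) * (sqrt_iter k.+1 + sqrt_iter k)).
  have e : sqrt_iter k.+1 * sqrt_iter k = sqrt_iter k * sqrt_iter k.+1.
    by apply: sqrt_iter_comm; apply/esym; exact: sqrt_iter_comm.
  rewrite -[sqrt_iter k.+2]/((2^-1 : C) *: (T + sqrt_iter k.+1 * sqrt_iter k.+1)).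
  rewrite -{3}[sqrt_iter k.+1]/((2^-1 : C) *: (T + sqrt_iter k * sqrt_iter k)).
  move: e; move: (sqrt_iter k.+1) (sqrt_iter k) => a b ab.
  by rewrite -scalerBr mulrBl !mulrDr ab addrKA [T + _]addrC addrKA.
apply: le_trans (ell1_normZ _ _) _; rewrite nhalf.
have -> : real_iter k.+2 - real_iter k.+1 =
    2^-1 * ((real_iter k.+1 - real_iter k) * (real_iter k.+1 + real_iter k)).
  rewrite -[real_iter k.+2]/((1 + real_iter k.+1 ^+ 2) / 2).
  rewrite -{2}[real_iter k.+1]/((1 + real_iter k ^+ 2) / 2).
  by move: (real_iter k.+1) (real_iter k) => a b; field.
rewrite ler_wpM2l ?invr_ge0//; apply: le_trans (ell1_normM _ _) _.
apply: ler_pM; rewrite ?ell1_norm_ge0//.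
by apply: le_trans (ell1_normD _ _) _; rewrite lerD ?sqrt_iter_norm.
Qed.

Let u k := sqrt_iter k.+1 - sqrt_iter k.

Lemma sqrt_iter_tail K M : (forall k, real_iter k <= M) ->
  bounded_sums (fun k => ell1_norm (u (K + k))) (M - real_iter K).
Proof.
move=> tM; apply: bounded_nat => [k|N]; first exact: ell1_norm_ge0.
apply: (@le_trans _ _ (real_iter (K + N) - real_iter K)); last by rewrite lerD2r.
elim: N => [|N IH]; first by rewrite big_ord0 addn0 subrr.
rewrite big_ord_recr/= addnS; have := sqrt_iter_step (K + N); rewrite -/(u _).
by move: IH; move: (\sum_(_ < _) _) (ell1_norm _) (real_iter _) (real_iter _) (real_iter _)
  => a b c d e; lra.
Qed.

Lemma sqrt_iter_limit : exists W : A, ell1_norm W <= 1 /\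
  forall e, 0 < e -> exists K, forall k, (K <= k)%N -> ell1_norm (W - sqrt_iter k) < e.
Proof.
have t1 k : real_iter k <= 1 by have /andP[] := real_iter01 k.
have := sqrt_iter_tail 0 t1; rewrite subr0 => uM.
have [W hW] := ell1_series uM; exists W.
pose X := [set real_iter k | k in [set: nat]].
have hX : has_sup X by split; [exists (real_iter 0), 0%N | exists 1 => _ [k _ <-]].
have tX k : real_iter k <= sup X by apply: ub_le_sup; [exact: hX.2 | exists k].
have tail k : ell1_norm (W - sqrt_iter k) <= sup X - real_iter k.
  apply: ell1_norm_le; apply: (ell1_series_bound (sqrt_iter_tail k tX)) => n y.
  elim: k => [|k IH]; first by rewrite subr0.
  have := has_sum_shift IH; rewrite addn0 /u !ell1_evalB opprB addrA subrK.
  by apply: has_sum_ext => i; rewrite addnS.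
split.
  have := tail 0%N; rewrite !subr0 => h.
  by apply: le_trans h (ge_sup hX.1 _) => _ [k _ <-].
move=> e e0; have [_ [K _ <-] hK] := sup_adherent e0 hX.
exists K => k Kk; apply: le_lt_trans (tail k) _.
have := real_iter_le Kk; move: hK; set s := sup X.
by move: (real_iter K) (real_iter k) => a b; lra.
Qed.

(** The equation is (1 - W)^2 = 1 - T expanded. The commutation clause makes W central when T is. *)
Lemma ell1_sqrt : exists W : A, [/\ W + W = T + W * W, ell1_norm W <= 1 &
  forall a, T * a = a * T -> W * a = a * W].
Proof.
have [W [W1 hW]] := sqrt_iter_limit; exists W; split=> //.
  apply/eqP; rewrite -subr_eq0; apply/eqP; apply: ell1_norm_eq0.
  apply/ler_addgt0Pr => e e0; have [K hK] := hW (e / 4) (divr_gt0 e0 (ltr0Sn _ 3)).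
  pose w := sqrt_iter K; pose w' := sqrt_iter K.+1.
  have ww' : w' + w' = T + w * w.
    by rewrite /w'/= -/w -scalerDl -[2^-1]mul1r -splitr scale1r.
  (* Subtracting w' + w' = T + w w leaves four terms, each containing a difference from W and of
     norm at most e / 4. *)
  have -> : W + W - (T + W * W) =
      (W - w') + (W - w') - ((W - w) * W + w * (W - w)).
    rewrite mulrBl mulrBr subrKA addrACA -opprD ww' -[RHS]addrA -opprD; congr (_ - _).
    by rewrite -addrA [w * w + _]addrC subrK.
  have h := ltW (hK K (leqnn K)); have h' := ltW (hK K.+1 (leqnSn K)).
  have w1 : ell1_norm w <= 1.
    by apply: le_trans (sqrt_iter_norm K) _; have /andP[] := real_iter01 K.
  rewrite add0r; apply: le_trans (ell1_normD _ _) _; rewrite ell1_normN.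
  have h1 : ell1_norm ((W - w) * W) <= e / 4.
    apply: le_trans (ell1_normM _ _) _; rewrite -[leRHS]mulr1.
    by apply: ler_pM; rewrite ?ell1_norm_ge0.
  have h2 : ell1_norm (w * (W - w)) <= e / 4.
    apply: le_trans (ell1_normM _ _) _; rewrite -[leRHS]mul1r.
    by apply: ler_pM; rewrite ?ell1_norm_ge0.
  apply: (@le_trans _ _ ((e / 4 + e / 4) + (e / 4 + e / 4))); last by lra.
  apply: lerD; apply: le_trans (ell1_normD _ _) _; exact: lerD.
move=> a Ta; apply/eqP; rewrite -subr_eq0; apply/eqP; apply: ell1_norm_eq0.
apply/ler_addgt0Pr => e e0; rewrite add0r.
have n1 : 0 < 2 * (ell1_norm a + 1) by rewrite mulr_gt0// ltr_wpDl ?ell1_norm_ge0.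
have [K hK] := hW _ (divr_gt0 e0 n1); have h := ltW (hK K (leqnn K)).
have -> : W * a - a * W = (W - sqrt_iter K) * a - a * (W - sqrt_iter K).
  by rewrite mulrBl mulrBr (sqrt_iter_comm K Ta) opprB subrKA.
apply: le_trans (ell1_normD _ _) _; rewrite ell1_normN.
have h1 := ell1_normM (W - sqrt_iter K) a.
have h2 := ell1_normM a (W - sqrt_iter K).
have h3 := ler_wpM2r (ell1_norm_ge0 a) h.
apply: le_trans (lerD h1 h2) _; rewrite [X in _ + X]mulrC.
apply: le_trans (lerD h3 h3) _.
rewrite [e in leRHS]splitr; suff h4 : e / (2 * (ell1_norm a + 1)) * ell1_norm a <= e / 2.
  exact: lerD.
rewrite -mulrA ler_wpM2l ?(ltW e0)// ler_pdivrMl//.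
by rewrite mulrAC divff ?pnatr_eq0// mul1r lerDl.
Qed.

End SquareRoot.

Lemma bump_identity (F : fieldType) (e e' z z' c u : F) : 2 != 0 :> F ->
  e * e' = 1 -> z * z' = 1 -> e + e' = 2 * c -> u = 2^-1 * (z + z') - c ->
  (1 - e * z) * (1 - e' * z) = 2 * z * u.
Proof.
move=> two0 ee zz ec ->.
have -> : 2 * z * (2^-1 * (z + z') - c) = z * z + z * z' - z * (2 * c) by field.
have -> : (1 - e * z) * (1 - e' * z) = 1 - z * (e + e') + e * e' * (z * z) by ring.
by rewrite zz ee ec; ring.
Qed.

(** * Bump elements on the circle *)

Section CircleBump.
Context {R : realType} {S : dynsys}.
Local Notation C := (Cplx R).
Local Notation A := (ell1 R S).
Variable p : nat.
Hypothesis p_gt0 : (0 < p)%N.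
Hypothesis orbits_of_order_p : forall x : S, (orbit_of x #= `I_p)%card.
Let act_per := act_period orbits_of_order_p.
Local Notation pi l1 x := (orbit_rep p_gt0 l1 act_per x).

Lemma unit_normc_inv (l : C) : normc l = 1 -> l^-1 = l^*%C.
Proof.
move=> l1; have l0 := unit_normc_neq0 l1.
by apply: (mulIf l0); rewrite mulVf// conjc_mul l1 expr1n.
Qed.

Lemma normc_conjc (z : C) : normc z^*%C = normc z.
Proof. by case: z => a b /=; rewrite sqrrN. Qed.

Lemma orbit_rep_delta (l : C) (l1 : normc l = 1) x h :
  pi l1 x (delta p%:Z) h = l *: h.
Proof.
by apply: qper_inj => j; rewrite orbit_rep_single mul1r qperP qperZ.
Qed.

Lemma orbit_rep_deltaN (l : C) (l1 : normc l = 1) x h :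
  pi l1 x (delta (- p%:Z)) h = l^*%C *: h.
Proof.
apply: qper_inj => j; rewrite orbit_rep_single mul1r qperZ opprK.
by rewrite -[p%:Z]mul1r qper_shift// exprN1 unit_normc_inv.
Qed.

(** A single [s] serves all l and x: it is 1 - W for T = m delta^q, central because sigma^q is the
    identity. The bound on 1 - r comes from the norm of W and later selects the branch of the
    root. *)
Lemma root_action (q : int) (m : C) : (forall y : S, act q y = y) -> normc m = 1 ->
  exists s : A, forall (l : C) (l1 : normc l = 1) x k,
    (forall h, pi l1 x (delta q) h = k *: h) ->
    exists r : C, [/\ r ^+ 2 = 1 - m * k, normc (1 - r) <= 1 &
      forall h, pi l1 x s h = r *: h].
Proof.
move=> qy m1; pose T : A := m *: delta q.
have T1 : ell1_norm T <= 1.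
  by apply: le_trans (ell1_normZ _ _) _; rewrite m1 mul1r ell1_norm_delta.
have [W [WT W1 Wc]] := ell1_sqrt T1.
have Wcentral a : W * a = a * W.
  by apply: Wc; rewrite /T -scalerAl -scalerAr delta_comm.
exists (1 - W) => l l1 x k hk.
have irr : alg_irreducible (pi l1 x) by exact: orbit_rep_irr.
have [w hw] := ell1_central_scalar irr Wcentral.
have w1 := le_trans (ell1_scalar_bound irr hw) W1.
exists (1 - w); split; last 2 first.
- by rewrite subKr.
- by move=> h; rewrite repB (rep1 irr) hw scalerBl scale1r.
have [a [v av]] := irr.1.
have v0 : v != 0 by apply/eqP => v0; apply: av; rewrite v0 linear0.
have : pi l1 x (W + W) v = pi l1 x (T + W * W) v by rewrite WT.
rewrite !repD rep_mul !hw repZ hk !scalerA -!scalerDl => /eqP.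
rewrite -subr_eq0 -scalerBl scaler_eq0 (negbTE v0) orbF subr_eq0 => /eqP ww.
by rewrite sqrrB expr1n mul1r mulr2n ww expr2; ring.
Qed.

(* [s] is the conjugate of [r] up to sign; the disc |1 - r| <= 1 lies in the half
   plane of nonnegative real part, which decides the sign. *)
Lemma root_conj_mul (a r s : C) : r ^+ 2 = a -> s ^+ 2 = a^*%C ->
  normc (1 - r) <= 1 -> normc (1 - s) <= 1 -> r * s = real_complex R (normc a).
Proof.
move=> ra sa r1 s1.
have na : normc a = normc r ^+ 2 by rewrite -ra !expr2 normcM.
have : s ^+ 2 = (r^*%C) ^+ 2 by rewrite sa -ra rmorphXn.
move/eqP; rewrite eqf_sqr => /orP[] /eqP sr.
  by rewrite sr mulrC conjc_mul na.
suff r0 : r = 0 by rewrite na r0 mul0r normc0 expr0n.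
move: r1 s1; rewrite sr; case: (r) => x y /=.
have le1 (t : R) : Num.sqrt t <= 1 -> 0 <= t -> t <= 1.
  by move=> t1 t0; rewrite -[t]sqr_sqrtr// exprn_ile1// sqrtr_ge0.
move=> /le1 h1 /le1 h2.
have := h1 (addr_ge0 (sqr_ge0 _) (sqr_ge0 _)).
have := h2 (addr_ge0 (sqr_ge0 _) (sqr_ge0 _)).
rewrite !opprK !sub0r !sqrrN sqrrB sqrrD expr1n !mul1r => e1 e2.
have x0 := sqr_ge0 x; have y0 := sqr_ge0 y.
have x2 : x ^+ 2 == 0 by rewrite eq_le x0 andbT; lra.
have y2 : y ^+ 2 == 0 by rewrite eq_le y0 andbT; lra.
by move: x2 y2; rewrite !sqrf_eq0 => /eqP -> /eqP ->.
Qed.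

(** delta^(-p) acts as the conjugate of l, so [root_action] at -p with the conjugate of m yields the
    conjugate root. *)
Lemma norm_action (m : C) : normc m = 1 ->
  exists s : A, forall (l : C) (l1 : normc l = 1) x h,
    pi l1 x s h = real_complex R (normc (1 - m * l)) *: h.
Proof.
move=> m1.
have actN (y : S) : act (- p%:Z) y = y by rewrite -[in LHS](act_per y) -actD addNr.
have [s hs] := root_action act_per m1.
have mc1 : normc m^*%C = 1 by rewrite normc_conjc.
have [t ht] := root_action actN mc1.
exists (s * t) => l l1 x h.
have [r [r2 r1 hr]] := hs l l1 x l (orbit_rep_delta l1 x).
have [r' [r'2 r'1 hr']] := ht l l1 x _ (orbit_rep_deltaN l1 x).
rewrite rep_mul hr' linearZ/= hr scalerA; congr (_ *: _).
rewrite mulrC; apply: root_conj_mul r2 _ r1 r'1.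
by rewrite r'2 rmorphB rmorph1 rmorphM.
Qed.

(* The function [u + |u|] of [l], where [u] is the real part of [l / l0] minus
   [c], is a bump at [l0]. With [z = l / l0] and [e = c + i sqrt (1 - c^2)] one
   has [2 z u = (1 - e z) (1 - e^* z)], so that [|u|] is a product of two
   functions obtained from [norm_action]. *)
Lemma circle_bump (l0 : C) (c : R) : normc l0 = 1 -> c ^+ 2 <= 1 ->
  exists g : A, forall (l : C) (l1 : normc l = 1) x h,
    let u := complex.Re (l * l0^*%C) - c in
    pi l1 x g h = real_complex R (u + `|u|) *: h.
Proof.
move=> l01 c1.
have [e e1 ec] : exists2 e : C, normc e = 1 & e + e^*%C = 2 * real_complex R c.
  exists (Complex c (Num.sqrt (1 - c ^+ 2))).
    by rewrite /= sqr_sqrtr ?subr_ge0// addrC subrK sqrtr1.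
  by apply/eqP; rewrite eq_complex/=; apply/andP; split; apply/eqP; ring.
have lc1 : normc l0^*%C = 1 by rewrite normc_conjc.
have el1 : normc (e * l0^*%C) = 1 by rewrite normcM e1 lc1 mulr1.
have ecl1 : normc (e^*%C * l0^*%C) = 1 by rewrite normcM normc_conjc e1 lc1 mulr1.
have [s hs] := norm_action el1; have [t ht] := norm_action ecl1.
pose two : C := 2^-1.
exists (two *: (l0^*%C *: delta p%:Z + l0 *: delta (- p%:Z)) - real_complex R c *: 1
  + two *: (s * t)).
move=> l l1 x h u.
have irr : alg_irreducible (pi l1 x) by exact: orbit_rep_irr.
have := orbit_rep_deltaN l1 x h; have := orbit_rep_delta l1 x h.
have := ht l l1 x h; have := hs l l1 x h; have := rep1 irr h.
move: {irr} (pi l1 x) => rho rho1 rs rt rd rdN.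
have rsZ k : rho s (k *: h) = k *: rho s h by exact: linearZ.
rewrite repD repB !repZ repD !repZ rep_mul rho1 rt rsZ rs rd rdN.
rewrite !scalerA -!scalerDl scalerA -scalerBl -scalerDl; congr (_ *: _).
pose z : C := l * l0^*%C.
have zz : z * z^*%C = 1.
  by rewrite mulrC conjc_mul normcM l1 lc1 mulr1 expr1n.
have z1 : normc z = 1 by rewrite normcM l1 lc1 mulr1.
have ee : e * e^*%C = 1 by rewrite mulrC conjc_mul e1 expr1n.
have two0 : (2 : C) != 0 by rewrite pnatr_eq0.
have uz : real_complex R u = two * (z + z^*%C) - real_complex R c.
  rewrite rmorphB/=; congr (_ - _); apply: (mulfI two0); rewrite mulrA mulfV// mul1r.
  by rewrite -/z; case: (z) => a b; apply/eqP; rewrite eq_complex/=;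
    apply/andP; split; apply/eqP; ring.
have n2 : normc (2 : C) = 2.
  have -> : (2 : C) = real_complex R 2 by rewrite rmorph_nat.
  by rewrite normc_real ger0_norm.
have nu : `|u| = 2^-1 * (normc (1 - e * l0^*%C * l) * normc (1 - e^*%C * l0^*%C * l)).
  rewrite -normcM.
  have -> : (1 - e * l0^*%C * l) * (1 - e^*%C * l0^*%C * l) = 2 * z * real_complex R u.
    rewrite -[e * _ * l]mulrA -[e^*%C * _ * l]mulrA [l0^*%C * l]mulrC -/z.
    exact: (bump_identity two0 ee zz ec uz).
  rewrite (normcM _ (real_complex R u)) (normcM 2 z) n2 z1 mulr1 (normc_real u).
  by rewrite mulrA mulVf ?mul1r.
rewrite rmorphD/= uz nu; congr (_ - _ + _).
  have zc : z^*%C = l^*%C * l0 by rewrite /z rmorphM/= conjcK.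
  by rewrite zc; congr (_ * (_ + _)); rewrite mulrC.
by rewrite !rmorphM fmorphV rmorph_nat -mulrA; congr (_ * _); exact: mulrC.
Qed.

End CircleBump.

(** * The topology of the structure space *)

Lemma normc_sqrB (R : realType) (z w : Cplx R) : normc (z - w) ^+ 2 =
  normc z ^+ 2 + normc w ^+ 2 - 2 * complex.Re (z * w^*%C).
Proof.
case: z w => [a b] [c d] /=.
by rewrite !sqr_sqrtr ?addr_ge0 ?sqr_ge0//; ring.
Qed.

Section OrbitSpace.
Variable S : dynsys.

Definition orbit_pi (x : S) : orbit_space S := \pi_({eq_quot (orbit_equiv S)})%qT x.

Lemma orbit_pi_surj (q : orbit_space S) : exists x, orbit_pi x = q.
Proof. by exists (repr q); exact: reprK. Qed.

Lemma orbit_piP x y : orbit_pi x = orbit_pi y <-> orbit_of x y.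
Proof.
split=> [/eqmodP /asboolP //|xy].
by apply/eqmodP/asboolP.
Qed.

Lemma orbit_pi_act n x : orbit_pi (act n x) = orbit_pi x.
Proof. by apply/esym/orbit_piP; exists n. Qed.

Lemma orbit_open (U : set (orbit_space S)) : open U = open (orbit_pi @^-1` U).
Proof. by []. Qed.

Lemma orbit_pi_open (W : set S) : open W -> open (orbit_pi @` W).
Proof.
move=> oW; rewrite orbit_open.
have -> : orbit_pi @^-1` (orbit_pi @` W) = \bigcup_n (act n @^-1` W).
  apply/seteqP; split=> x; last first.
    by move=> [n _ nx]; exists (act n x) => //; exact: orbit_pi_act.
  by move=> [y Wy /esym/orbit_piP[n _ nx]]; exists n => //=; rewrite nx.
apply: bigcup_open => n _; apply: open_comp => // x _; exact: act_continuous.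
Qed.

End OrbitSpace.

Arguments orbit_pi {S}.

Section UnitCircle.
Context {R : realType}.
Local Notation T := (unit_circle R).
Local Notation C := (Cplx R).

Definition circle_val (t : T) : C := set_val t.

Lemma circle_normc (t : T) : normc (circle_val t) = 1.
Proof.
have : Num.norm (circle_val t) = 1 := set_valP t.
by rewrite Defs.normcE => -[].
Qed.

Lemma circle_val_continuous : continuous circle_val.
Proof. exact: initial_continuous. Qed.

Lemma circle_val_inj : injective circle_val.
Proof. exact: val_inj. Qed.

Lemma circle_nbhs (t : T) (V : set T) : nbhs t V ->
  exists2 e : R, 0 < e & forall s, normc (circle_val s - circle_val t) < e -> V s.
Proof.
move=> [_ [[W oW <-] /= Wt] WV].
have : nbhs (circle_val t) W by exact: open_nbhs_nbhs.
move=> /nbhs_ballP[e e0 eW].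
have [r r0 re] : exists2 r : R, 0 < r & e = real_complex R r.
  have : (0 : C) < (e : C) := e0; case: (e : C) => a b; rewrite ltcE /=.
  by move=> /andP[/eqP -> a0]; exists a.
exists r => // s st; apply: WV => /=; apply: eW.
by rewrite /ball/= distrC Defs.normcE re ltcR.
Qed.

End UnitCircle.

Section StructureSpace.
Context {R : realType} {S : dynsys}.
Local Notation C := (Cplx R).
Local Notation A := (ell1 R S).
Local Notation T := (unit_circle R).
Variable p : nat.
Hypothesis p_gt0 : (0 < p)%N.
Hypothesis orbits_of_order_p : forall x : S, (orbit_of x #= `I_p)%card.
Let act_per := act_period orbits_of_order_p.
Local Notation rho x t := (orbit_rep p_gt0 (circle_normc t) act_per x).
Local Notation eps t := (qper_basis p_gt0 (circle_normc t)).

Lemma rep_kernel_primitive x (t : T) : primitive_ideal (rep_kernel (rho x t)).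
Proof. by exists (qper p (circle_val t)), (rho x t); split=> //; exact: orbit_rep_irr. Qed.

Definition orbit_ideal x t : structure_space A :=
  StructureSpace (rep_kernel_primitive x t).

Lemma orbit_idealP x t a : (orbit_ideal x t : set A) a <->
  forall i j, rho x t a (eps t i) j = 0.
Proof.
split=> [h i j|h v]; first by rewrite h.
rewrite (qper_basis_sum p_gt0 (circle_normc t) 0 v) linear_sum big1 // => i _.
by rewrite linearZ; apply: qper_inj => j; rewrite qperZ h mulr0.
Qed.

Lemma structure_space_eq (P Q : structure_space A) : (P : set A) = Q -> P = Q.
Proof.
case: P Q => [P hP] [Q hQ] /= PQ; rewrite PQ in hP *.
by congr StructureSpace; exact: Prop_irrelevance.
Qed.

(** Within the representation at x, [eps n] is already a joint eigenvector, with evaluation at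
    sigma^n x as its character. *)
Lemma orbit_ideal_act n x t : orbit_ideal (act n x) t = orbit_ideal x t.
Proof.
apply: structure_space_eq; apply/esym => /=.
apply: (@kernel_orbit_rep _ _ p p_gt0 orbits_of_order_p _ (rho x t) _ _ (act n x) (eps t n)).
- exact: orbit_rep_irr.
- exact: qper_basis0_neq0.
- exact: orbit_rep_delta.
- by move=> f cf; have := orbit_rep_basis p_gt0 orbits_of_order_p (circle_normc t) x 0 cf n;
    rewrite add0r.
Qed.

Lemma orbit_ideal_surj (P : structure_space A) : exists x t, P = orbit_ideal x t.
Proof.
have [E [r [irr Pr]]] := ideal_ofP P.
have [x [l [l1 h]]] := irreducible_kernel p_gt0 orbits_of_order_p irr.
have lT : [set z : C | Num.norm z = 1] l by rewrite /= Defs.normcE l1.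
exists x, (SigSub (mem_set lT)); apply: structure_space_eq.
rewrite Pr h /=; congr (rep_kernel (orbit_rep _ _ _ _)).
exact: Prop_irrelevance.
Qed.

(** A product of a circle bump at t0 and a Urysohn function f. Its coefficients involve f at every
    point of the orbit of x, which is why the whole orbit has to lie in K. *)
Lemma orbit_ideal_separate x0 (t0 : T) (K : set S) (d : R) : closed K -> ~ K x0 -> 0 < d ->
  exists a, ~ (orbit_ideal x0 t0 : set A) a /\ forall x t,
    (forall n, K (act n x)) \/ d <= normc (circle_val t - circle_val t0) ->
    (orbit_ideal x t : set A) a.
Proof.
move=> cK Kx0 d0; have [f [cf fx0 fK]] := @dynsys_urysohn R S K x0 cK Kx0.
(* On the circle Re (t / t0) = 1 - |t - t0|^2 / 2, so u <= 0 exactly when |t - t0| >= r, and u = r^2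
   / 2 at t0. Capping r at 1 keeps c^2 <= 1. *)
pose r := Num.min d 1; pose c := 1 - r ^+ 2 / 2.
have r0 : 0 < r by rewrite lt_min d0 ltr01.
have r1 : r <= 1 by rewrite ge_min lexx orbT.
have r2 : r ^+ 2 <= 1 by apply: exprn_ile1 => //; exact: ltW.
have r20 : 0 < r ^+ 2 by rewrite exprn_gt0.
have c1 : c ^+ 2 <= 1.
  by apply: exprn_ile1; rewrite /c; move: r2 r20; move: (r ^+ 2) => q *; lra.
have [g hg] := circle_bump p_gt0 orbits_of_order_p (circle_normc t0) c1.
have fg x t i j : rho x t (g * single 0 cf) (eps t i) j =
    real_complex R (complex.Re (circle_val t * (circle_val t0)^*%C) - c +
      `|complex.Re (circle_val t * (circle_val t0)^*%C) - c|) *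
    (f (act i x) * eps t i j).
  rewrite rep_mul hg qperZ (orbit_rep_basis p_gt0 orbits_of_order_p).
  by rewrite add0r qperZ.
exists (g * single 0 cf); split=> [/orbit_idealP /(_ 0 0)|x t h].
  have tt : circle_val t0 * (circle_val t0)^*%C = real_complex R 1.
    by rewrite mulrC conjc_mul circle_normc expr1n.
  rewrite fg tt fx0 qper_basis_diag !mulr1 => -[].
  have -> : 1 - c = r ^+ 2 / 2 by rewrite subKr.
  by rewrite ger0_norm ?divr_ge0 ?(ltW r20)// -splitr; apply/eqP; rewrite gt_eqF.
apply/orbit_idealP => i j; rewrite fg; case: h => [/(_ i) /fK ->|dt].
  by rewrite mul0r mulr0.
have u0 : complex.Re (circle_val t * (circle_val t0)^*%C) - c <= 0.
  have := normc_sqrB (circle_val t) (circle_val t0); rewrite !circle_normc.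
  have : r ^+ 2 <= normc (circle_val t - circle_val t0) ^+ 2.
    by rewrite ler_pXn2r ?nnegrE ?normc_nneg ?(ltW r0)// (le_trans _ dt)// ge_min lexx.
  rewrite /c; move: (normc _ ^+ 2) (complex.Re _) (r ^+ 2) => q x' y.
  by rewrite expr1n; lra.
by rewrite ler0_norm// subrr rmorph0 mul0r.
Qed.

Lemma orbit_rep_continuous (a : A) i j :
  continuous (fun z : S * T => rho z.1 z.2 a (eps z.2 i) j : C).
Proof.
apply: (has_sum_continuous (g := fun n z => a n (act j z.1) * eps z.2 i (j - n)) _ _
  (ell1_norm_bounded a)); last by move=> z; exact: orbit_rep_has_sum.
- move=> n; have c1 : continuous (fun z : S * T => a n (act j z.1)).
    move=> z; apply: (@continuous_comp _ _ _ (fun z : S * T => act j z.1) (a n)).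
      apply: (@continuous_comp _ _ _ (fst : S * T -> S) (act j)); first exact: cvg_fst.
      exact: act_continuous.
    exact: ell1_continuous.
  have c2 : continuous (fun z : S * T => eps z.2 i (j - n) : C).
    under eq_fun do rewrite qper_basisE.
    case: (p%:Z %| j - n - i)%Z; last exact: cst_continuous.
    apply: exprz_continuous; last first.
      by move=> z; apply: unit_normc_neq0; exact: circle_normc.
    move=> z; apply: (@continuous_comp _ _ _ (snd : S * T -> T) circle_val).
      exact: cvg_snd.
    exact: circle_val_continuous.
  by move=> z; apply: cvgM; [exact: c1 | exact: c2].
- move=> n z; rewrite normcM -[leRHS]mulr1.
  by rewrite ler_pM ?normc_nneg ?qper_basis_le1 ?le_supnorm//; exact: ell1_continuous.
Qed.

Lemma notin_orbit_ideal_near (a : A) x t : ~ (orbit_ideal x t : set A) a ->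
  \forall z \near (x, t), ~ (orbit_ideal z.1 z.2 : set A) a.
Proof.
move=> xta; have [i [j hij]] : exists i j, rho x t a (eps t i) j <> 0.
  apply: contrapT => h; apply: xta; apply/orbit_idealP => i j.
  by apply: contrapT => hij; apply: h; exists i, j.
have /cplx_continuousP/(_ (x, t) (normc (rho x t a (eps t i) j))) :=
  @orbit_rep_continuous a i j.
have n0 : 0 < normc (rho x t a (eps t i) j).
  by rewrite lt_neqAle normc_nneg andbT eq_sym; apply/eqP => /eq0_normc.
move=> /(_ n0); apply: filterS => z hz /orbit_idealP/(_ i j) z0.
by move: hz; rewrite z0 subr0 ltxx.
Qed.

Definition orbit_repr (q : orbit_space S) : S := sval (cid (orbit_pi_surj q)).

Lemma orbit_reprK q : orbit_pi (orbit_repr q) = q.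
Proof. exact: svalP (cid (orbit_pi_surj q)). Qed.

Definition ideal_at (y : orbit_space S * T) : structure_space A :=
  orbit_ideal (orbit_repr y.1) y.2.

Lemma ideal_at_pi x t : ideal_at (orbit_pi x, t) = orbit_ideal x t.
Proof.
have /orbit_piP[n _ nx] := orbit_reprK (orbit_pi x).
by rewrite -[in RHS]nx orbit_ideal_act.
Qed.

Lemma orbit_closed (x : S) : closed (orbit_of x).
Proof.
have /accessible_finite_set_closed := hausdorff_accessible (@dspace_hausdorff S).
by apply; apply/finite_setP; exists p; exact: orbits_of_order_p.
Qed.

Lemma ideal_at_inj : injective ideal_at.
Proof.
move=> [q t] [q' t'] qt.
have [x xq] := orbit_pi_surj q; have [x' xq'] := orbit_pi_surj q'.
move: qt; rewrite -xq -xq' !ideal_at_pi => qt.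
have xx' : orbit_pi x' = orbit_pi x.
  apply: contrapT => xx'.
  have ox : ~ orbit_of x' x by move=> /orbit_piP.
  (* With K the orbit of x' the radius is arbitrary; for the circle coordinate below K is empty and
     the radius decides. *)
  have [a [xa ha]] := orbit_ideal_separate t (@orbit_closed x') ox ltr01.
  by apply: xa; rewrite qt; apply: ha; left => n; exists n.
congr (_, _); first exact/esym.
apply: circle_val_inj; apply: contrapT => tt'.
have d0 : 0 < normc (circle_val t' - circle_val t).
  rewrite lt_neqAle normc_nneg andbT eq_sym; apply/eqP => /eq0_normc /eqP.
  by rewrite subr_eq0 => /eqP /esym.
have [a [xa ha]] := orbit_ideal_separate t closed0 (fun h : set0 x => h) d0.
by apply: xa; rewrite qt; apply: ha; right.
Qed.

Lemma ideal_at_surj P : exists y, ideal_at y = P.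
Proof.
have [x [t ->]] := orbit_ideal_surj P.
by exists (orbit_pi x, t); exact: ideal_at_pi.
Qed.

(** An element of all ideals outside V that is not in the given one stays out of nearby ideals,
    which are therefore in V. Nearness is obtained upstairs in X x T and descends because [orbit_pi]
    is open. *)
Lemma ideal_at_continuous : continuous ideal_at.
Proof.
apply/continuousP => V; rewrite open_hk => oV; rewrite openE => -[q t] /= Vqt.
have [x xq] := orbit_pi_surj q; rewrite -xq in Vqt *.
rewrite /= ideal_at_pi in Vqt.
have : ~ hk_closure (~` V) (orbit_ideal x t) by move=> /oV.
move=> /existsNP[a /not_implyP[aV xta]].
have [[W1 W2] [W1x W2t] W] := notin_orbit_ideal_near xta.
have nW : nbhs (orbit_pi x) (orbit_pi @` W1^°).
  apply: open_nbhs_nbhs; split; first by apply: orbit_pi_open; exact: open_interior.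
  by exists x => //; exact: nbhs_singleton (nbhs_interior W1x).
exists (orbit_pi @` W1^°, W2); first by split.
move=> [_ s] [/= [y W1y <-] W2s]; rewrite ideal_at_pi.
have nya : ~ (orbit_ideal y s : set A) a := W (y, s) (conj (interior_subset W1y) W2s).
by apply: contrapT => nV; apply: nya; exact: (aV (orbit_ideal y s) nV).
Qed.

(** To keep a point of the image out of the closure of the complement, one element outside its ideal
    must lie in all ideals off the image; [orbit_ideal_separate] gives it, with K the saturated
    complement of a neighbourhood. *)
Lemma ideal_at_open (U : set (orbit_space S * T)) : open U -> open (ideal_at @` U).
Proof.
move=> oU; rewrite open_hk => P PU [[q t] Uqt qtP].
have [x xq] := orbit_pi_surj q; rewrite -xq in Uqt qtP.
have : nbhs (orbit_pi x, t) U by exact: open_nbhs_nbhs.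
move=> [[V1 V2] [/= V1x V2t] V].
have [d d0 dV] := circle_nbhs V2t.
have cK : closed (~` (orbit_pi @^-1` V1^°)).
  apply: open_closedC; rewrite -orbit_open; exact: open_interior.
have nx : ~ (~` (orbit_pi @^-1` V1^°)) x.
  have V1x' : nbhs (orbit_pi x) V1 := V1x.
  by move=> h; exact: h (nbhs_singleton (nbhs_interior V1x')).
have [a [xa ha]] := orbit_ideal_separate t cK nx d0.
apply: xa; rewrite -ideal_at_pi qtP; apply: PU => Q /= nQ.
have [[q' s] qsQ] := ideal_at_surj Q; have [y yq'] := orbit_pi_surj q'.
rewrite -qsQ -yq' ideal_at_pi; apply: ha.
have [yV|yV] := pselect (V1^° (orbit_pi y)); last by left => n /=; rewrite orbit_pi_act.
right; rewrite leNgt; apply/negP => sd; apply: nQ; exists (q', s) => //.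
rewrite -yq'; apply: V; split=> /=; first exact: interior_subset yV.
exact: dV.
Qed.

End StructureSpace.

Theorem corollary5p12 (R : realType) (Sigma : dynsys) (p : nat)
    (p_ge1 : (1 <= p)%N)
    (orbits_of_order_p : forall x : Sigma, (orbit_of x #= `I_p)%card) :
  homeomorphic (structure_space (ell1 R Sigma))
    (orbit_space Sigma * unit_circle R)%type.
Proof.
pose g := @ideal_at R Sigma p p_ge1 orbits_of_order_p.
have /choice[f fK] : forall P, exists y, g y = P by exact: ideal_at_surj.
have gK : cancel g f.
  by move=> y; apply: (@ideal_at_inj R Sigma p p_ge1 orbits_of_order_p); exact: fK.
exists f, g; split=> //; last exact: ideal_at_continuous.
apply/continuousP => U oU.
suff -> : f @^-1` U = g @` U by exact: ideal_at_open.
apply/seteqP; split=> [P /= Ufp|_ [y Uy <-]]; first by exists (f P).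
by rewrite /= gK.
Qed.
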